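(* Let $N\in\mathbb{N}$, $\rho$, a symmetric positive-definite matrix $C\in\mathbb{R}^{N\times N}$ and $\mu\in\mathbb{R}^N$ be fixed. Suppose that, for every $M\in\mathbb{N}$, a model as described in the context is given such that (i) almost surely, $\mathbb{E}\left[\exp\left(\alpha^\top C^{-1/2}(E-\mathbb{E}[E\mid Y])\right)\,\middle|\,Y\right]\le \exp\left(\|\alpha\|_2^2/2\right)$ for all $\alpha\in\mathbb{R}^N$; (ii) $|(\mathbb{E}[E\mid Y])_i|\le\mu_i$ almost surely for $1\le i\le N$; (iii) $C_{YY}^{-1/2}Y$ is a $\rho$-sub-Gaussian random vector. Let $n=n(M)$ be such that $\lim_{M\to\infty}M/n(M)=\gamma$ for some $0<\gamma<1/(c^2\rho^4)$, where $c>0$ is the absolute constant described in the context. Then, almost surely, $$\limsup_{M\to\infty}\mathbb{E}_Y\left[\|\hat\Theta^\top Y-\Theta_*^\top Y\|_2^2\right]\le\varepsilon_{\mathrm{err}}^\gamma+\varepsilon_{\mathrm{bias}}^\gamma,$$ where $$\varepsilon_{\mathrm{err}}^\gamma:=\frac{\operatorname{tr}(C)\,\gamma}{(1-c\rho^2\sqrt\gamma)^2}\quad\text{and}\quad\varepsilon_{\mathrm{bias}}^\gamma:=\frac{(3/2)\rho^2\|\mu\|_2^2\,\gamma}{(1-c\rho^2\sqrt\gamma)^4}.$$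
   Context: Model (for each $M$; all objects may depend on $M$ unless stated otherwise). $X$ (values in $\mathbb{R}^N$) and $Z$ (values in $\mathbb{R}^M$) are independent, square integrable random vectors with mean zero and invertible covariance matrices $C_{XX}$, $C_{ZZ}$, whose laws have continuous densities with respect to Lebesgue measure. $A\in\mathbb{R}^{M\times N}$ is a fixed matrix, $Y:=AX+Z$, and $C_{YY}$ is the covariance matrix of $Y$. The matrix $\Theta_*\in\mathbb{R}^{M\times N}$ is defined by $\Theta_*^\top:=(A^\top C_{ZZ}^{-1}A+C_{XX}^{-1})^{-1}A^\top C_{ZZ}^{-1}$ (so $y\mapsto\Theta_*^\top y$ is the linear minimum mean squared error estimator of $X$ from $Y$), and $E:=X-\Theta_*^\top Y$ is the estimation error. $\{(X_i,Y_i)\}_{i=1}^n$ are $n=n(M)$ independent samples of $(X,Y)$. The matrices $\boldsymbol{X}\in\mathbb{R}^{n\times N}$ and $\boldsymbol{Y}\in\mathbb{R}^{n\times M}$ have rows $X_i^\top$ and $Y_i^\top$. The least squares estimator is given by the minimizer $\hat\Theta$ of $\frac1n\|\boldsymbol{Y}\Theta-\boldsymbol{X}\|_F^2$ over $\Theta\in\mathbb{R}^{M\times N}$; if $\boldsymbol{Y}$ is injective it is unique and $\hat\Theta=(\boldsymbol{Y}^\top\boldsymbol{Y})^{-1}\boldsymbol{Y}^\top\boldsymbol{X}$. $\mathbb{E}_Y$ denotes expectation over a fresh $Y$ independent of the samples, with the samples held fixed; the resulting quantity is a random variable depending on the samples. The sequence (over $M$) of these random variables is considered on a common probability space. $\|\cdot\|_2$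 is the Euclidean norm for vectors and the spectral norm for matrices. A real random variable $V$ is sub-Gaussian with parameter $\sigma\ge0$ if $\mathbb{E}[e^{\lambda(V-\mathbb{E}V)}]\le e^{\sigma^2\lambda^2/2}$ for all $\lambda\in\mathbb{R}$. A random vector $V$ is $\sigma$-sub-Gaussian if $a^\top V$ is sub-Gaussian with parameter $\sigma$ for every unit vector $a$. The constant $c>0$ is an absolute constant with the following property (such a constant exists): for all $n,M$, every $\rho$, every random $n\times M$ matrix $W$ whose rows are independent $\rho$-sub-Gaussian isotropic (identity covariance) random vectors in $\mathbb{R}^M$, and every $t\ge0$, with probability at least $1-2e^{-t}$, $\sqrt n-c\rho^2(\sqrt M+\sqrt t)\le\sigma_{\min}(W)\le\sigma_{\max}(W)\le\sqrt n+c\rho^2(\sqrt M+\sqrt t)$, where $\sigma_{\min},\sigma_{\max}$ are the minimal and maximal singular values. *)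

(* Defs.v *)
From HB Require Import structures.
From mathcomp Require Import all_boot all_order all_algebra.
From mathcomp Require Import all_classical all_reals all_analysis.

Set Implicit Arguments.
Unset Strict Implicit.
Unset Printing Implicit Defensive.
Import Order.TTheory GRing.Theory Num.Theory numFieldNormedType.Exports.
Local Open Scope classical_set_scope.
Local Open Scope ring_scope.

Section LinearAlgebra.
Context {R : realType}.

Definition norm2 n (v : 'cV[R]_n) : R := Num.sqrt (\sum_i v i ord0 ^+ 2).

Definition frobenius_sq m n (B : 'M[R]_(m, n)) : R := \sum_i \sum_j B i j ^+ 2.

Definition posdef n (C : 'M[R]_n) : Prop :=
  C^T = C /\
  forall x : 'cV[R]_n, x != 0 -> 0 < (x^T *m C *m x) ord0 ord0.

(* The positive definite square root of C; junk (0) unless C is positive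
   definite. *)
Definition sqrtmx n (C : 'M[R]_n) : 'M[R]_n :=
  xget 0 [set S | posdef S /\ S *m S = C].

Definition singular_values m n (W : 'M[R]_(m, n)) : set R :=
  [set s | 0 <= s /\ eigenvalue (W^T *m W) (s ^+ 2)].

(* n singular values are counted for an m x n matrix, so that sigma_min W = 0
   when W is not injective. *)
Definition sigma_min m n (W : 'M[R]_(m, n)) : R := inf (singular_values W).
Definition sigma_max m n (W : 'M[R]_(m, n)) : R := sup (singular_values W).

End LinearAlgebra.

(* Measurable structure on matrices: the sigma-algebra generated by the entries,
   as the library does for tuples. For entries in R it is the Borel
   sigma-algebra of R^(m * n). *)
Definition measure_matrix_display : measure_display -> measure_display.
Proof. exact. Qed.

Section MeasurableMatrix.
Context {d} {T : measurableType d} (m n : nat).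

Definition g_sigma_entries : set (set 'M[T]_(m, n)) :=
  <<s \bigcup_(ij in [set: 'I_m * 'I_n])
        preimage_set_system setT (fun B : 'M[T]_(m, n) => B ij.1 ij.2)
          measurable >>.

Let entries_set0 : g_sigma_entries set0.
Proof. exact: sigma_algebra0. Qed.

Let entries_setC B : g_sigma_entries B -> g_sigma_entries (~` B).
Proof. exact: sigma_algebraC. Qed.

Let entries_bigcup (F : (set 'M[T]_(m, n))^nat) :
  (forall i, g_sigma_entries (F i)) -> g_sigma_entries (\bigcup_i (F i)).
Proof. exact: sigma_algebra_bigcup. Qed.


HB.instance Definition _ := @isMeasurable.Build (measure_matrix_display d)
  'M[T]_(m, n) g_sigma_entries entries_set0 entries_setC entries_bigcup.

End MeasurableMatrix.

Section LebesgueVector.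
Context {R : realType}.

Definition cons_col n (xv : R * 'cV[R]_n) : 'cV[R]_n.+1 :=
  col_mx xv.1%:M xv.2 : 'cV[R]_(1 + n).

Lemma measurable_entry d (T : measurableType d) m n (i : 'I_m) (j : 'I_n) :
  measurable_fun [set: 'M[T]_(m, n)] (fun B => B i j).
Proof.
move=> _ U mU; apply: sub_sigma_algebra.
by exists (i, j) => //; exists U.
Qed.

Lemma measurable_matrixP d d' (S : measurableType d) (T : measurableType d')
    m n (f : S -> 'M[T]_(m, n)) :
  (forall i j, measurable_fun setT (fun x => f x i j)) -> measurable_fun setT f.
Proof.
move=> mf; apply: (@measurability _ _ _ _ setT f) => //.
move=> _ [U [[i j] _ [B mB <-]] <-].
by rewrite !setTI; have := mf i j measurableT B mB; rewrite setTI.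
Qed.

Lemma measurable_cons_col n : measurable_fun setT (@cons_col n).
Proof.
apply: measurable_matrixP => i j.
case: (split_ordP (i : 'I_(1 + n))) => k ->.
- have -> : (fun xv : R * 'cV[R]_n => cons_col xv (lshift n k) j) = fst.
    apply/funext => xv.
    by rewrite [LHS](col_mxEu xv.1%:M xv.2 k j) mxE !ord1 eqxx mulr1n.
  exact: measurable_fst.
- have -> : (fun xv : R * 'cV[R]_n => cons_col xv (rshift 1 k) j) =
            (fun xv => xv.2 k j).
    by apply/funext => xv; exact: (col_mxEd xv.1%:M xv.2 k j).
  exact: (measurableT_comp (measurable_entry k j) measurable_snd).
Qed.

Definition lebesgue_cons n (mu : {measure set 'cV[R]_n -> \bar R}) :
    {measure set 'cV[R]_n.+1 -> \bar R} :=
  measure_function_pushforward__canonical__measure_function_Measure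
    (lebesgue_measure \x^ mu)%E (@measurable_cons_col n).

(* Lebesgue measure on R^n, as an iterated product; R^0 is a single point. *)
Fixpoint lebesgue_vec n : {measure set 'cV[R]_n -> \bar R} :=
  if n is n'.+1 then lebesgue_cons (lebesgue_vec n') else \d_(0 : 'cV[R]_0).

End LebesgueVector.

Section Probability.
Context {R : realType}.
Local Open Scope ereal_scope.

Definition independent_RV d d1 d2 (T : measurableType d)
    (T1 : measurableType d1) (T2 : measurableType d2) (P : probability T R)
    (U : T -> T1) (V : T -> T2) : Prop :=
  forall (A : set T1) (B : set T2), measurable A -> measurable B ->
    P (U @^-1` A `&` V @^-1` B) = P (U @^-1` A) * P (V @^-1` B).

Definition mutually_independent_RV d d' (T : measurableType d)
    (T' : measurableType d') (P : probability T R) n (U : 'I_n -> T -> T') :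
    Prop :=
  forall (J : {set 'I_n}) (A : 'I_n -> set T'),
    (forall i, measurable (A i)) ->
    P (\bigcap_(i in [set` J]) (U i @^-1` A i)) =
    \prod_(i in J) P (U i @^-1` A i).

Definition same_law d1 d2 d' (T1 : measurableType d1) (T2 : measurableType d2)
    (T' : measurableType d') (P1 : probability T1 R) (P2 : probability T2 R)
    (U : T1 -> T') (V : T2 -> T') : Prop :=
  forall A : set T', measurable A -> P1 (U @^-1` A) = P2 (V @^-1` A).

Section OneSpace.
Context d (T : measurableType d) (P : probability T R).

Definition coordinate n (V : T -> 'cV[R]_n) (i : 'I_n) (w : T) : R :=
  V w i ord0.

Definition square_integrable n (V : T -> 'cV[R]_n) : Prop :=
  forall i, coordinate V i \in Lfun P 2%:E.

Definition mean_zero n (V : T -> 'cV[R]_n) : Prop :=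
  forall i, 'E_P[coordinate V i] = 0.

Definition covmx n (V : T -> 'cV[R]_n) : 'M[R]_n :=
  \matrix_(i, j) fine (covariance P (coordinate V i) (coordinate V j)).

Definition has_continuous_density n (V : T -> 'cV[R]_n) : Prop :=
  exists f : 'cV[R]_n -> R,
    [/\ continuous f, (forall x, 0 <= f x)%R &
      forall A, measurable A ->
        P (V @^-1` A) = \int[lebesgue_vec n]_(x in A) (f x)%:E].

Definition subgaussian (sigma : R) (V : T -> R) : Prop :=
  [/\ (0 <= sigma)%R, P.-integrable setT (EFin \o V) &
    forall lambda : R,
      'E_P[fun w => expR (lambda * (V w - fine 'E_P[V]))] <=
      (expR (sigma ^+ 2 * lambda ^+ 2 / 2))%:E].

Definition subgaussian_vec (sigma : R) n (V : T -> 'cV[R]_n) : Prop :=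
  forall a : 'cV[R]_n, norm2 a = 1%R ->
    subgaussian sigma (fun w => (a^T *m V w) ord0 ord0).

(* G is a version of the conditional expectation E[V | Y]. *)
Definition cond_expectation d' (T' : measurableType d') (Y : T -> T')
    (V G : T -> R) : Prop :=
  [/\ P.-integrable setT (EFin \o V), P.-integrable setT (EFin \o G),
    (forall B, measurable B -> g_sigma_algebra_preimage Y (G @^-1` B)) &
    forall D, g_sigma_algebra_preimage Y D ->
      \int[P]_(w in D) (G w)%:E = \int[P]_(w in D) (V w)%:E].

End OneSpace.

(* c satisfies the two-sided bound for the extreme singular values of random
   matrices with independent sub-Gaussian isotropic rows. Isotropic random
   vectors are centred: for a large deterministic mean no c would do. *)
Definition singular_value_constant (c : R) : Prop :=
  forall d (T : measurableType d) (P : probability T R) (n M : nat) (rho : R)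
    (W : 'I_n -> {RV P >-> 'cV[R]_M}),
  (0 < n)%N -> (0 < M)%N ->
  mutually_independent_RV P W ->
  (forall i, [/\ subgaussian_vec P rho (W i), mean_zero P (W i) &
                 covmx P (W i) = 1%:M]) ->
  let Wmx w : 'M[R]_(n, M) := \matrix_(i, j) W i w j ord0 in
  forall t : R, (0 <= t)%R ->
  (1 - 2 * expR (- t))%:E <=
  P [set w |
      let r := (c * rho ^+ 2 * (Num.sqrt M%:R + Num.sqrt t))%R in
      [/\ (Num.sqrt n%:R - r <= sigma_min (Wmx w))%R,
          (sigma_min (Wmx w) <= sigma_max (Wmx w))%R &
          (sigma_max (Wmx w) <= Num.sqrt n%:R + r)%R]].

End Probability.

Section Model.
Context {R : realType} d (T : measurableType d) (P : probability T R).
Context (N M : nat) (A : 'M[R]_(M, N)).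
Context (X : {RV P >-> 'cV[R]_N}) (Z : {RV P >-> 'cV[R]_M}).

Definition centered_with_density n (V : {RV P >-> 'cV[R]_n}) : Prop :=
  [/\ square_integrable P V, mean_zero P V, covmx P V \in unitmx &
      has_continuous_density P V].

Definition linear_model : Prop :=
  [/\ independent_RV P X Z, centered_with_density X & centered_with_density Z].

Definition observation (w : T) : 'cV[R]_M := A *m X w + Z w.

Definition Theta_star : 'M[R]_(M, N) :=
  let CX := covmx P X in let CZ := covmx P Z in
  (invmx (A^T *m invmx CZ *m A + invmx CX) *m A^T *m invmx CZ)^T.

Definition estimation_error (w : T) : 'cV[R]_N :=
  X w - Theta_star^T *m observation w.

End Model.

Section Sampling.
Context {R : realType} (N M n : nat).

Definition iid_samples d d' (T : measurableType d) (Omega : measurableType d')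
    (P : probability T R) (Q : probability Omega R)
    (X : T -> 'cV[R]_N) (Y : T -> 'cV[R]_M)
    (S : 'I_n -> {RV Q >-> ('cV[R]_N * 'cV[R]_M)%type}) : Prop :=
  mutually_independent_RV Q S /\
  forall i, same_law Q P (S i) (fun w => (X w, Y w)).

Definition sample_X d' (Omega : measurableType d')
    (S : 'I_n -> Omega -> 'cV[R]_N * 'cV[R]_M) (w : Omega) : 'M[R]_(n, N) :=
  \matrix_(i, j) (S i w).1 j ord0.

Definition sample_Y d' (Omega : measurableType d')
    (S : 'I_n -> Omega -> 'cV[R]_N * 'cV[R]_M) (w : Omega) : 'M[R]_(n, M) :=
  \matrix_(i, j) (S i w).2 j ord0.

Definition least_squares (Xs : 'M[R]_(n, N)) (Ys : 'M[R]_(n, M))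
    (Theta : 'M[R]_(M, N)) : Prop :=
  forall Theta' : 'M[R]_(M, N),
    n%:R^-1 * frobenius_sq (Ys *m Theta - Xs) <=
    n%:R^-1 * frobenius_sq (Ys *m Theta' - Xs).

End Sampling.

Definition eps_err {R : realType} (c rho gamma : R) N (C : 'M[R]_N) : R :=
  \tr C * gamma / (1 - c * rho ^+ 2 * Num.sqrt gamma) ^+ 2.

Definition eps_bias {R : realType} (c rho gamma : R) N (mu : 'cV[R]_N) : R :=
  3 / 2 * rho ^+ 2 * norm2 mu ^+ 2 * gamma /
  (1 - c * rho ^+ 2 * Num.sqrt gamma) ^+ 4.

(* Main.v *)
(* Put W = Ys C_YY^{-1/2}, whose rows are independent, isotropic and sub-Gaussian.
   Column k of C_YY^{1/2} (Theta_hat - Theta_star) is W^+ (xi + b), where b_i is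
   the value of (E[E | Y])_k at the i-th sample and xi_i, the remaining noise, is
   sub-Gaussian with variance proxy C_kk conditionally on the Y-samples; the
   error of the statement is the sum over k of its squared norms. On the event
   sigma_min(W) >= s, which has probability at least 1 - 2 exp(- delta M), the
   exponential moments of <a, W^+ xi> conditionally on the Y-samples bound
   |W^+ xi|^2 by about C_kk M / s^2. For the bias, |W^+ b| <= |W^T b| / s^2, and
   W^T b is a sum of independent centred vectors: E is orthogonal to Y, and
   exp y - y <= cosh (sqrt (3/2) y) turns |b_i| <= mu_k into a sub-Gaussian bound
   with variance proxy (3/2) rho^2 mu_k^2, which explains the constant 3/2. The
   cross term is linear in xi, hence negligible. All exceptional probabilities
   decay geometrically in M, so Borel-Cantelli applies. *)

Require Import Defs.
From HB Require Import structures.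
From mathcomp Require Import all_boot all_order all_algebra.
From mathcomp Require Import all_classical all_reals all_analysis.
From mathcomp Require Import measurable_realfun normal_distribution ring lra.

Set Implicit Arguments.
Unset Strict Implicit.
Unset Printing Implicit Defensive.
Import Order.TTheory GRing.Theory Num.Theory numFieldNormedType.Exports.
Local Open Scope classical_set_scope.
Local Open Scope ring_scope.

(** * Quadratic forms, extreme eigenvalues and square roots of symmetric matrices *)

Section QuadraticForms.
Context {R : realType}.
Implicit Types (n m : nat).

(** No conditional law is ever constructed. A conditional expectation given the observation is
    replaced by a Borel function of it, which can be evaluated at samples living on another
    probability space, and a conditional bound becomes an identity between integrals over preimages.
    The obstacle is that the directions fed to the conditional moment bound come from the
    pseudo-inverse, hence are functions of the very samples conditioned on; they are frozen on
    countably many cells and the cells are refined. The detour of the bias through W^T b is forced: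
    |W^+ b| <= |b| / s would leave a multiple of |mu|^2 without the factor gamma. The detour gains
    this factor and costs a fourth power in the denominator. Variance proxies are kept in the shape
    tau / M with tau independent of M. Exponential Markov with a parameter proportional to M then
    gives tails q^M, where q depends only on a tolerance and on a margin for s / sqrt n; these two
    are relaxed along a countable sequence at the very end. *)

Definition dotv n (x y : 'cV[R]_n) : R := (x^T *m y) ord0 ord0.
Definition qform n (B : 'M[R]_n) (x : 'cV[R]_n) : R := dotv x (B *m x).
Definition psd n (B : 'M[R]_n) : Prop := B^T = B /\ forall x, 0 <= qform B x.

Lemma dotvE n (x y : 'cV[R]_n) : dotv x y = \sum_i x i ord0 * y i ord0.
Proof. by rewrite /dotv mxE; apply: eq_bigr => i _; rewrite mxE. Qed.

Lemma mul_tr_dotv n (x y : 'cV[R]_n) : x^T *m y = (dotv x y)%:M.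
Proof. by apply/matrixP => i j; rewrite !ord1 [RHS]mxE eqxx mulr1n. Qed.

Lemma dotvC n (x y : 'cV[R]_n) : dotv x y = dotv y x.
Proof. by rewrite !dotvE; apply: eq_bigr => i _; rewrite mulrC. Qed.

Lemma dotvDl n (x y z : 'cV[R]_n) : dotv (x + y) z = dotv x z + dotv y z.
Proof. by rewrite /dotv linearD mulmxDl mxE. Qed.

Lemma dotvDr n (x y z : 'cV[R]_n) : dotv z (x + y) = dotv z x + dotv z y.
Proof. by rewrite /dotv mulmxDr mxE. Qed.

Lemma dotvZl n a (x z : 'cV[R]_n) : dotv (a *: x) z = a * dotv x z.
Proof. by rewrite /dotv linearZ -scalemxAl mxE. Qed.

Lemma dotvZr n a (x z : 'cV[R]_n) : dotv z (a *: x) = a * dotv z x.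
Proof. by rewrite /dotv -scalemxAr mxE. Qed.

Lemma dotvNr n (x z : 'cV[R]_n) : dotv z (- x) = - dotv z x.
Proof. by rewrite -scaleN1r dotvZr mulN1r. Qed.

Lemma dotv_mull n m (B : 'M[R]_(n, m)) (x : 'cV[R]_m) (y : 'cV[R]_n) :
  dotv (B *m x) y = dotv x (B^T *m y).
Proof. by rewrite /dotv trmx_mul mulmxA. Qed.

Lemma dotvv_sqr n (x : 'cV[R]_n) : dotv x x = \sum_i x i ord0 ^+ 2.
Proof. by rewrite dotvE; apply: eq_bigr => i _; rewrite expr2. Qed.

Lemma dotvv_ge0 n (x : 'cV[R]_n) : 0 <= dotv x x.
Proof. by rewrite dotvv_sqr sumr_ge0 // => i _; rewrite sqr_ge0. Qed.

Lemma dotvv_eq0 n (x : 'cV[R]_n) : (dotv x x == 0) = (x == 0).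
Proof.
apply/idP/eqP => [|->]; last by rewrite /dotv mulmx0 mxE.
rewrite dotvv_sqr psumr_eq0 => [/allP x0|i _]; last by rewrite sqr_ge0.
apply/colP => i; rewrite mxE; apply/eqP.
by have := x0 i (mem_index_enum i); rewrite sqrf_eq0.
Qed.

Lemma dotvv_gt0 n (x : 'cV[R]_n) : (0 < dotv x x) = (x != 0).
Proof. by rewrite lt_neqAle dotvv_ge0 andbT eq_sym dotvv_eq0. Qed.

Lemma norm2_sqr n (x : 'cV[R]_n) : norm2 x ^+ 2 = dotv x x.
Proof. by rewrite /norm2 sqr_sqrtr -dotvv_sqr // dotvv_ge0. Qed.

Lemma qformE n (B : 'M[R]_n) x :
  qform B x = \sum_i \sum_j B i j * (x i ord0 * x j ord0).
Proof.
rewrite /qform dotvE; apply: eq_bigr => i _; rewrite mxE mulr_sumr.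
by apply: eq_bigr => j _; rewrite mulrCA.
Qed.

Lemma posdef_qform n (B : 'M[R]_n) :
  posdef B <-> B^T = B /\ forall x, x != 0 -> 0 < qform B x.
Proof. by split=> -[? h]; split=> // x /h; rewrite /qform /dotv mulmxA. Qed.

Lemma qform_bounded n (B : 'M[R]_n) :
  exists2 K, 0 <= K & forall x, `|qform B x| <= K * dotv x x.
Proof.
exists (\sum_i \sum_j `|B i j|).
  by apply: sumr_ge0 => i _; apply: sumr_ge0 => j _.
move=> x; rewrite qformE mulr_suml; apply: le_trans (ler_norm_sum _ _ _) _.
apply: ler_sum => i _; rewrite mulr_suml.
apply: le_trans (ler_norm_sum _ _ _) _; apply: ler_sum => j _.
rewrite normrM ler_wpM2l //.
have le1 k : x k ord0 ^+ 2 <= dotv x x.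
  rewrite dotvv_sqr (bigD1 k) //= lerDl sumr_ge0 // => l _.
  by rewrite sqr_ge0.
have := le1 i; have := le1 j; rewrite ler_norml => h1 h2.
by apply/andP; split; nra.
Qed.

Lemma qformB_scalar n (B : 'M[R]_n) a x :
  qform (B - a%:M) x = qform B x - a * dotv x x.
Proof. by rewrite /qform mulmxBl mul_scalar_mx dotvDr dotvNr dotvZr. Qed.

Lemma psd_cauchy_schwarz n (B : 'M[R]_n) x y : psd B ->
  dotv x (B *m y) ^+ 2 <= qform B x * qform B y.
Proof.
move=> [Bs Bp].
have key t : 0 <= qform B x + t * (2 * dotv x (B *m y)) + t ^+ 2 * qform B y.
  have := Bp (x + t *: y); rewrite /qform mulmxDr dotvDl !dotvDr.
  rewrite -!scalemxAr !dotvZl !dotvZr.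
  have -> : dotv y (B *m x) = dotv x (B *m y).
    by rewrite dotvC dotv_mull Bs.
  by move=> h; apply: le_trans h _; rewrite le_eqVlt; apply/orP; left;
     apply/eqP; ring.
set b := dotv _ _ in key *; set a := qform B x in key *.
set c := qform B y in key *.
have c0 : 0 <= c by exact: Bp.
have [c00|cn0] := eqVneq c 0.
  rewrite c00 mulr0 in key *.
  have [->|bn0] := eqVneq b 0; first by rewrite expr0n.
  (* With [qform B y = 0] the bound is affine in [t]; at this [t] it would equal [-1]. *)
  have := key (- (a + 1) / (2 * b)); rewrite mulr0 addr0.
  have -> : - (a + 1) / (2 * b) * (2 * b) = - (a + 1).
    by rewrite mulfVK // mulf_neq0.
  by rewrite opprD addrA subrr sub0r ler0N1.
have cp : 0 < c by rewrite lt_neqAle eq_sym cn0.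
(* The minimizer of the quadratic polynomial in [t]. *)
have := key (- b / c).
have -> : a + - b / c * (2 * b) + (- b / c) ^+ 2 * c = (a * c - b ^+ 2) / c.
  by field.
by rewrite pmulr_lge0 ?invr_gt0 // subr_ge0.
Qed.

Lemma psd_qform_eq0 n (B : 'M[R]_n) x : psd B -> qform B x = 0 -> B *m x = 0.
Proof.
move=> Bp Bx0; apply/eqP; rewrite -dotvv_eq0.
have := psd_cauchy_schwarz (B *m x) x Bp.
by rewrite Bx0 mulr0 -/(dotv _ _) => h; rewrite -sqrf_eq0 eq_le h sqr_ge0.
Qed.

(** Coercivity without compactness: Cauchy-Schwarz for [B] between [x] and [invmx B *m x] bounds the
    fourth power of the norm of [x] by [qform B x * qform (invmx B) x], and the last factor is at
    most [K * dotv x x]. *)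
Lemma psd_unit_lower n (B : 'M[R]_n) : psd B -> B \in unitmx ->
  exists2 e, 0 < e & forall x, e * dotv x x <= qform B x.
Proof.
move=> Bp Bu; have [K K0 hK] := qform_bounded (invmx B).
exists (K + 1)^-1; first by rewrite invr_gt0 ltr_wpDl.
move=> x; rewrite mulrC ler_pdivrMr ?ltr_wpDl //.
have [->|xn0] := eqVneq x 0.
  by rewrite /qform !mulmx0 /dotv mulmx0 mxE mul0r.
have xp : 0 < dotv x x by rewrite dotvv_gt0.
have := psd_cauchy_schwarz x (invmx B *m x) Bp.
rewrite {2}/qform !mulKVmx // (dotvC (invmx B *m x)) -/(qform _ _) => h.
have h2 : qform (invmx B) x <= K * dotv x x by apply: le_trans (hK x); rewrite ler_norm.
have q0 : 0 <= qform B x by case: Bp.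
rewrite -(ler_pM2r xp) -expr2; apply: le_trans h _.
rewrite -mulrA; apply: ler_wpM2l => //; apply: le_trans h2 _.
by rewrite ler_wpM2r ?(ltW xp) // lerDl.
Qed.

(** The extremal constant is the supremum of the lower bounds of the Rayleigh quotient. It is an
    eigenvalue, for otherwise [B - (sup L)%:M] would be positive semidefinite and invertible, hence
    coercive, and the supremum could be raised. *)
Lemma symmetric_min_eigen n (B : 'M[R]_n.+1) : B^T = B ->
  exists l, (forall x, l * dotv x x <= qform B x) /\
            exists2 v : 'cV_n.+1, v != 0 & B *m v = l *: v.
Proof.
move=> Bs; have [K K0 hK] := qform_bounded B.
pose L := [set l | forall x, l * dotv x x <= qform B x].
have Lne : L !=set0.
  exists (- K) => x; have := hK x; rewrite ler_norml mulNr => /andP[] //.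
pose e : 'cV[R]_n.+1 := delta_mx ord0 ord0.
have ee : 0 < dotv e e.
  rewrite dotvv_gt0; apply/eqP => /matrixP/(_ ord0 ord0).
  by rewrite !mxE => /eqP; rewrite oner_eq0.
have Lub : ubound L (qform B e / dotv e e).
  by move=> l Ll; rewrite ler_pdivlMr //; exact: Ll.
have Lsup : has_sup L by split=> //; exists (qform B e / dotv e e).
exists (sup L).
have supL : forall x, sup L * dotv x x <= qform B x.
  move=> x; have [->|xn0] := eqVneq x 0.
    by rewrite /qform !mulmx0 /dotv mulmx0 mxE mulr0.
  have xp : 0 < dotv x x by rewrite dotvv_gt0.
  rewrite -ler_pdivlMr //; apply: ge_sup => // l Ll.
  by rewrite ler_pdivlMr //; exact: Ll.
split => //.
pose D := B - (sup L)%:M.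
have Dp : psd D.
  split; first by rewrite /D linearB /= tr_scalar_mx Bs.
  by move=> x; rewrite qformB_scalar subr_ge0.
have Dnu : D \notin unitmx.
  apply/negP => /(psd_unit_lower Dp)[eps e0 he].
  have : L (sup L + eps).
    by move=> x; have := he x; rewrite qformB_scalar mulrDl lerBrDl.
  move=> /(ub_le_sup (proj2 Lsup)); rewrite gerDl => h.
  by have := lt_le_trans e0 h; rewrite ltxx.
have : D^T \notin unitmx by rewrite unitmx_tr.
rewrite -row_free_unit -kermx_eq0 => /rowV0Pn[v /sub_kermxP vD v0].
exists v^T; first by rewrite -(trmx_eq0 v^T) trmxK.
have : D *m v^T = 0 by rewrite -(trmxK D) -trmx_mul vD trmx0.
by rewrite mulmxBl mul_scalar_mx => /eqP; rewrite subr_eq0 => /eqP.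
Qed.

Lemma symmetric_max_eigen n (B : 'M[R]_n.+1) : B^T = B ->
  exists l, (forall x, qform B x <= l * dotv x x) /\
            exists2 v : 'cV_n.+1, v != 0 & B *m v = l *: v.
Proof.
move=> Bs; have [|l [hl [v v0 Bv]]] := @symmetric_min_eigen n (- B).
  by rewrite linearN /= Bs.
exists (- l); split=> [x|].
  by have := hl x; rewrite /qform mulNmx dotvNr lerNr mulNr.
exists v => //; apply/eqP; rewrite scaleNr -eqr_oppLR -mulNmx.
exact/eqP.
Qed.

Lemma symmetric_qform_eq0 n (B : 'M[R]_n) : B^T = B ->
  (forall x, qform B x = 0) -> B = 0.
Proof.
move=> Bs B0; have Bp : psd B by split=> // x; rewrite B0.
apply/matrixP => i j.
have /matrixP/(_ i ord0) := psd_qform_eq0 Bp (B0 (delta_mx j ord0)).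
by rewrite -colE !mxE.
Qed.

(** Deflation, by induction on the rank: the top eigenvector [v] is split off through the projection
    [V]. The remainder [B'] has smaller rank and kills [v], so the square roots of the two parts
    annihilate each other and can be added. *)
Lemma psd_sqrt n (B : 'M[R]_n) : psd B -> exists2 S, psd S & S *m S = B.
Proof.
have [r] := ubnP (\rank B); elim: r => // r IH in n B *.
rewrite ltnS => rB Bp.
have [->|Bn0] := eqVneq B 0.
  exists 0; last by rewrite mulmx0.
  by split=> [|x]; rewrite ?trmx0 // /qform mul0mx /dotv mulmx0 mxE.
case: n => [|n] in B rB Bp Bn0 *.
  by rewrite flatmx0 eqxx in Bn0.
have [Bs Bge] := Bp.
have [l [hl [v v0 Bv]]] := symmetric_max_eigen Bs.
have l0 : 0 < l.
  rewrite lt_neqAle; apply/andP; split; last first.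
    have := Bge v; rewrite /qform Bv dotvZr pmulr_lge0 // dotvv_gt0 //.
  apply: contraNneq Bn0 => l0; apply/eqP; apply: symmetric_qform_eq0 => // x.
  by apply/eqP; rewrite eq_le Bge andbT; have := hl x; rewrite -l0 mul0r.
have vp : 0 < dotv v v by rewrite dotvv_gt0.
pose V : 'M[R]_n.+1 := (dotv v v)^-1 *: (v *m v^T).
have Vs : V^T = V by rewrite /V linearZ /= trmx_mul trmxK.
have Vv : V *m v = v.
  rewrite /V -scalemxAl -mulmxA mul_tr_dotv mul_mx_scalar scalerA mulVf ?scale1r //.
  by rewrite gt_eqF.
have VV : V *m V = V.
  by rewrite {2}/V -scalemxAr mulmxA Vv.
have VB : V *m B = l *: V.
  rewrite -[LHS]trmxK trmx_mul Vs Bs {1}/V -scalemxAr mulmxA Bv.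
  by rewrite -scalemxAl scalerA mulrC -scalerA linearZ /= -/V Vs.
have BV : B *m V = l *: V.
  by rewrite -[LHS]trmxK trmx_mul Vs Bs VB linearZ /= Vs.
pose B' := B - l *: V.
have B'E : B' = (1%:M - V) *m B by rewrite mulmxBl mul1mx VB.
have qV x : qform V x = (dotv v v)^-1 * dotv v x ^+ 2.
  rewrite /qform -scalemxAl dotvZr -mulmxA mul_tr_dotv mul_mx_scalar dotvZr.
  by rewrite (dotvC x) expr2.
have B'v : B' *m v = 0 by rewrite mulmxBl Bv -scalemxAl Vv subrr.
have B'p : psd B'.
  split=> [|x]; first by rewrite linearB linearZ /= Vs Bs.
  have Vx : qform B' x = qform B (x - V *m x).
    have Bx : B *m (x - V *m x) = B' *m x.
      by rewrite mulmxBr mulmxA BV -mulmxBl.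
    have VB'x : V *m (B' *m x) = 0.
      by rewrite mulmxA mulmxBr VB -scalemxAr VV subrr mul0mx.
    rewrite /qform Bx dotvDl -scaleN1r dotvZl dotv_mull Vs VB'x.
    by rewrite [X in _ * X]/dotv mulmx0 mxE mulr0 addr0.
  by rewrite Vx.
have rB' : (\rank B' < r)%N.
  apply: leq_trans rB.
  have sB' : (B' <= B)%MS by rewrite B'E submxMl.
  (* Equal ranks would put the row space of [B] inside that of [B'], whence [B *m v = 0]. *)
  rewrite ltn_neqAle (mxrankS sB') andbT; apply/eqP => eqr.
  have : (B' == B)%MS by rewrite -(mxrank_leqif_eq sB'); exact/eqP.
  move=> /andP[_ /submxP[D BD]].
  have : B *m v = 0 by rewrite BD -mulmxA B'v mulmx0.
  by rewrite Bv => /eqP; rewrite scaler_eq0 (negPf v0) gt_eqF.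
have [S' [S's S'p] S'S'] := IH _ B' rB' B'p.
have S'v : S' *m v = 0.
  apply/eqP; rewrite -dotvv_eq0 dotv_mull S's mulmxA S'S' B'v.
  by rewrite /dotv mulmx0 mxE.
have S'V : S' *m V = 0 by rewrite /V -scalemxAr mulmxA S'v mul0mx scaler0.
have VS' : V *m S' = 0 by rewrite -[LHS]trmxK trmx_mul Vs S's S'V trmx0.
clearbody V; exists (S' + Num.sqrt l *: V).
  split=> [|x]; first by rewrite linearD linearZ /= S's Vs.
  rewrite /qform mulmxDl dotvDr -scalemxAl dotvZr -/(qform V x) qV.
  rewrite addr_ge0 ?S'p // mulr_ge0 ?sqrtr_ge0 // mulr_ge0 ?sqr_ge0 //.
  by rewrite invr_ge0 ltW.
rewrite mulmxDl !mulmxDr -!scalemxAl -!scalemxAr S'V VS' VV S'S' !scaler0.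
by rewrite add0r addr0 scalerA -expr2 sqr_sqrtr ?ltW // subrK.
Qed.

Lemma posdef_unit n (B : 'M[R]_n) : posdef B -> B \in unitmx.
Proof.
move=> /posdef_qform[Bs Bp]; rewrite -unitmx_tr -row_free_unit -kermx_eq0.
apply/rowV0P => v /sub_kermxP vB; apply/eqP; rewrite -trmx_eq0.
apply: contraTT isT => v0; have := Bp _ v0.
by rewrite /qform -(trmxK B) -trmx_mul vB trmx0 /dotv mulmx0 mxE ltxx.
Qed.

Lemma posdef_psd n (B : 'M[R]_n) : posdef B -> psd B.
Proof.
move=> /posdef_qform[Bs Bp]; split=> // x; have [->|/Bp/ltW//] := eqVneq x 0.
by rewrite /qform !mulmx0 /dotv mulmx0 mxE.
Qed.

Lemma psd_unit_posdef n (B : 'M[R]_n) : psd B -> B \in unitmx -> posdef B.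
Proof.
move=> Bp Bu; apply/posdef_qform; split; first by case: Bp.
move=> x xn0; have [e e0 he] := psd_unit_lower Bp Bu.
by apply: lt_le_trans (he x); rewrite mulr_gt0 // dotvv_gt0.
Qed.

Lemma sqrtmxP n (B : 'M[R]_n) : posdef B ->
  posdef (sqrtmx B) /\ sqrtmx B *m sqrtmx B = B.
Proof.
move=> Bp; have [S Sp SS] := psd_sqrt (posdef_psd Bp).
have Su : S \in unitmx.
  by have := posdef_unit Bp; rewrite -SS unitmx_mul => /andP[].
apply: (@xgetPex _ 0 [set S | posdef S /\ S *m S = B]).
by exists S; split => //; exact: psd_unit_posdef.
Qed.

Lemma gram_qform m n (W : 'M[R]_(m, n)) x :
  qform (W^T *m W) x = dotv (W *m x) (W *m x).
Proof. by rewrite /qform -mulmxA -dotv_mull. Qed.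

Lemma gram_sym m n (W : 'M[R]_(m, n)) : (W^T *m W)^T = W^T *m W.
Proof. by rewrite trmx_mul trmxK. Qed.

Lemma sym_eigenvalueP n (B : 'M[R]_n) a : B^T = B ->
  eigenvalue B a <-> exists2 v : 'cV_n, v != 0 & B *m v = a *: v.
Proof.
move=> Bs; split=> [/eigenvalueP[v vB v0]|[v v0 Bv]].
  exists v^T; first by rewrite trmx_eq0.
  by rewrite -{1}Bs -trmx_mul vB linearZ.
apply/eigenvalueP; exists v^T; last by rewrite trmx_eq0.
by rewrite -{1}Bs -trmx_mul Bv linearZ.
Qed.

Lemma singular_values_rayleigh m n (W : 'M[R]_(m, n)) s : singular_values W s ->
  0 <= s /\ exists2 v : 'cV_n, v != 0 &
    dotv (W *m v) (W *m v) = s ^+ 2 * dotv v v.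
Proof.
move=> [s0 /(sym_eigenvalueP _ (gram_sym W))[v v0 Wv]]; split=> //.
by exists v => //; rewrite -gram_qform /qform Wv dotvZr.
Qed.

(** The index [n.+1] excludes matrices without columns, which have no singular value and whose
    infimum would be a default value. *)
Lemma sigma_minE m n (W : 'M[R]_(m, n.+1)) :
  singular_values W (sigma_min W) /\
  forall x, sigma_min W ^+ 2 * dotv x x <= dotv (W *m x) (W *m x).
Proof.
have [l [hl [v v0 Wv]]] := symmetric_min_eigen (gram_sym W).
have vp : 0 < dotv v v by rewrite dotvv_gt0.
have l0 : 0 <= l.
  have := dotvv_ge0 (W *m v); rewrite -gram_qform /qform Wv dotvZr.
  by rewrite pmulr_lge0.
have sl : singular_values W (Num.sqrt l).
  split; first exact: sqrtr_ge0.
  by rewrite sqr_sqrtr //; apply/(sym_eigenvalueP _ (gram_sym W)); exists v.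
have lb : lbound (singular_values W) (Num.sqrt l).
  move=> s /singular_values_rayleigh[s0 [u u0 us]].
  rewrite -(ler_pXn2r (n := 2)) ?nnegrE ?sqrtr_ge0 // sqr_sqrtr //.
  have := hl u; rewrite gram_qform us ler_pM2r ?dotvv_gt0 //.
have -> : sigma_min W = Num.sqrt l.
  apply/eqP; rewrite eq_le; apply/andP; split.
    by apply: ge_inf => //; exists (Num.sqrt l).
  by apply: lb_le_inf => //; exists (Num.sqrt l).
by split=> // x; rewrite sqr_sqrtr // -gram_qform.
Qed.

Lemma sigma_maxE m n (W : 'M[R]_(m, n.+1)) :
  singular_values W (sigma_max W) /\
  forall x, dotv (W *m x) (W *m x) <= sigma_max W ^+ 2 * dotv x x.
Proof.
have [l [hl [v v0 Wv]]] := symmetric_max_eigen (gram_sym W).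
have vp : 0 < dotv v v by rewrite dotvv_gt0.
have l0 : 0 <= l.
  have := dotvv_ge0 (W *m v); rewrite -gram_qform /qform Wv dotvZr.
  by rewrite pmulr_lge0.
have sl : singular_values W (Num.sqrt l).
  split; first exact: sqrtr_ge0.
  by rewrite sqr_sqrtr //; apply/(sym_eigenvalueP _ (gram_sym W)); exists v.
have ub : ubound (singular_values W) (Num.sqrt l).
  move=> s /singular_values_rayleigh[s0 [u u0 us]].
  rewrite -(ler_pXn2r (n := 2)) ?nnegrE ?sqrtr_ge0 // sqr_sqrtr //.
  have := hl u; rewrite gram_qform us ler_pM2r ?dotvv_gt0 //.
have -> : sigma_max W = Num.sqrt l.
  apply/eqP; rewrite eq_le; apply/andP; split.
    by apply: ge_sup => //; exists (Num.sqrt l).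
  by apply: ub_le_sup => //; exists (Num.sqrt l).
by split=> // x; rewrite sqr_sqrtr // -gram_qform.
Qed.

Lemma sigma_min_le_max m n (W : 'M[R]_(m, n.+1)) : sigma_min W <= sigma_max W.
Proof.
have [/singular_values_rayleigh[s0 [v v0 hv]] _] := sigma_minE W.
have [[t0 _] ht] := sigma_maxE W.
have := ht v; rewrite hv ler_pM2r ?dotvv_gt0 //.
by rewrite ler_pXn2r ?nnegrE.
Qed.

(** The Rayleigh form of the event: it yields the coercivity used for the pseudo-inverse and, tested
    on rational vectors, measurability. *)
Lemma le_sigma_min m n (W : 'M[R]_(m, n.+1)) s : 0 <= s ->
  s <= sigma_min W <->
  forall x, s ^+ 2 * dotv x x <= dotv (W *m x) (W *m x).
Proof.
move=> s0; have [/singular_values_rayleigh[t0 [v v0 hv]] ht] := sigma_minE W.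
split=> [st x|h].
  by apply: le_trans (ht x); rewrite ler_wpM2r ?dotvv_ge0 // ler_pXn2r ?nnegrE.
by have := h v; rewrite hv ler_pM2r ?dotvv_gt0 // ler_pXn2r ?nnegrE.
Qed.

Lemma ge_sigma_max m n (W : 'M[R]_(m, n.+1)) s : 0 <= s ->
  sigma_max W <= s <->
  forall x, dotv (W *m x) (W *m x) <= s ^+ 2 * dotv x x.
Proof.
move=> s0; have [/singular_values_rayleigh[t0 [v v0 hv]] ht] := sigma_maxE W.
split=> [st x|h].
  by apply: le_trans (ht x) _; rewrite ler_wpM2r ?dotvv_ge0 // ler_pXn2r ?nnegrE.
by have := h v; rewrite hv ler_pM2r ?dotvv_gt0 // ler_pXn2r ?nnegrE.
Qed.

End QuadraticForms.

(** * Comparison of integrals, from preimages to nonnegative weights *)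

Section WeightedIntegrals.
Local Open Scope ereal_scope.
Context {R : realType} d d' (T : measurableType d) (T' : measurableType d').
Import HBNNSimple.

(** A substitute for conditional expectation: domination of [w1] by [w2] on the events generated by
    [f] extends to all nonnegative functions of [f], by simple functions and monotone convergence.
    Since all terms are nonnegative, the integrals may be infinite. *)
Lemma le_integral_weighted (mu : {measure set T -> \bar R}) (f : T -> T')
    (w1 w2 : T -> R) (g : T' -> \bar R) :
  measurable_fun setT f -> measurable_fun setT w1 -> measurable_fun setT w2 ->
  (forall x, 0 <= w1 x)%R -> (forall x, 0 <= w2 x)%R ->
  (forall B, measurable B -> \int[mu]_(x in f @^-1` B) (w1 x)%:E <=
                             \int[mu]_(x in f @^-1` B) (w2 x)%:E) ->
  measurable_fun setT g -> (forall y, 0 <= g y) ->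
  \int[mu]_x (g (f x) * (w1 x)%:E) <= \int[mu]_x (g (f x) * (w2 x)%:E).
Proof.
move=> mf mw1 mw2 w10 w20 w12 mg g0.
have mpre (h : {nnsfun T' >-> R}) y : measurable (f @^-1` (h @^-1` [set y])).
  by rewrite -[X in measurable X]setTI; apply: mf => //.
have simpleE (h : {nnsfun T' >-> R}) (w : T -> R) : measurable_fun setT w ->
    (forall x, 0 <= w x)%R ->
    \int[mu]_x ((h (f x))%:E * (w x)%:E) = \sum_(y \in range h)
      (y%:E * \int[mu]_(x in f @^-1` (h @^-1` [set y])) (w x)%:E).
  move=> mw w0.
  have mw' y : measurable_fun setT
      ((EFin \o w) \_ (f @^-1` (h @^-1` [set y]))).
    apply/(measurable_restrictT _ _).1 => //.
    by apply: measurable_funTS; exact/measurable_EFinP.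
  have w'0 y x : 0 <= ((EFin \o w) \_ (f @^-1` (h @^-1` [set y]))) x.
    by apply: erestrict_ge0 => x' _; rewrite lee_fin.
  transitivity (\int[mu]_x \sum_(y \in range h)
      (y%:E * ((EFin \o w) \_ (f @^-1` (h @^-1` [set y]))) x)).
    apply: eq_integral => x _.
    rewrite (fsbigD1 (h (f x))) //=; last by exists (f x).
    rewrite patchT ?inE // fsbig1 ?adde0 // => y [_ /= /eqP yh].
    by rewrite patchN ?mule0 // notin_setE /= => /esym /eqP; rewrite (negPf yh).
  rewrite ge0_integral_fsum //.
  - apply: eq_fsbigr => y /set_mem[z _ <-].
    by rewrite [in RHS]integral_mkcond ge0_integralZl // lee_fin.
  - by move=> y; apply: emeasurable_funM.
  - move=> y x _; have [yh|yh] := pselect ((range h) y).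
      by case: yh => z _ <-; apply: mule_ge0; rewrite // lee_fin.
    rewrite patchN ?mule0 // notin_setE /= => hy; apply: yh.
    by exists (f x).
have lim (w : T -> R) : measurable_fun setT w -> (forall x, 0 <= w x)%R ->
    \int[mu]_x ((nnsfun_approx measurableT mg n (f x))%:E * (w x)%:E) @[n --> \oo]
    --> \int[mu]_x (g (f x) * (w x)%:E).
  move=> mw w0.
  rewrite [X in _ --> X](_ : _ = \int[mu]_x
      limn (fun n => (nnsfun_approx measurableT mg n (f x))%:E * (w x)%:E)).
    apply: cvg_monotone_convergence => //.
    - move=> n; apply: emeasurable_funM; apply/measurable_EFinP => //.
      exact: measurableT_comp mf.
    - by move=> n x _; apply: mule_ge0; rewrite ?lee_fin.
    - move=> x _ m n mn; apply: lee_wpmul2r; rewrite ?lee_fin //.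
      exact/lefP/nd_nnsfun_approx.
  apply: eq_integral => x _; apply/esym/cvg_lim => //.
  apply: cvgeZr => //.
  exact: (@cvg_nnsfun_approx _ _ _ _ measurableT _ mg (fun y _ => g0 y) (f x) I).
have l1 := lim _ mw1 w10; have l2 := lim _ mw2 w20.
rewrite -(cvg_lim _ l1) // -(cvg_lim _ l2) //; apply: lee_lim.
- by apply/cvg_ex; eexists; exact: l1.
- by apply/cvg_ex; eexists; exact: l2.
apply: nearW => n; rewrite !simpleE //; apply: lee_fsum => // y [z _ <-].
by apply: lee_wpmul2l; [rewrite lee_fin|exact: w12].
Qed.

Lemma eq_integral_weighted (mu : {measure set T -> \bar R}) (f : T -> T')
    (w1 w2 : T -> R) (g : T' -> \bar R) :
  measurable_fun setT f -> measurable_fun setT w1 -> measurable_fun setT w2 ->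
  (forall x, 0 <= w1 x)%R -> (forall x, 0 <= w2 x)%R ->
  (forall B, measurable B -> \int[mu]_(x in f @^-1` B) (w1 x)%:E =
                             \int[mu]_(x in f @^-1` B) (w2 x)%:E) ->
  measurable_fun setT g -> (forall y, 0 <= g y) ->
  \int[mu]_x (g (f x) * (w1 x)%:E) = \int[mu]_x (g (f x) * (w2 x)%:E).
Proof.
move=> mf mw1 mw2 w10 w20 w12 mg g0; apply/eqP; rewrite eq_le.
by apply/andP; split; apply: le_integral_weighted => // B mB; rewrite w12.
Qed.

End WeightedIntegrals.

(** * Factorization of measurable functions through the observation *)

Section DoobDynkin.
Context {R : realType} d d' (T : measurableType d) (T' : measurableType d').

(* h y is the infimum of the rationals q with y in B_q, where
   B_q witnesses that {V < q} is in the sigma-algebra generated by Y. *)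
Lemma doob_dynkin (Y : T -> T') (V : T -> R) :
  (forall B, measurable B -> g_sigma_algebra_preimage Y (V @^-1` B)) ->
  exists2 h : T' -> R, measurable_fun setT h & forall w, V w = h (Y w).
Proof.
move=> mV.
have /choice[B hB] : forall q : rat, exists B : set T',
    measurable B /\ Y @^-1` B = [set w | V w < ratr q].
  move=> q; have := mV [set` `]-oo, (ratr q : R)[] (measurable_itv _).
  move=> [B mB BE]; exists B; split => //; rewrite setTI in BE.
  by rewrite BE; apply/seteqP; split => w /=; rewrite in_itv.
(* The rationals are enumerated by [unpickle]; an index without a rational contributes [+oo], which
   is neutral for the infimum. *)
pose f n y : \bar R := if unpickle n is Some q then
  (if y \in B q then (ratr q)%:E else +oo)%E else +oo%E.
have mf n : measurable_fun setT (f n).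
  rewrite /f; case: unpickle => [q|]; last exact: measurable_cst.
  apply: measurable_fun_ifT => //.
  apply: (measurable_fun_bool true); rewrite setTI.
  rewrite [X in measurable X](_ : _ = B q); first by case: (hB q).
  by apply/seteqP; split => y /=; [move/set_mem|move/mem_set].
pose h0 y := einfs (fun n => f n y) 0%N.
have h0V w : h0 (Y w) = (V w)%:E.
  have BV q : B q (Y w) <-> V w < ratr q.
    have [_ Bq] := hB q; split => [Bw|Vw].
      by have : (Y @^-1` B q) w by []; rewrite Bq.
    by have : [set w | V w < ratr q] w by []; rewrite -Bq.
  apply/eqP; rewrite eq_le; apply/andP; split.
    apply/lee_addgt0Pr => e e0.
    have [|q] := @rat_in_itvoo _ (V w) (V w + e); first by rewrite ltrDl.
    rewrite in_itv /= => /andP[qV qe].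
    apply: (@le_trans _ _ (ratr q)%:E); last by rewrite -EFinD lee_fin ltW.
    apply: ereal_inf_lbound; exists (pickle q) => //=.
    by rewrite /f pickleK; case: ifPn => // /negP[]; apply/mem_set/BV.
  apply: le_ereal_inf_tmp => _ [n _ <-]; rewrite /f.
  case: unpickle => [q|]; last exact: leey.
  case: ifPn => [/set_mem /BV Vq|_]; last exact: leey.
  by rewrite lee_fin ltW.
(* Off the range of [Y] the infimum may be infinite; [fine] gives it the value [0] there. *)
exists (fine \o h0); last by move=> w; rewrite /= h0V.
apply: measurableT_comp; first exact: fine_measurable.
exact: measurable_fun_einfs.
Qed.

End DoobDynkin.

(** * Product formulas for independent variables *)

Section Independence.
Local Open Scope ereal_scope.
Context {R : realType} d (T : measurableType d) (P : probability T R).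

Lemma integral_probability_cst (r : R) : \int[P]_w r%:E = r%:E.
Proof. by rewrite integral_cst // [X in _ * X]probability_setT mule1. Qed.

Lemma integral_comp_indic d' (T' : measurableType d') (U : T -> T') (B : set T') :
  measurable_fun setT U -> measurable B ->
  \int[P]_w (\1_B (U w))%:E = P (U @^-1` B).
Proof.
move=> mU mB; have mUB : measurable (U @^-1` B).
  by rewrite -[X in measurable X]setTI; exact: mU.
transitivity (\int[P]_w (\1_(U @^-1` B) w)%:E).
  by [].
by rewrite integral_indic // setIT.
Qed.

Lemma integral_preimage_indic d' (T' : measurableType d') (U : T -> T')
    (B : set T') (w : T -> R) :
  \int[P]_(x in U @^-1` B) (w x)%:E = \int[P]_x (\1_B (U x) * w x)%:E.
Proof.
rewrite integral_mkcond; apply: eq_integral => x _; rewrite indicE.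
have [xB|xB] := boolP (U x \in B).
  by rewrite patchT ?mul1r // inE; exact/set_mem.
by rewrite patchN ?mul0r // notin_setE /= => Bx; case/negP: xB; exact/mem_set.
Qed.

(** Induction on a bound [k] beyond which all factors are indicators. For indicators the formula is
    independence itself; factor [k] is freed by [eq_integral_weighted], comparing the product of the
    other factors with its mean on the events of [U k]. *)
Lemma independent_integral_prod d' (T' : measurableType d') n
    (U : 'I_n -> T -> T') (f : 'I_n -> T' -> R) :
  mutually_independent_RV P U -> (forall i, measurable_fun setT (U i)) ->
  (forall i, measurable_fun setT (f i)) -> (forall i y, 0 <= f i y)%R ->
  (forall i, \int[P]_w (f i (U i w))%:E < +oo) ->
  \int[P]_w (\prod_i f i (U i w))%:E = \prod_i \int[P]_w (f i (U i w))%:E.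
Proof.
move=> indU mU.
suff H k : forall f : 'I_n -> T' -> R,
    (forall i, measurable_fun setT (f i)) -> (forall i y, 0 <= f i y)%R ->
    (forall i, \int[P]_w (f i (U i w))%:E < +oo) ->
    (forall i : 'I_n, (k <= i)%N -> exists2 A, measurable A & f i = \1_A) ->
    \int[P]_w (\prod_i f i (U i w))%:E = \prod_i \int[P]_w (f i (U i w))%:E.
  move=> mf f0 foo; apply: (H n) => // i; by rewrite leqNgt ltn_ord.
elim: k => [|k IH] {}f mf f0 foo fA.
  have /choice[A hA] : forall i, exists A, measurable A /\ f i = \1_A.
    by move=> i; have [//|A mA fiA] := fA i; exists A.
  have mA i : measurable (A i) by case: (hA i).
  have fiA i : f i = \1_(A i) by case: (hA i).
  have mUA i : measurable (U i @^-1` A i).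
    by rewrite -[X in measurable X]setTI; exact: mU.
  under [RHS]eq_bigr do rewrite fiA integral_comp_indic //.
  have := indU (finset.setTfor 'I_n) A mA.
  rewrite [X in _ = X -> _](_ : _ = \prod_i P (U i @^-1` A i)); last first.
    by apply: eq_bigl => i; rewrite finset.in_setT.
  move=> <-; rewrite -[X in P X]setIT -integral_indic //; last first.
    by apply: fin_bigcap_measurable.
  apply: eq_integral => w _; congr EFin; rewrite indicE.
  under eq_bigr do rewrite fiA indicE.
  have [/set_mem h|h] := boolP (w \in _).
    rewrite big1 // => i _; rewrite mem_set //; apply: (h i).
    by rewrite /= finset.in_setT.
  apply/eqP; rewrite prodf_seq_eq0; apply: contraNT h => /hasPn h.
  apply/mem_set => i _ /=; apply/set_mem.
  by have := h i (mem_index_enum i); rewrite /= pnatr_eq0 eqb0 negbK.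
have [nk|kn] := leqP n k.
  apply: IH => // i ki; have := leq_ltn_trans ki (ltn_ord i).
  by rewrite ltnNge nk.
pose i0 := Ordinal kn.
pose f1 B i := if i == i0 then \1_B else f i : T' -> R.
pose w1 x := (\prod_(i | i != i0) f i (U i x))%R.
(* The mean of the other factors, a real number because every factor has a finite integral. *)
pose c := fine (\prod_(i | i != i0) \int[P]_w (f i (U i w))%:E).
have fin i : \int[P]_w (f i (U i w))%:E \is a fin_num.
  by rewrite ge0_fin_numE // integral_ge0 // => x _; rewrite lee_fin.
have cE : c%:E = \prod_(i | i != i0) \int[P]_w (f i (U i w))%:E.
  by rewrite fineK //; apply: prode_fin_num.
have c0 : (0 <= c)%R.
  apply: fine_ge0; apply: prode_ge0 => i _; apply: integral_ge0 => x _.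
  by rewrite lee_fin.
have mw1 : measurable_fun setT w1.
  rewrite /w1; under eq_fun do rewrite big_mkcond /=.
  apply: measurable_prod => i _; case: (i != i0) => //.
  exact: measurableT_comp.
rewrite (bigD1 i0) //= -cE.
under eq_integral do rewrite (bigD1 i0) //= EFinM.
rewrite (@eq_integral_weighted _ _ _ _ _ P (U i0) w1 (cst c)
  (EFin \o f i0)) //=.
- rewrite ge0_integralZr // => [|x _]; last by rewrite lee_fin.
  by apply/measurable_EFinP; exact: measurableT_comp.
- by move=> x; apply: prodr_ge0 => i _.
- move=> B mB; rewrite integral_cst; last first.
    by rewrite -[X in measurable X]setTI; exact: mU.
  rewrite integral_preimage_indic.
  transitivity (\int[P]_x (\prod_i f1 B i (U i x))%:E).
    apply: eq_integral => x _; rewrite [in RHS](bigD1 i0) //= /f1 eqxx.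
    congr (_ * _)%:E; apply: eq_bigr => i /negPf -> //.
  have f1i i : i != i0 -> f1 B i = f i by rewrite /f1 => /negPf ->.
  have f1i0 : f1 B i0 = \1_B by rewrite /f1 eqxx.
  rewrite (IH (f1 B)).
  + rewrite (bigD1 i0) //= f1i0 integral_comp_indic // muleC; congr (_ * _).
    by rewrite cE; apply: eq_bigr => i /f1i ->.
  + move=> i; have [->|/f1i ->//] := eqVneq i i0; rewrite f1i0.
    exact: measurable_indic.
  + by move=> i y; have [->|/f1i ->//] := eqVneq i i0; rewrite f1i0.
  + move=> i; have [->|/f1i ->//] := eqVneq i i0; rewrite f1i0.
    rewrite integral_comp_indic //; apply: le_lt_trans (ltry 1).
    apply: probability_le1.
    by rewrite -[X in measurable X]setTI; exact: mU.
  + move=> i ki; have [->|ni] := eqVneq i i0; first by exists B.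
    rewrite (f1i _ ni); apply: fA; rewrite ltn_neqAle ki andbT.
    by apply: contraNneq ni => ki'; apply/eqP/val_inj.
- exact/measurable_EFinP.
- by move=> y; rewrite lee_fin.
Qed.

(** The two variables have different codomains, so the indexed family above does not cover them; the
    argument is the same, applied first to [f] and then to [g]. *)
Lemma independent_integral2 d1 d2 (T1 : measurableType d1)
    (T2 : measurableType d2) (U : T -> T1) (V : T -> T2)
    (f : T1 -> R) (g : T2 -> R) :
  independent_RV P U V -> measurable_fun setT U -> measurable_fun setT V ->
  measurable_fun setT f -> measurable_fun setT g ->
  (forall y, 0 <= f y)%R -> (forall y, 0 <= g y)%R ->
  \int[P]_w (g (V w))%:E < +oo ->
  \int[P]_w (f (U w) * g (V w))%:E =
  \int[P]_w (f (U w))%:E * \int[P]_w (g (V w))%:E.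
Proof.
move=> indU mU mV mf mg f0 g0 goo.
pose c := fine (\int[P]_w (g (V w))%:E).
have g0' : 0 <= \int[P]_w (g (V w))%:E.
  by apply: integral_ge0 => x _; rewrite lee_fin.
have cE : c%:E = \int[P]_w (g (V w))%:E by rewrite fineK // ge0_fin_numE.
have c0 : (0 <= c)%R by rewrite -lee_fin cE.
under eq_integral do rewrite EFinM.
rewrite (@eq_integral_weighted _ _ _ _ _ P U (g \o V) (cst c) (EFin \o f)) //=.
- rewrite ge0_integralZr ?cE // => [|x _]; last by rewrite lee_fin.
  by apply/measurable_EFinP; exact: measurableT_comp.
- exact: measurableT_comp.
- move=> A mA; have mUA : measurable (U @^-1` A).
    by rewrite -[X in measurable X]setTI; exact: mU.
  rewrite integral_cst // integral_preimage_indic.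
  under eq_integral do rewrite mulrC EFinM.
  pose c' := fine (P (U @^-1` A)).
  have c'E : c'%:E = P (U @^-1` A) by rewrite fineK // fin_num_measure.
  rewrite (@eq_integral_weighted _ _ _ _ _ P V (\1_A \o U) (cst c')
    (EFin \o g)) //=.
  + rewrite ge0_integralZr ?c'E ?cE // => [|x _]; last by rewrite lee_fin.
    by apply/measurable_EFinP; exact: measurableT_comp.
  + by apply: measurableT_comp => //; exact: measurable_indic.
  + by move=> _; rewrite -lee_fin c'E.
  + move=> B mB; have mVB : measurable (V @^-1` B).
      by rewrite -[X in measurable X]setTI; exact: mV.
    rewrite integral_cst // c'E -indU // integral_preimage_indic.
    rewrite -[X in P X]setIT -integral_indic //; last exact: measurableI.
    apply: eq_integral => x _; rewrite indicI /= mulrC.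
    by [].
  + exact/measurable_EFinP.
- exact/measurable_EFinP.
Qed.

End Independence.

(** * Approximation of reals on a grid *)

Section FloorApprox.
Context {R : realType}.

(** Rounding down to the grid of mesh [1 / k.+1]: the values are rational and countable in number,
    which serves both density arguments and the freezing of random coefficients. *)
Definition floor_approx (k : nat) (x : R) : R :=
  (Num.floor (x * k.+1%:R))%:~R / k.+1%:R.

Lemma cvg_floor_approx (x : R) : floor_approx k x @[k --> \oo] --> x.
Proof.
have hc : x - harmonic k @[k --> \oo] --> x.
  rewrite -[X in _ --> X]subr0; apply: cvgB; first exact: cvg_cst.
  exact: cvg_harmonic.
apply: (squeeze_cvgr _ hc (cvg_cst x)); apply: nearW => k.
have k0 : 0 < k.+1%:R :> R by rewrite ltr0n.
have /andP[h1 h2] := floor_itv (x * k.+1%:R).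
rewrite /floor_approx; apply/andP; split; last by rewrite ler_pdivrMr.
rewrite ler_pdivlMr // /harmonic mulrBl mulVf ?gt_eqF // lerBlDr.
by rewrite intrD in h2; exact: ltW.
Qed.

Lemma cvg_sumr I (r : seq I) (p : pred I) (f : I -> nat -> R) (l : I -> R) :
  (forall i, f i k @[k --> \oo] --> l i) ->
  \sum_(i <- r | p i) f i k @[k --> \oo] --> \sum_(i <- r | p i) l i.
Proof.
move=> fl; rewrite (_ : (fun k => _) = \sum_(i <- r | p i) f i); last first.
  by apply/funext => k; rewrite fct_sumE.
elim: r => [|i r IH]; first by rewrite !big_nil; exact: cvg_cst.
by rewrite !big_cons; case: ifP => // _; exact: cvgD.
Qed.

End FloorApprox.

(** * Measurability of matrix operations and singular values *)

Section MatrixMeasurability.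
Context {R : realType} d (T : measurableType d).

Definition measurable_mx m n (B : T -> 'M[R]_(m, n)) : Prop :=
  forall i j, measurable_fun setT (fun w => B w i j).

Lemma measurable_mxP m n (B : T -> 'M[R]_(m, n)) :
  measurable_fun setT B <-> measurable_mx B.
Proof.
split=> [mB i j|]; last exact: measurable_matrixP.
exact: measurableT_comp (measurable_entry i j) mB.
Qed.

Lemma measurable_cst_mx m n (B : 'M[R]_(m, n)) : measurable_mx (fun=> B).
Proof. by move=> i j; exact: measurable_cst. Qed.

Lemma measurable_mulmx m n p (A : T -> 'M[R]_(m, n)) (B : T -> 'M[R]_(n, p)) :
  measurable_mx A -> measurable_mx B -> measurable_mx (fun w => A w *m B w).
Proof.
move=> mA mB i j; under eq_fun do rewrite mxE.
by apply: measurable_sum => k; exact: measurable_funM.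
Qed.

Lemma measurable_trmx m n (A : T -> 'M[R]_(m, n)) :
  measurable_mx A -> measurable_mx (fun w => (A w)^T).
Proof. by move=> mA i j; under eq_fun do rewrite mxE; exact: mA. Qed.

Lemma measurable_det n (A : T -> 'M[R]_n) :
  measurable_mx A -> measurable_fun setT (fun w => \det (A w)).
Proof.
move=> mA; rewrite /determinant; apply: measurable_sum => s.
apply: measurable_funM => //; apply: measurable_prod => i _; exact: mA.
Qed.

Lemma measurable_funV (f : T -> R) :
  measurable_fun setT f -> measurable_fun setT (fun w => (f w)^-1).
Proof.
move=> mf; rewrite (_ : (fun w => _) = (fun w => f w * (f w ^+ 2) `^ (-1))).
  apply: measurable_funM => //; apply: (measurableT_comp (measurable_powR _)).
  exact: measurable_funX.
apply/funext => w; rewrite powR_inv1 ?sqr_ge0 //.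
have [->|f0] := eqVneq (f w) 0; first by rewrite invr0 mul0r.
by field.
Qed.

Lemma measurable_invmx n (A : T -> 'M[R]_n) :
  measurable_mx A -> measurable_mx (fun w => invmx (A w)).
Proof.
move=> mA i j.
(* [invmx] returns its argument on singular matrices; elsewhere Cramer's rule is polynomial in the
   entries, up to division by the determinant. *)
rewrite (_ : (fun w => _) = (fun w => if \det (A w) == 0 then A w i j else
   (\det (A w))^-1 * \adj (A w) i j)); last first.
  apply/funext => w; rewrite /invmx unitmxE unitfE.
  by case: eqVneq => //=; rewrite mxE.
have mdet := measurable_det mA.
apply: measurable_fun_ifT => //; first exact: measurable_fun_eqr.
apply: measurable_funM; first exact: measurable_funV.
under eq_fun do rewrite mxE /cofactor.
apply: measurable_funM => //; apply: measurable_det => k l.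
by under eq_fun do rewrite !mxE; exact: mA.
Qed.

Lemma measurable_qform n (B : T -> 'M[R]_n) (x : 'cV_n) :
  measurable_mx B -> measurable_fun setT (fun w => qform (B w) x).
Proof.
move=> mB; under eq_fun do rewrite qformE.
apply: measurable_sum => i; apply: measurable_sum => j.
exact: measurable_funM.
Qed.

Lemma measurable_fun_le_set (f g : T -> R) :
  measurable_fun setT f -> measurable_fun setT g ->
  measurable [set w | f w <= g w].
Proof.
move=> mf mg; rewrite -[X in measurable X]setTI.
rewrite (_ : [set w | _] = (fun w => f w <= g w) @^-1` [set true]) //.
by apply: (measurable_fun_ler mf mg) => //.
Qed.

(** Continuity in [x] and density of the rational vectors; an uncountable family of inequalities
    thus becomes a countable intersection of events. *)
Lemma qform_ge0_rat n (B : 'M[R]_n) :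
  (forall q : 'cV[rat]_n, 0 <= qform B (map_mx ratr q)) ->
  forall x, 0 <= qform B x.
Proof.
move=> Bq x; pose y k : 'cV[rat]_n := \col_i
  ((Num.floor (x i ord0 * k.+1%:R))%:~R / k.+1%:R).
have yE k i : (map_mx ratr (y k) : 'cV[R]_n) i ord0 = floor_approx k (x i ord0).
  by rewrite !mxE fmorph_div rmorph_int rmorph_nat.
have c : qform B (map_mx ratr (y k)) @[k --> \oo] --> qform B x.
  under eq_fun do rewrite qformE.
  rewrite qformE; apply: cvg_sumr => i; apply: cvg_sumr => j.
  apply: cvgMr; under eq_fun do rewrite !yE.
  by apply: cvgM; exact: cvg_floor_approx.
rewrite -(cvg_lim _ c) //; apply: limr_ge; last exact: nearW.
by apply/cvg_ex; exists (qform B x).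
Qed.

Lemma measurable_qform_ge0 n (B : T -> 'M[R]_n) : measurable_mx B ->
  measurable [set w | forall x, 0 <= qform (B w) x].
Proof.
move=> mB; pose F k := if (unpickle k : option 'cV[rat]_n) is Some q then
  [set w | 0 <= qform (B w) (map_mx ratr q)] else setT.
rewrite (_ : [set w | _] = \bigcap_k F k).
  apply: bigcapT_measurable => k; rewrite /F; case: unpickle => // q.
  by apply: measurable_fun_le_set => //; exact: measurable_qform.
apply/seteqP; split => [w Bw k _|w Bw].
  by rewrite /F; case: unpickle => // q; exact: Bw.
apply: qform_ge0_rat => q; have := Bw (pickle q) I.
by rewrite /F pickleK.
Qed.

Lemma measurable_le_sigma_min m n (W : T -> 'M[R]_(m, n.+1)) (s : R) :
  measurable_mx W -> measurable [set w | s <= sigma_min (W w)].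
Proof.
move=> mW; have [s0|s0] := ltP s 0.
  rewrite (_ : [set w | _] = setT) //; apply/seteqP; split => // w _ /=.
  by have [[h _] _] := sigma_minE (W w); exact: le_trans (ltW s0) h.
rewrite (_ : [set w | _] =
  [set w | forall x, 0 <= qform ((W w)^T *m W w - (s ^+ 2)%:M) x]).
  apply: measurable_qform_ge0 => i j; under eq_fun do rewrite mxE.
  apply: measurable_funD; last exact: measurable_cst.
  by apply: measurable_mulmx => //; exact: measurable_trmx.
by apply/seteqP; split => w /=; rewrite le_sigma_min // => h x;
  have := h x; rewrite qformB_scalar gram_qform subr_ge0.
Qed.

Lemma measurable_ge_sigma_max m n (W : T -> 'M[R]_(m, n.+1)) (s : R) :
  measurable_mx W -> measurable [set w | sigma_max (W w) <= s].
Proof.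
move=> mW; have [s0|s0] := ltP s 0.
  rewrite (_ : [set w | _] = set0) //; apply/seteqP; split => // w /= ws.
  have [[h _] _] := sigma_maxE (W w).
  by have := le_lt_trans (le_trans h ws) s0; rewrite ltxx.
rewrite (_ : [set w | _] =
  [set w | forall x, 0 <= qform ((s ^+ 2)%:M - (W w)^T *m W w) x]).
  apply: measurable_qform_ge0 => i j; under eq_fun do rewrite mxE.
  apply: measurable_funD; first exact: measurable_cst.
  under eq_fun do rewrite mxE.
  apply: measurableT_comp => //.
  by apply: measurable_mulmx => //; exact: measurable_trmx.
have E w x : qform ((s ^+ 2)%:M - (W w)^T *m W w) x =
    s ^+ 2 * dotv x x - dotv (W w *m x) (W w *m x).
  by rewrite -gram_qform /qform mulmxBl dotvDr dotvNr mul_scalar_mx dotvZr.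
by apply/seteqP; split => w /=; rewrite ge_sigma_max // => h x;
  have := h x; rewrite E subr_ge0.
Qed.

End MatrixMeasurability.

(** * Exponential moments of squares of sub-Gaussian variables *)

Section GaussianTrick.
Context {R : realType}.
Local Notation leb := (@lebesgue_measure R).
Local Notation gauss := (@normal_pdf R 0 1).

Lemma gauss_mgf (b : R) :
  (\int[leb]_g (gauss g * expR (b * g))%:E = (expR (b ^+ 2 / 2))%:E)%E.
Proof.
(* Completing the square turns the integrand into a multiple of the density centred at [b]. *)
transitivity (\int[leb]_g ((expR (b ^+ 2 / 2))%:E * (normal_pdf b 1 g)%:E))%E.
  apply: eq_integral => g _; rewrite -EFinM !normal_pdfE ?oner_eq0 //.
  congr EFin; rewrite /normal_fun -mulrA -expRD [RHS]mulrCA -expRD.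
  by congr (_ * expR _); field.
rewrite ge0_integralZl //=.
- by rewrite integral_normal_pdf mule1.
- by apply/measurable_EFinP; exact: measurable_normal_pdf.
by move=> g _; rewrite lee_fin normal_pdf_ge0.
Qed.

Lemma gauss_mgf_sqr (eta : R) : eta < 1 ->
  (\int[leb]_g (gauss g * expR (eta * g ^+ 2 / 2))%:E =
   ((Num.sqrt (1 - eta))^-1)%:E)%E.
Proof.
move=> eta1; have e0 : 0 < 1 - eta by rewrite subr_gt0.
pose s := (Num.sqrt (1 - eta))^-1.
have s0 : 0 < s by rewrite invr_gt0 sqrtr_gt0.
have s2 : s ^+ 2 = (1 - eta)^-1 by rewrite exprVn sqr_sqrtr // ltW.
have pk : normal_peak 1 = s * normal_peak s.
  rewrite /normal_peak s2 expr1n mul1r -mulrnAr sqrtrM ?invr_ge0 ?ltW //.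
  rewrite sqrtrV ?ltW // -/s invfM mulrA mulfV ?mul1r // gt_eqF //.
(* The integrand is [s] times the centred Gaussian density of standard deviation [s], where
   [s ^+ 2 = (1 - eta)^-1]. *)
transitivity (\int[leb]_g (s%:E * (normal_pdf 0 s g)%:E))%E.
  apply: eq_integral => g _; rewrite -EFinM !normal_pdfE ?oner_eq0 ?gt_eqF //.
  congr EFin; rewrite pk -!mulrA; congr (_ * (_ * _)).
  rewrite /normal_fun -expRD s2; congr expR.
  by field; rewrite gt_eqF.
rewrite ge0_integralZl //=.
- by rewrite integral_normal_pdf mule1.
- by apply/measurable_EFinP; exact: measurable_normal_pdf.
- by move=> g _; rewrite lee_fin normal_pdf_ge0.
by rewrite lee_fin ltW.
Qed.

Context d (T : measurableType d) (P : probability T R).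
Local Open Scope ereal_scope.

Lemma measure_le_integral (A : set T) (f : T -> R) :
  measurable A -> measurable_fun setT f -> (forall w, 0 <= f w)%R ->
  (forall w, A w -> 1 <= f w)%R -> P A <= \int[P]_w (f w)%:E.
Proof.
move=> mA mf f0 f1; rewrite -[X in P X]setIT -integral_indic //.
apply: ge0_le_integral => //=.
- by apply/measurable_EFinP; exact: measurable_indic.
- exact/measurable_EFinP.
move=> w _; rewrite lee_fin indicE.
by have [/set_mem/f1|] := boolP (w \in A).
Qed.

(* exp (lambda u^2) is the Gaussian average of exp (sqrt (2 lambda) g u), which
   trades the squares for linear terms one coordinate at a time. *)
Lemma subgaussian_sqr_mgf M (U : 'I_M -> T -> R) (tau lambda : R) :
  (forall j, measurable_fun setT (U j)) -> (0 <= lambda)%R ->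
  (2 * lambda * tau < 1)%R ->
  (forall a : 'I_M -> R, \int[P]_w (expR (\sum_j a j * U j w))%:E <=
     (expR (tau * (\sum_j a j ^+ 2) / 2))%:E) ->
  \int[P]_w (expR (lambda * \sum_j U j w ^+ 2))%:E <=
  ((Num.sqrt (1 - 2 * lambda * tau))^-1 ^+ M)%:E.
Proof.
move=> mU l0 lt1 HU.
pose K := ((Num.sqrt (1 - 2 * lambda * tau))^-1)%R.
have K0 : (0 <= K)%R by rewrite invr_ge0.
(* Coordinates below [k] already appear squared, each for a factor [K]; the others are still linear,
   with free coefficients that the next step can randomize. *)
suff H k : (k <= M)%N -> forall a : 'I_M -> R,
   \int[P]_w (expR (lambda * \sum_(j : 'I_M | (j < k)%N) U j w ^+ 2 +
                    \sum_(j : 'I_M | (k <= j)%N) a j * U j w))%:E <=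
   (K ^+ k * expR (tau * (\sum_(j : 'I_M | (k <= j)%N) a j ^+ 2) / 2))%:E.
  have := H M (leqnn M) (fun=> 0%R).
  rewrite (_ : (\sum_(j : 'I_M | (M <= j)%N) _)%R = 0%R); last first.
    by apply: big_pred0 => j; rewrite leqNgt ltn_ord.
  rewrite mulr0 mul0r expR0 mulr1; apply: le_trans; rewrite le_eqVlt.
  apply/orP; left; apply/eqP; apply: eq_integral => w _.
  rewrite [X in (_ + X)%R]big_pred0 ?addr0; last first.
    by move=> j; rewrite leqNgt ltn_ord.
  by congr (expR (_ * _))%:E; apply: eq_bigl => j; rewrite ltn_ord.
elim: k => [|k IH] kM a.
  under eq_integral => w _ do rewrite big_pred0 // mulr0 add0r.
  by rewrite expr0 mul1r; exact: HU.
pose i0 := Ordinal kM.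
have lek (j : 'I_M) : (k <= j)%N = (j == i0) || (k < j)%N.
  by rewrite leq_eqVlt -val_eqE /= eq_sym.
have ltk (j : 'I_M) : (j < k.+1)%N = (j == i0) || (j < k)%N.
  by rewrite ltnS leq_eqVlt -val_eqE.
have sum_lek (F : 'I_M -> R) :
    (\sum_(j : 'I_M | (k <= j)%N) F j = F i0 + \sum_(j : 'I_M | (k < j)%N) F j)%R.
  rewrite (bigD1 i0) //=; congr (_ + _)%R; apply: eq_bigl => j.
  rewrite lek; have [->|//] := eqVneq j i0; rewrite /= ?ltnn //.
  by rewrite andbT.
have sum_ltk (F : 'I_M -> R) :
    (\sum_(j : 'I_M | (j < k.+1)%N) F j = F i0 + \sum_(j : 'I_M | (j < k)%N) F j)%R.
  rewrite (bigD1 i0) //=; congr (_ + _)%R; apply: eq_bigl => j.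
  rewrite ltk; have [->|//] := eqVneq j i0; rewrite /= ?ltnn //.
  by rewrite andbT.
pose s := Num.sqrt (2 * lambda).
have s2 : (s ^+ 2 = 2 * lambda)%R by rewrite sqr_sqrtr // mulr_ge0.
pose H w := expR (lambda * \sum_(j : 'I_M | (j < k)%N) U j w ^+ 2 +
                  \sum_(j : 'I_M | (k < j)%N) a j * U j w).
pose F (z : T * R) := (H z.1 * (gauss z.2 * expR (s * U i0 z.1 * z.2)))%R.
have mH : measurable_fun setT H.
  apply: measurableT_comp => //; apply: measurable_funD.
    apply: measurable_funM => //.
    under eq_fun do rewrite big_mkcond /=.
    apply: measurable_sum => j; case: (_ < _)%N => //.
    exact: measurable_funX.
  under eq_fun do rewrite big_mkcond /=.
  apply: measurable_sum => j; case: (_ < _)%N => //.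
  exact: measurable_funM.
have mF : measurable_fun setT F.
  apply: measurable_funM; first exact: measurableT_comp.
  apply: measurable_funM.
    by apply: measurableT_comp => //; exact: measurable_normal_pdf.
  apply: measurableT_comp => //; apply: measurable_funM => //.
  by apply: measurable_funM => //; exact: measurableT_comp.
have F0 z : 0 <= (F z)%:E.
  by rewrite lee_fin !mulr_ge0 ?expR_ge0 // normal_pdf_ge0.
have mFw w : measurable_fun setT (fun g => (gauss g * expR (s * U i0 w * g))%:E).
  apply/measurable_EFinP; apply: measurable_funM.
    exact: measurable_normal_pdf.
  by apply: measurableT_comp => //; exact: measurable_funM.
apply: (@le_trans _ _ (\int[P]_w \int[leb]_g (F (w, g))%:E)).
  rewrite le_eqVlt; apply/orP; left; apply/eqP.
  apply: eq_integral => w _; rewrite /F /=.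
  under eq_integral do rewrite EFinM.
  rewrite ge0_integralZl //=; first last.
  - by rewrite lee_fin expR_ge0.
  - by move=> g _; rewrite lee_fin mulr_ge0 ?expR_ge0 // normal_pdf_ge0.
  - exact: mFw.
  rewrite gauss_mgf -EFinM -expRD; congr (expR _)%:E.
  by rewrite sum_ltk exprMn s2; field.
have -> : \int[P]_w \int[leb]_g (F (w, g))%:E =
          \int[leb]_g \int[P]_w (F (w, g))%:E.
  by apply: (@fubini_tonelli _ _ _ _ _ P leb (EFin \o F)) => //;
     exact/measurable_EFinP.
pose B := (K ^+ k * expR (tau * (\sum_(j : 'I_M | (k < j)%N) a j ^+ 2) / 2))%R.
have B0 : (0 <= B)%R by rewrite mulr_ge0 ?expR_ge0 // exprn_ge0.
apply: (@le_trans _ _ (\int[leb]_g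
    (B%:E * (gauss g * expR (2 * lambda * tau * g ^+ 2 / 2))%:E))).
  apply: ge0_le_integral => //=.
  - by move=> g _; apply: integral_ge0.
  - by apply: (measurable_fun_fubini_tonelli_G (EFin \o F)) => //; exact/measurable_EFinP.
  - apply: measurable_funeM; apply/measurable_EFinP; apply: measurable_funM.
      exact: measurable_normal_pdf.
    apply: measurableT_comp => //; apply: measurable_funM => //.
    by apply: measurable_funM => //; exact: measurable_funX.
  (* For fixed [g] the induction hypothesis applies with [s * g] as coefficient of the coordinate
     [i0]. *)
  move=> g _; pose a' j := if j == i0 then (s * g)%R else a j.
  have IHa := IH (ltnW kM) a'.
  rewrite (_ : \int[P]_w (F (w, g))%:E = (gauss g)%:E * \int[P]_w
    (expR (lambda * (\sum_(j : 'I_M | (j < k)%N) U j w ^+ 2) +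
     \sum_(j : 'I_M | (k <= j)%N) a' j * U j w))%:E); last first.
    rewrite -ge0_integralZl //=; first last.
    - by rewrite lee_fin normal_pdf_ge0.
    - apply/measurable_EFinP; apply: measurableT_comp => //.
      apply: measurable_funD.
        apply: measurable_funM => //.
        under eq_fun do rewrite big_mkcond /=.
        apply: measurable_sum => j; case: (_ < _)%N => //.
        exact: measurable_funX.
      under eq_fun do rewrite big_mkcond /=.
      apply: measurable_sum => j; case: (_ <= _)%N => //.
      exact: measurable_funM.
    apply: eq_integral => w _; rewrite -EFinM /F /= /H mulrCA -expRD.
    congr (_ * expR _)%:E; rewrite sum_lek {1}/a' eqxx -addrA.
    congr (_ + _)%R; rewrite addrC mulrAC; congr (_ + _)%R.
    by apply: eq_bigr => j kj; rewrite /a' ifN // -val_eqE /= gtn_eqF.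
  apply: le_trans (lee_wpmul2l _ IHa) _; first by rewrite lee_fin normal_pdf_ge0.
  rewrite -!EFinM lee_fin le_eqVlt; apply/orP; left; apply/eqP.
  rewrite sum_lek {1}/a' eqxx exprMn s2 /B.
  rewrite (eq_bigr (fun j => a j ^+ 2)%R); last first.
    by move=> j kj; rewrite /a' ifN // -val_eqE /= gtn_eqF.
  set S := (\sum_(j : 'I_M | _) _)%R.
  have -> : (tau * (2 * lambda * g ^+ 2 + S) / 2 =
             tau * S / 2 + 2 * lambda * tau * g ^+ 2 / 2)%R by field.
  by rewrite expRD; ring.
rewrite ge0_integralZl //=; first last.
- by move=> g _; rewrite lee_fin mulr_ge0 ?expR_ge0 // normal_pdf_ge0.
- apply/measurable_EFinP; apply: measurable_funM.
    exact: measurable_normal_pdf.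
  apply: measurableT_comp => //; apply: measurable_funM => //.
  by apply: measurable_funM => //; exact: measurable_funX.
(* The Gaussian average of the remaining exponential of [lambda * tau * g ^+ 2] is finite because
   [2 * lambda * tau < 1], and it contributes the new factor [K]. *)
rewrite gauss_mgf_sqr // -EFinM lee_fin -/K exprSr /B.
by rewrite mulrAC.
Qed.

End GaussianTrick.

(** * Tail of a sum of squares *)

Section Chi2Tail.
Context {R : realType}.

(** The denominator makes [delta := chi2_slope tau0 eps] satisfy [2 * (delta * tau0) <= 1 / 2],
    through the term in [eps * tau0], and [4 * delta * tau0 ^+ 2 <= eps / 2], through the term in
    [tau0 ^+ 2]; the [1] keeps it positive when [tau0 = 0]. *)
Definition chi2_slope (tau0 eps : R) : R :=
  eps / (8 * tau0 ^+ 2 + 4 * eps * tau0 + 1).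
Definition chi2_rate (tau0 eps : R) : R := expR (- (chi2_slope tau0 eps * eps / 2)).

Lemma chi2_slope_gt0 tau0 eps : 0 <= tau0 -> 0 < eps -> 0 < chi2_slope tau0 eps.
Proof.
move=> t0 e0; rewrite divr_gt0 // ltr_wpDl // addr_ge0 ?mulr_ge0 ?sqr_ge0 //.
exact: ltW.
Qed.

Lemma chi2_rate_lt1 tau0 eps : 0 <= tau0 -> 0 < eps -> chi2_rate tau0 eps < 1.
Proof.
move=> t0 e0; rewrite expR_lt1 oppr_lt0 divr_gt0 // mulr_gt0 //.
exact: chi2_slope_gt0.
Qed.

(** The term [x / 2] will cancel the mean [tau0] in the Chernoff bound, so that only the quadratic
    error is paid for with [eps]. After squaring and bounding the exponential below by its tangent,
    it suffices that [1 <= (1 - x) * (1 + (x + 2 * x ^+ 2))], which holds for [0 <= x <= 1 / 2]. *)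
Lemma inv_sqrt_le_expR (x : R) : 0 <= x -> x <= 1 / 2 ->
  (Num.sqrt (1 - x))^-1 <= expR (x / 2 + x ^+ 2).
Proof.
move=> x0 x1; have p : 0 < 1 - x by lra.
have sp : 0 < Num.sqrt (1 - x) by rewrite sqrtr_gt0.
rewrite -(ler_pM2l sp) mulfV ?gt_eqF //.
rewrite -(ler_pXn2r (n := 2)) ?nnegrE ?mulr_ge0 ?expR_ge0 ?(ltW sp) //.
rewrite expr1n exprMn sqr_sqrtr ?(ltW p) // -expRM_natl.
have -> : expR (2 * (x / 2 + x ^+ 2)) = expR (x + 2 * x ^+ 2).
  by congr expR; field.
have h := expR_ge1Dx (x + 2 * x ^+ 2).
apply: (@le_trans _ _ ((1 - x) * (1 + (x + 2 * x ^+ 2)))); first by nra.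
by rewrite ler_wpM2l // (ltW p).
Qed.

(** With variance proxy [tau0 / M] in every direction, the [M] squares add up to about [tau0]. The
    Chernoff parameter must be of order [M] to match this proxy, which makes the tail geometric in
    [M]. *)
Lemma chi2_tail d (T : measurableType d) (P : probability T R) M
    (U : 'I_M -> T -> R) (tau0 eps : R) :
  (0 < M)%N -> 0 <= tau0 -> 0 < eps -> (forall j, measurable_fun setT (U j)) ->
  (forall a : 'I_M -> R, (\int[P]_w (expR (\sum_j a j * U j w))%:E <=
     (expR (tau0 / M%:R * (\sum_j a j ^+ 2) / 2))%:E)%E) ->
  (P [set w | (tau0 + eps <= \sum_j U j w ^+ 2)%R] <= (chi2_rate tau0 eps ^+ M)%:E)%E.
Proof.
move=> M0 t0 e0 mU HU; pose delta := chi2_slope tau0 eps.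
have d0 : 0 < delta by exact: chi2_slope_gt0.
have Mp : 0 < M%:R :> R by rewrite ltr0n.
have D0 : 0 < 8 * tau0 ^+ 2 + 4 * eps * tau0 + 1.
  by rewrite ltr_wpDl // addr_ge0 ?mulr_ge0 ?sqr_ge0 //; exact: ltW.
have dE : delta * (8 * tau0 ^+ 2 + 4 * eps * tau0 + 1) = eps.
  by rewrite mulfVK // gt_eqF.
have d1 : 2 * (delta * tau0) <= 1 / 2.
  rewrite -(ler_pM2r e0); have : 0 <= delta * tau0 ^+ 2 by rewrite mulr_ge0 ?sqr_ge0 // ltW.
  by nra.
have d2 : 4 * delta * tau0 ^+ 2 <= eps / 2.
  have : 0 <= delta * eps * tau0 by apply: mulr_ge0 => //; apply: mulr_ge0; exact: ltW.
  by nra.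
pose lambda := delta * M%:R.
have lt : 2 * lambda * (tau0 / M%:R) = 2 * (delta * tau0).
  by rewrite /lambda; field; rewrite gt_eqF.
have l0 : 0 <= lambda by rewrite mulr_ge0 // ltW.
have mS : measurable_fun setT (fun w => \sum_j U j w ^+ 2).
  by apply: measurable_sum => j; exact: measurable_funX.
have mA : measurable [set w | (tau0 + eps <= \sum_j U j w ^+ 2)%R].
  rewrite -[X in measurable X]setTI.
  rewrite (_ : [set w | _] = (fun w => \sum_j U j w ^+ 2) @^-1`
                [set` `[tau0 + eps, +oo[]); first exact: mS.
  by apply/seteqP; split => w /=; rewrite in_itv /= andbT.
apply: le_trans (@measure_le_integral _ _ _ P _ (fun w =>
  expR (- (lambda * (tau0 + eps))) * expR (lambda * \sum_j U j w ^+ 2)) mA _ _ _) _.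
- apply: measurable_funM => //; apply: measurableT_comp => //.
  exact: measurable_funM.
- by move=> w; rewrite mulr_ge0 ?expR_ge0.
- move=> w /= hw; rewrite -expRD -expR0 ler_expR addrC -mulrBr.
  by rewrite mulr_ge0 // subr_ge0.
under eq_integral do rewrite EFinM.
rewrite ge0_integralZl //=; first last.
- by apply/measurable_EFinP; apply: measurableT_comp => //; exact: measurable_funM.
have h := subgaussian_sqr_mgf mU l0 _ HU.
apply: le_trans (lee_wpmul2l _ (h _)) _; first by rewrite lee_fin expR_ge0.
  by rewrite lt; apply: le_lt_trans d1 _; lra.
rewrite -EFinM lee_fin lt.
have K1 := @inv_sqrt_le_expR (2 * (delta * tau0)) _ d1.
have dt0 : 0 <= 2 * (delta * tau0).
  by apply: mulr_ge0 => //; apply: mulr_ge0 => //; exact: ltW.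
apply: (@le_trans _ _ (expR (- (lambda * (tau0 + eps))) *
   expR (2 * (delta * tau0) / 2 + (2 * (delta * tau0)) ^+ 2) ^+ M)).
  apply: ler_wpM2l; first exact: expR_ge0.
  by apply: lerXn2r; rewrite ?nnegrE ?invr_ge0 ?expR_ge0 // K1.
rewrite /chi2_rate -!expRM_natl -expRD ler_expR -/delta /lambda.
have -> : - (delta * M%:R * (tau0 + eps)) +
   M%:R * (2 * (delta * tau0) / 2 + (2 * (delta * tau0)) ^+ 2) =
   M%:R * (delta * (4 * delta * tau0 ^+ 2 - eps)) by field.
have -> : M%:R * - (delta * eps / 2) = M%:R * (delta * (eps / 2 - eps)) by field.
by rewrite !ler_wpM2l // ?lerD2r // ltW.
Qed.

End Chi2Tail.

(** * An inequality between the exponential and the hyperbolic cosine *)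

Section ExpCosh.
Context {R : realType}.
Implicit Types x y : R.

Let theta : R := Num.sqrt (3 / 2).

Lemma sqr_sqrt_3_2 : Num.sqrt (3 / 2) ^+ 2 = 3 / 2 :> R.
Proof. by rewrite sqr_sqrtr. Qed.

(** The partial sums have an even number of terms, so that each odd term can be shared between its
    even neighbours. *)
Let S m y : R := series (exp_coeff y) m.*2.
Let u m y : R := exp_coeff y m.*2.

Let SS m y : S m.+1 y = S m y + u m y + exp_coeff y m.*2.+1.
Proof. by rewrite /S doubleS /series /= !big_nat_recr. Qed.

Let u_ge0 m y : 0 <= u m y.
Proof. by rewrite /u /exp_coeff /= -mul2n exprM divr_ge0 // exprn_ge0 // sqr_ge0. Qed.

Let cvg_double : m.*2 @[m --> \oo] --> \oo.
Proof.
apply/cvgnyPge => A; exists A => // m /= Am.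
by apply: leq_trans Am _; rewrite -addnn leq_addr.
Qed.

Let cvgS y : S m y @[m --> \oo] --> expR y.
Proof.
apply: (cvg_comp _ _ cvg_double (G := \oo)); exact: is_cvg_series_exp_coeff.
Qed.

Let cvgu y : u m y @[m --> \oo] --> (0 : R).
Proof. apply: (cvg_comp _ _ cvg_double (G := \oo)); exact: cvg_exp_coeff. Qed.

Let coeffS y n : exp_coeff y n.+1 = exp_coeff y n * (y / n.+1%:R).
Proof.
by rewrite /exp_coeff /= exprSr factS natrM invfM; ring.
Qed.

(* AM-GM between the two neighbouring even terms. *)
Let odd_le m y : (0 < m)%N ->
  exp_coeff y m.*2.+1 <= u m y / 2 + 2 / 3 * u m.+1 y.
Proof.
move=> m0; pose t := y / m.*2.+1%:R; pose r : R := m.*2.+1%:R / m.*2.+2%:R.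
have oE : exp_coeff y m.*2.+1 = u m y * t by rewrite coeffS.
have uE : u m.+1 y = u m y * t * (y / m.*2.+2%:R) by rewrite /u doubleS !coeffS.
have q0 : 0 < m.*2.+2%:R :> R by rewrite ltr0n.
have p0 : 0 < m.*2.+1%:R :> R by rewrite ltr0n.
have yt : y / m.*2.+2%:R = t * r.
  by rewrite /t /r; field; rewrite nat1r !gt_eqF.
have m1 : 1 <= m%:R :> R by rewrite ler1n.
have h : 3 / 4 <= r.
  rewrite /r.
  have e1 : m.*2.+1%:R = m%:R * 2 + 1 :> R by rewrite -natr1 -muln2 natrM.
  have e2 : m.*2.+2%:R = m%:R * 2 + 1 + 1 :> R by rewrite -natr1 e1.
  by rewrite ler_pdivlMr // e1 e2; lra.
rewrite uE oE yt -/r.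
have key : t <= 1 / 2 + 2 / 3 * (t * (t * r)).
  have : 3 / 4 * (t * t) <= r * (t * t).
    by rewrite ler_wpM2r // -expr2 sqr_ge0.
  by have := sqr_ge0 (t - 1); rewrite expr2; nra.
by have := ler_wpM2l (u_ge0 m y) key; lra.
Qed.

Let uu m y : u m (theta * y) = (3 / 2) ^+ m * u m y.
Proof.
by rewrite /u /exp_coeff /= exprMn -mul2n exprM sqr_sqrt_3_2 -mulrA.
Qed.

Let coeffN y n : exp_coeff (- y) n = (-1) ^+ n * exp_coeff y n.
Proof. by rewrite /exp_coeff /= (exprNn y) mulrA.  Qed.

(** Induction over pairs of terms. The remainder [2 / 3 * u m.+2 y] is the share of the last odd
    term charged to the next even one. The base case needs the quadratic coefficient
    [1 + 1 / 2 = 3 / 2]; a later step needs [1 + 1 / 2 + 2 / 3 = 13 / 6], which is below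
    [9 / 4 <= (3 / 2) ^+ m.+2]. The remainder vanishes in the limit. *)
Let claim m y : S m.+2 y - y <=
  (S m.+2 (theta * y) + S m.+2 (- (theta * y))) / 2 + 2 / 3 * u m.+2 y.
Proof.
have evenE k : u k (- (theta * y)) = (3 / 2) ^+ k * u k y.
  by rewrite /u coeffN -signr_odd odd_double mul1r -/(u _ _) uu.
have oddE k : exp_coeff (- (theta * y)) k.*2.+1 = - exp_coeff (theta * y) k.*2.+1.
  by rewrite coeffN -signr_odd /= odd_double mulN1r.
elim: m => [|m IH].
  have o1 := @odd_le 1 y isT.
  have S0 z : S 0 z = 0 by rewrite /S /series /= big_nil.
  rewrite !SS !S0 !evenE !uu !oddE.
  have u0 : u 0 y = 1 by rewrite /u /exp_coeff /= expr0 divr1.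
  have c1 : exp_coeff y (0.*2).+1 = y by rewrite /exp_coeff /= expr1 divr1.
  rewrite u0 c1 expr0 expr1.
  have := u_ge0 1 y; lra.
have o1 := @odd_le m.+2 y isT.
rewrite (SS _ y) (SS _ (theta * y)) (SS _ (- (theta * y))) evenE uu oddE.
have h : 9 / 4 <= (3 / 2) ^+ m.+2 :> R.
  rewrite !exprS mulrA; have : 1 <= (3 / 2 : R) ^+ m by rewrite exprn_ege1 //; lra.
  lra.
have := ler_wpM2r (u_ge0 m.+2 y) h.
have := u_ge0 m.+2 y; lra.
Qed.

Lemma expR_sub_le_cosh y :
  expR y - y <= (expR (Num.sqrt (3 / 2) * y) + expR (- (Num.sqrt (3 / 2) * y))) / 2.
Proof.
have cS z : S m.+2 z @[m --> \oo] --> expR z.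
  by have := @cvgS z; rewrite -(cvg_shiftn 2); under eq_fun do rewrite addn2.
have cu : u m.+2 y @[m --> \oo] --> (0 : R).
  by have := @cvgu y; rewrite -(cvg_shiftn 2); under eq_fun do rewrite addn2.
have c1 : S m.+2 y - y @[m --> \oo] --> expR y - y.
  by apply: cvgB => //; exact: cvg_cst.
have c2 : (S m.+2 (theta * y) + S m.+2 (- (theta * y))) / 2 + 2 / 3 * u m.+2 y
   @[m --> \oo] --> (expR (theta * y) + expR (- (theta * y))) / 2 + 2 / 3 * 0.
  by apply: cvgD; [apply: cvgMl; exact: cvgD | exact: cvgMr].
rewrite mulr0 addr0 in c2.
rewrite -(cvg_lim _ c1) // -(cvg_lim _ c2) //; apply: ler_lim.
- by apply/cvg_ex; eexists; exact: c1.
- by apply/cvg_ex; eexists; exact: c2.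
- by apply: nearW => m; exact: claim.
Qed.

Lemma expRDN_le x y : `|x| <= `|y| ->
  expR x + expR (- x) <= expR y + expR (- y).
Proof.
have absE (z : R) : expR z + expR (- z) = expR `|z| + expR (- `|z|).
  by have [z0|z0] := ger0P z; rewrite // opprK addrC.
move=> xy; rewrite absE (absE y).
set a := `|x|; set b := `|y|.
have a0 : 0 <= a by exact: normr_ge0.
have b0 : 0 <= b by exact: normr_ge0.
have e1 : expR (- a) * expR a = 1 by rewrite -expRD addNr expR0.
have e2 : expR (- b) * expR b = 1 by rewrite -expRD addNr expR0.
have h1 : expR a <= expR b by rewrite ler_expR.
have h2 : 1 <= expR a by rewrite -expR0 ler_expR.
have h3 : 1 <= expR b by rewrite -expR0 ler_expR.
have h4 : expR (- a) * expR (- b) <= 1.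
  by rewrite -expRD -expR0 ler_expR -opprD oppr_le0 addr_ge0.
rewrite -subr_ge0.
(* The difference factors into two terms whose signs are visible from [0 <= a <= b]. *)
have -> : expR b + expR (- b) - (expR a + expR (- a)) =
   (expR b - expR a) * (1 - expR (- a) * expR (- b)).
  have -> : (expR b - expR a) * (1 - expR (- a) * expR (- b)) =
     expR b - expR a - (expR (- b) * expR b) * expR (- a) +
     (expR (- a) * expR a) * expR (- b) by ring.
  by rewrite e1 e2; ring.
by rewrite mulr_ge0 // subr_ge0.
Qed.

End ExpCosh.

(** * Products of a sub-Gaussian and a bounded variable *)

Section BoundedProduct.
Context {R : realType} d (T : measurableType d) (P : probability T R).
Local Open Scope ereal_scope.

(** Once the linear term is split off, the bound depends on [b] only through its absolute value,
    which [mu] replaces. Hence [b] may be any function of [V], provided the orthogonality of the two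
    kills the linear term. *)
Lemma subgaussian_mul_bounded_mgf (V b : T -> R) (rho mu l : R) :
  measurable_fun setT V -> measurable_fun setT b ->
  (forall w, `|b w| <= mu)%R ->
  (forall l : R, \int[P]_w (expR (l * V w))%:E <= (expR (rho ^+ 2 * l ^+ 2 / 2))%:E) ->
  P.-integrable setT (EFin \o (fun w => V w * b w)%R) ->
  \int[P]_w (V w * b w)%:E = 0 ->
  \int[P]_w (expR (l * (V w * b w)))%:E <=
  (expR (3 / 2 * rho ^+ 2 * mu ^+ 2 * l ^+ 2 / 2))%:E.
Proof.
move=> mV mb bmu HV iVb Vb0.
pose s := (Num.sqrt (3 / 2) * (l * mu))%R.
have s2 : (s ^+ 2 = 3 / 2 * l ^+ 2 * mu ^+ 2)%R.
  by rewrite exprMn sqr_sqrt_3_2 exprMn mulrA.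
have mexp (a : R) : measurable_fun setT (fun w => (expR (a * V w))%:E).
  by apply/measurable_EFinP; apply: measurableT_comp => //; exact: measurable_funM.
have iexp (a : R) : P.-integrable setT (fun w => (expR (a * V w))%:E).
  apply/integrableP; split => //.
  under eq_integral do rewrite gee0_abs ?lee_fin ?expR_ge0 //.
  by apply: le_lt_trans (HV a) _; rewrite ltry.
pose c w := ((expR (s * V w) + expR (- s * V w)) / 2)%R.
have ic : P.-integrable setT (EFin \o c).
  rewrite (_ : EFin \o c = (fun w => (2^-1)%:E * ((expR (s * V w))%:E + (expR (- s * V w))%:E))).
    by apply: integrableZl => //; apply: integrableD.
  by apply/funext => w; rewrite -EFinD -EFinM /= /c mulrC.
have il : P.-integrable setT (fun w => l%:E * (V w * b w)%:E).
  by apply: integrableZl.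
apply: (@le_trans _ _ (\int[P]_w (l%:E * (V w * b w)%:E + (c w)%:E))).
  apply: ge0_le_integral => //=.
  - apply/measurable_EFinP; apply: measurableT_comp => //.
    by apply: measurable_funM => //; exact: measurable_funM.
  - by apply: emeasurable_funD; apply: measurable_int; [exact: il|exact: ic].
  move=> w _; rewrite -EFinM -EFinD lee_fin.
  rewrite -lerBlDl; apply: le_trans (expR_sub_le_cosh _) _.
  rewrite ler_pM2r // mulNr; apply: expRDN_le.
  rewrite !normrM -!mulrA; apply: ler_wpM2l => //; apply: ler_wpM2l => //.
  rewrite mulrC; apply: ler_wpM2r => //.
  by apply: le_trans (bmu w) _; exact: ler_norm.
rewrite integralD // integralZl // Vb0 mule0 add0e.
rewrite (_ : \int[P]_w (c w)%:E = (2^-1)%:E *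
   (\int[P]_w (expR (s * V w))%:E + \int[P]_w (expR (- s * V w))%:E)).
  have h1 := HV s; have h2 := HV (- s)%R; rewrite sqrrN in h2.
  apply: le_trans (lee_wpmul2l _ (leeD h1 h2)) _; first by rewrite lee_fin.
  rewrite -EFinD -EFinM lee_fin s2 le_eqVlt; apply/orP; left; apply/eqP.
  rewrite -mulr2n -[X in (_ * X)%R]mulr_natl mulKf //; congr expR; ring.
rewrite -integralD // -integralZl //; last exact: integrableD.
by apply: eq_integral => w _; rewrite -EFinD -EFinM /c mulrC.
Qed.

End BoundedProduct.

(** * Generation of the sigma-algebra of matrices by row boxes *)

Section RowBoxes.
Context {R : realType} (n M : nat).

(** Independence of the samples gives product formulas for events that constrain each row
    separately; these form the pi-system from which general events of the sample matrix are
    reached. *)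
Definition row_box (A : 'I_n -> set 'cV[R]_M) : set 'M[R]_(n, M) :=
  [set B | forall i, A i (row i B)^T].

Definition row_boxes : set (set 'M[R]_(n, M)) :=
  [set row_box A | A in [set A | forall i, measurable (A i)]].

Lemma measurable_row_tr (i : 'I_n) :
  measurable_fun setT (fun B : 'M[R]_(n, M) => (row i B)^T).
Proof.
apply/measurable_mxP => j k; under eq_fun do rewrite !mxE.
exact: measurable_entry.
Qed.

Lemma measurable_row_boxes : @measurable _ 'M[R]_(n, M) = <<s row_boxes >>.
Proof.
apply/seteqP; split.
  apply: smallest_sub; first exact: smallest_sigma_algebra.
  move=> _ [[i j] _ [U mU <-]]; apply: sub_sigma_algebra.
  exists (fun k => if k == i then [set v : 'cV[R]_M | U (v j ord0)] else setT).
    move=> k /=; case: ifP => // _; rewrite -[X in measurable X]setTI.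
    exact: (measurable_entry j ord0 measurableT mU).
  rewrite setTI; apply/seteqP; split => B /= => [/(_ i)|BU k].
    by rewrite eqxx /= !mxE.
  by case: eqP => // ->; rewrite /= !mxE.
apply: smallest_sub; first exact: sigma_algebra_measurable.
move=> _ [A mA <-].
rewrite (_ : row_box A = \bigcap_(i in [set: 'I_n]) (fun B => (row i B)^T) @^-1` A i).
  apply: fin_bigcap_measurable => // i _.
  by rewrite -[X in measurable X]setTI; exact: measurable_row_tr.
by apply/seteqP; split => B /= BA i => [_|]; exact: BA.
Qed.

Lemma row_boxes_setI : setI_closed row_boxes.
Proof.
move=> _ _ [A mA <-] [B mB <-]; exists (fun i => A i `&` B i).
  by move=> i; exact: measurableI.
apply/seteqP; split => C /= => [h|[h1 h2] i]; last by split.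
by split => i; have [] := h i.
Qed.

Context d (T : measurableType d) (P : probability T R).
Local Open Scope ereal_scope.

(** Dynkin's theorem. Integrability is what allows the step to complements, by subtraction from the
    whole integral. *)
Lemma eq_integral_row_boxes (Y : T -> 'M[R]_(n, M)) (f1 f2 : T -> R) :
  measurable_fun setT Y ->
  P.-integrable setT (EFin \o f1) -> P.-integrable setT (EFin \o f2) ->
  (forall w, 0 <= f1 w)%R -> (forall w, 0 <= f2 w)%R ->
  (forall A, (forall i, measurable (A i)) ->
    \int[P]_(w in Y @^-1` row_box A) (f1 w)%:E =
    \int[P]_(w in Y @^-1` row_box A) (f2 w)%:E) ->
  forall B, measurable B ->
    \int[P]_(w in Y @^-1` B) (f1 w)%:E = \int[P]_(w in Y @^-1` B) (f2 w)%:E.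
Proof.
move=> mY if1 if2 f10 f20 f12 B mB.
have mYB C : measurable C -> measurable (Y @^-1` C).
  by move=> mC; rewrite -[X in measurable X]setTI; exact: mY.
have mf1 := measurable_int _ if1; have mf2 := measurable_int _ if2.
have splitC (f : T -> R) C : P.-integrable setT (EFin \o f) ->
    (forall w, 0 <= f w)%R -> measurable C ->
    \int[P]_(w in Y @^-1` (~` C)) (f w)%:E =
    \int[P]_w (f w)%:E - \int[P]_(w in Y @^-1` C) (f w)%:E.
  move=> fi f0 mC.
  have mf := measurable_int _ fi.
  have iC : P.-integrable (Y @^-1` C) (EFin \o f).
    by apply: integrableS fi => //; exact: mYB.
  have -> : \int[P]_w (f w)%:E = \int[P]_(w in Y @^-1` (~` C)) (f w)%:E +
                                 \int[P]_(w in Y @^-1` C) (f w)%:E.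
    rewrite -ge0_integral_setU //=.
    - by rewrite -?preimage_setU setvU ?preimage_setT.
    - by apply: mYB; exact: measurableC.
    - exact: mYB.
    - exact: measurable_funTS.
    - by move=> w _; rewrite lee_fin.
    - by apply/disj_setPS => w [].
  by rewrite addeK //; apply: integrable_fin_num iC; exact: mYB.
have mE := measurable_row_boxes.
have YT : Y @^-1` [set: 'M[R]_(n, M)] = setT by [].
have boxT : row_box (fun=> setT) = setT.
  by apply/seteqP; split.
have fT : \int[P]_w (f1 w)%:E = \int[P]_w (f2 w)%:E.
  by rewrite -YT -boxT; apply: f12.
move: mB; rewrite mE => mB.
apply: (@dynkin_induction _ _ row_boxes (fun C =>
  \int[P]_(w in Y @^-1` C) (f1 w)%:E = \int[P]_(w in Y @^-1` C) (f2 w)%:E)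
  mE row_boxes_setI _ _ _ _ _ mB).
- exact: fT.
- by move=> _ [A mA <-]; exact: f12.
- by move=> C mC f12C; rewrite !splitC // fT f12C.
move=> F mF tF f12F; rewrite preimage_bigcup.
have tYF : trivIset setT (fun k => Y @^-1` F k).
  by apply/trivIsetP => i j _ _ ij; rewrite -preimage_setI;
     move/trivIsetP : tF => -> //; rewrite preimage_set0.
have bigE (f : T -> R) : measurable_fun setT (EFin \o f) ->
    (forall w, 0 <= f w)%R ->
    \int[P]_(w in \bigcup_k (Y @^-1` F k)) (f w)%:E =
    \sum_(0 <= k <oo) \int[P]_(w in Y @^-1` F k) (f w)%:E.
  move=> mf f0; rewrite (@ge0_integral_bigcup _ _ _ P (fun k => Y @^-1` F k)) //.
  - by move=> k; exact: mYB.
  - exact: measurable_funTS.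
  - by move=> w _; rewrite lee_fin.
rewrite !bigE //.
by apply: eq_eseriesr => k _; exact: f12F.
Qed.

End RowBoxes.

(** * Exponential moments given the observations of the samples *)

Section ConditionalMGF.
Context {R : realType} d (T : measurableType d) (P : probability T R).
Context d' (T' : measurableType d') (n M : nat).
Context (S : 'I_n -> T -> T') (y : T' -> 'cV[R]_M) (r : T' -> R) (v : R).
Hypothesis indS : mutually_independent_RV P S.
Hypothesis mS : forall i, measurable_fun setT (S i).
Hypothesis my : measurable_fun setT y.
Hypothesis mr : measurable_fun setT r.
Local Open Scope ereal_scope.

(** [m] is the conditional exponential moment of [r] given [y], in integrated form. One function
    serves all samples and its bound holds at every point, so that a product over the samples can be
    bounded pointwise. *)
Hypothesis cond_mgf : forall l : R, exists m : 'cV[R]_M -> R,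
  [/\ measurable_fun setT m,
      forall z, (0 <= m z <= expR (v * l ^+ 2 / 2))%R &
      forall i B, measurable B ->
        \int[P]_w (\1_B (y (S i w)) * expR (l * r (S i w)))%:E =
        \int[P]_w (\1_B (y (S i w)) * m (y (S i w)))%:E].

Definition rows_of (w : T) : 'M[R]_(n, M) := \matrix_(i, j) y (S i w) j ord0.

Lemma row_rows_of i w : (row i (rows_of w))^T = y (S i w).
Proof. by apply/colP => j; rewrite !mxE. Qed.

Lemma measurable_rows_of : measurable_fun setT rows_of.
Proof.
apply/measurable_mxP => i j; under eq_fun do rewrite mxE.
apply: measurableT_comp (measurable_entry j ord0) _.
exact: measurableT_comp.
Qed.

Lemma indic_row_box A w :
  \1_(row_box A) (rows_of w) = (\prod_i \1_(A i) (y (S i w)))%R :> R.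
Proof.
rewrite indicE; under eq_bigr do rewrite indicE.
have [/set_mem h|h] := boolP (rows_of w \in _).
  by rewrite big1 // => i _; rewrite mem_set // -row_rows_of; exact: h.
apply/esym/eqP; rewrite prodf_seq_eq0; apply: contraNT h => /hasPn h.
apply/mem_set => i; rewrite row_rows_of; apply/set_mem.
by have := h i (mem_index_enum i); rewrite /= pnatr_eq0 eqb0 negbK.
Qed.

Let mexp (l : R) : measurable_fun setT (fun s => expR (l * r s)).
Proof. by apply: measurableT_comp => //; exact: measurable_funM. Qed.

(** By independence the exponentials may be replaced by the functions [m] on every row box, hence on
    every event of the rows by the Dynkin argument; only then is the bound on [m] used. *)
Lemma cond_mgf_rows_cst (l : 'I_n -> R) B : measurable B ->
  \int[P]_(w in rows_of @^-1` B) (\prod_i expR (l i * r (S i w)))%:E <=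
  (expR (v * (\sum_i l i ^+ 2) / 2))%:E * P (rows_of @^-1` B).
Proof.
move=> mB; have /choice[m hm] := fun i => cond_mgf (l i).
have mm i : measurable_fun setT (m i) by case: (hm i).
have m0 i z : (0 <= m i z)%R by have [_ /(_ z)/andP[]] := hm i.
have m1 i z : (m i z <= expR (v * l i ^+ 2 / 2))%R.
  by have [_ /(_ z)/andP[]] := hm i.
have myS i : measurable_fun setT (fun w => y (S i w)) by exact: measurableT_comp.
pose f1 w := (\prod_i expR (l i * r (S i w)))%R.
pose f2 w := (\prod_i m i (y (S i w)))%R.
have f20 w : (0 <= f2 w)%R by apply: prodr_ge0 => i _.
have f2K w : (f2 w <= expR (v * (\sum_i l i ^+ 2) / 2))%R.
  rewrite mulr_sumr mulr_suml expR_sum; apply: ler_prod => i _.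
  by rewrite m0 m1.
have mf1 : measurable_fun setT f1.
  by apply: measurable_prod => i _; exact: measurableT_comp (mexp (l i)) (mS i).
have mf2 : measurable_fun setT f2.
  by apply: measurable_prod => i _; exact: measurableT_comp.
have if2 : P.-integrable setT (EFin \o f2).
  apply: (@le_integrable _ _ _ P setT measurableT _
    (EFin \o cst (expR (v * (\sum_i l i ^+ 2) / 2)))).
  - exact/measurable_EFinP.
  - move=> w _ /=; rewrite lee_fin ger0_norm // ger0_norm ?expR_ge0 //.
  by apply: finite_measure_integrable_cst.
have eqi A i : measurable A ->
    \int[P]_w (\1_A (y (S i w)) * expR (l i * r (S i w)))%:E =
    \int[P]_w (\1_A (y (S i w)) * m i (y (S i w)))%:E.
  by have [_ _ h] := hm i => mA; exact: h.
have bi A i : measurable A ->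
    \int[P]_w (\1_A (y (S i w)) * m i (y (S i w)))%:E < +oo.
  move=> mA; apply: (@le_lt_trans _ _
    (\int[P]_w (expR (v * l i ^+ 2 / 2))%:E)); last first.
    by rewrite integral_probability_cst ltry.
  have mmA : measurable_fun setT (fun w => (\1_A (y (S i w)) * m i (y (S i w)))%R).
    apply: measurable_funM; last exact: measurableT_comp.
    by apply: measurableT_comp (myS i); exact: measurable_indic.
  apply: ge0_le_integral => //=.
  - by move=> w _; rewrite lee_fin mulr_ge0.
  - exact/measurable_EFinP.
  move=> w _; rewrite lee_fin; apply: le_trans (m1 i (y (S i w))).
  by rewrite ler_piMl // indicE lern1 leq_b1.
have mA1 A : measurable A -> measurable_fun setT (fun s => \1_A (y s) : R).
  by move=> mA; apply: measurableT_comp my; exact: measurable_indic.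
have box A : (forall i, measurable (A i)) ->
    \int[P]_w (\1_(row_box A) (rows_of w) * f1 w)%:E =
    \int[P]_w (\1_(row_box A) (rows_of w) * f2 w)%:E.
  move=> mA; under eq_integral do rewrite indic_row_box -big_split /=.
  under [RHS]eq_integral do rewrite indic_row_box -big_split /=.
  rewrite (independent_integral_prod (U := S) (f := fun i s =>
    (\1_(A i) (y s) * expR (l i * r s))%R) indS mS) /=; first last.
  - by move=> i; rewrite eqi //; exact: bi.
  - by move=> i s; rewrite mulr_ge0 ?expR_ge0.
  - by move=> i; apply: measurable_funM => //; exact: mA1.
  rewrite (independent_integral_prod (U := S) (f := fun i s =>
    (\1_(A i) (y s) * m i (y s))%R) indS mS) /=; first last.
  - by move=> i; exact: bi.
  - by move=> i s; rewrite mulr_ge0.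
  - by move=> i; apply: measurable_funM; [exact: mA1|exact: measurableT_comp].
  by apply: eq_bigr => i _; exact: eqi.
have boxT : row_box (fun=> setT) = setT :> set 'M[R]_(n, M).
  by apply/seteqP; split.
(* The product of exponentials has the same integral as the bounded product [f2], by the identity on
   the whole space, and is therefore integrable. *)
have if1 : P.-integrable setT (EFin \o f1).
  apply/integrableP; split; first exact/measurable_EFinP.
  have := box (fun=> setT) (fun=> measurableT); rewrite boxT => h.
  rewrite (_ : \int[P]_w `|(EFin \o f1) w| = \int[P]_w (f2 w)%:E).
    have /integrableP[_] := if2; apply: le_lt_trans.
    apply: ge0_le_integral => //=.
    - by move=> w _; rewrite lee_fin.
    - exact/measurable_EFinP.
    - by apply/measurable_EFinP; apply: measurableT_comp.
    by move=> w _; rewrite lee_fin ler_norm.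
  transitivity (\int[P]_w (\1_[set: 'M[R]_(n, M)] (rows_of w) * f1 w)%:E).
    apply: eq_integral => w _ /=; rewrite indicT mul1r ger0_norm //.
    by apply: prodr_ge0 => i _; exact: expR_ge0.
  by rewrite h; apply: eq_integral => w _; rewrite indicT mul1r.
rewrite (@eq_integral_row_boxes _ _ _ _ _ P rows_of f1 f2) //.
- apply: (@le_trans _ _ (\int[P]_(w in rows_of @^-1` B)
     (expR (v * (\sum_i l i ^+ 2) / 2))%:E)).
    have mYB : measurable (rows_of @^-1` B).
      by rewrite -[X in measurable X]setTI; exact: measurable_rows_of.
    apply: ge0_le_integral => //=.
    - by move=> w _; rewrite lee_fin.
    - by apply: measurable_funTS; exact/measurable_EFinP.
    by move=> w _; rewrite lee_fin f2K.
  rewrite integral_cst //.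
  by rewrite -[X in measurable X]setTI; exact: measurable_rows_of.
- exact: measurable_rows_of.
- by move=> w; apply: prodr_ge0 => i _; exact: expR_ge0.
move=> A mA; rewrite !integral_preimage_indic; exact: box.
Qed.

(** The compensator inside the exponential makes the bound [1] whatever the size of the
    coefficients, which depend on the observed rows. Rounded coefficients are constant on countably
    many events of the rows, where the previous bound applies; refining the rounding needs only
    Fatou's lemma. *)
Lemma cond_mgf_rows (alpha : 'I_n -> 'M[R]_(n, M) -> R) :
  (forall i, measurable_fun setT (alpha i)) ->
  \int[P]_w (expR (\sum_i alpha i (rows_of w) * r (S i w) -
                   v * (\sum_i alpha i (rows_of w) ^+ 2) / 2))%:E <= 1.
Proof.
move=> malpha.
pose E (a : 'I_n -> R) w :=
  expR (\sum_i a i * r (S i w) - v * (\sum_i a i ^+ 2) / 2).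
pose ak k w i := floor_approx k (alpha i (rows_of w)).
pose Z k w : 'cV[int]_n :=
  \col_i Num.floor (alpha i (rows_of w) * k.+1%:R)%R.
have ZkE k w i : Z k w i ord0 = Num.floor (alpha i (rows_of w) * k.+1%:R)%R.
  by rewrite mxE.
(* Cells on which the rounded coefficients are constant, indexed by the code of the integer vector
   [Z k]; codes that are not attained give empty cells. *)
pose F k m := [set w | pickle (Z k w) = m].
have tF k : trivIset setT (F k).
  by apply/trivIsetP => i j _ _ ij; apply/seteqP; split => // w [/= e1 e2];
     move: ij; rewrite -e1 -e2 eqxx.
have FT k : \bigcup_m F k m = setT.
  by apply/seteqP; split => // w _; exists (pickle (Z k w)).
have FE k w0 : exists2 B, measurable B &
    F k (pickle (Z k w0)) = rows_of @^-1` B.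
  exists (\bigcap_(i in [set: 'I_n]) (alpha i @^-1`
    [set` `[((Z k w0 i ord0)%:~R / k.+1%:R)%R : R,
            ((Z k w0 i ord0 + 1)%:~R / k.+1%:R)%R[])).
    apply: fin_bigcap_measurable => // i _.
    by rewrite -[X in measurable X]setTI; apply: malpha => //.
  have k0 : (0 < k.+1%:R :> R)%R by rewrite ltr0n.
  have flE i w : ((Z k w0 i ord0)%:~R / k.+1%:R <= alpha i (rows_of w) <
      (Z k w0 i ord0 + 1)%:~R / k.+1%:R)%R = (Z k w i ord0 == Z k w0 i ord0).
    rewrite ler_pdivrMr // ltr_pdivlMr // (ZkE k w i).
    apply/idP/eqP => [/floor_def //|<-]; exact: floor_itv.
  apply/seteqP; split => w /=.
    move=> /(pcan_inj (@pickleK _)) Zw i _ /=.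
    by rewrite in_itv /= flE Zw.
  move=> h; congr pickle; apply/colP => i; apply/eqP; rewrite -flE.
  by have := h i I; rewrite /= in_itv.
have mF k m : measurable (F k m).
  have [[w0 <-]|h] := pselect (exists w0, pickle (Z k w0) = m).
    have [B mB ->] := FE k w0; rewrite -[X in measurable X]setTI.
    exact: measurable_rows_of.
  rewrite (_ : F k m = set0) //; apply/seteqP; split => // w Fw.
  by apply: h; exists w.
have mE (a : T -> 'I_n -> R) : (forall i, measurable_fun setT (fun w => a w i)) ->
    measurable_fun setT (fun w => E (a w) w).
  move=> ma; apply: measurableT_comp => //; apply: measurable_funB.
    apply: measurable_sum => i; apply: measurable_funM => //.
    exact: measurableT_comp.
  apply: measurable_funM => //; apply: measurable_funM => //.
  by apply: measurable_sum => i; exact: measurable_funX.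
have ZE k w i : ak k w i = ((Z k w i ord0)%:~R / k.+1%:R)%R.
  by rewrite ZkE.
have makF k i : measurable_fun setT (fun w => ak k w i).
  rewrite -(FT k); apply/measurable_fun_bigcup => // m.
  have [[w0 <-]|h] := pselect (exists w0, pickle (Z k w0) = m).
    apply: (eq_measurable_fun (cst (ak k w0 i))); last exact: measurable_cst.
    move=> w /set_mem /= /(pcan_inj (@pickleK _)) Zw.
    by rewrite /= !ZE Zw.
  rewrite (_ : F k m = set0); first exact: measurable_fun_set0.
  by apply/seteqP; split => // w Fw; apply: h; exists w.
have step k : \int[P]_w (E (ak k w) w)%:E <= 1.
  have mEk : measurable_fun (\bigcup_m F k m) (fun w => (E (ak k w) w)%:E).
    by apply: measurable_funTS; apply/measurable_EFinP; exact: mE.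
  have := @ge0_integral_bigcup _ _ _ P (F k) _ (mF k) mEk
    (fun w _ => expR_ge0 _) (tF k).
  rewrite FT => ->.
  (* The total mass is distributed over the cells, so that the comparison can be made cell by
     cell. *)
  have P1 : 1 = \sum_(0 <= m <oo) P (F k m).
    rewrite -measure_semi_bigcup ?FT //.
    by rewrite [RHS]probability_setT.
  rewrite [leRHS]P1.
  apply: lee_nneseries => [m _ _|m _].
    by apply: integral_ge0 => w _; rewrite lee_fin expR_ge0.
  have [[w0 <-]|h] := pselect (exists w0, pickle (Z k w0) = m); last first.
    rewrite (_ : F k m = set0) ?integral_set0 //.
    by apply/seteqP; split => // w Fw; apply: h; exists w.
  pose l i := ak k w0 i.
  rewrite (eq_integral (fun w => (expR (- (v * (\sum_i l i ^+ 2) / 2)))%:E *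
     (\prod_i expR (l i * r (S i w)))%:E)); last first.
    move=> w /set_mem /= /(pcan_inj (@pickleK _)) Zw.
    have -> : ak k w = l by apply/funext => i; rewrite /l !ZE Zw.
    have prodE : (\prod_i expR (l i * r (S i w)) =
        expR (\sum_i l i * r (S i w)))%R by rewrite expR_sum.
    by rewrite prodE /E addrC expRD EFinM.
  have [B mB FB] := FE k w0.
  rewrite ge0_integralZl //=; first last.
  - by move=> w _; rewrite lee_fin prodr_ge0 // => i _; exact: expR_ge0.
  - apply: measurable_funTS; apply/measurable_EFinP.
    by apply: measurable_prod => i _; exact: measurableT_comp (mexp (l i)) (mS i).
  rewrite FB; apply: le_trans (lee_wpmul2l _ (cond_mgf_rows_cst l mB)) _.
    by rewrite lee_fin expR_ge0.
  by rewrite muleA -EFinM -expRD addNr expR0 mul1e.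
apply: (@le_trans _ _ (\int[P]_w limn_einf (fun k => (E (ak k w) w)%:E))).
  rewrite le_eqVlt; apply/orP; left; apply/eqP; apply: eq_integral => w _.
  apply/esym; apply: (cvg_limn_einf_sup _).1; apply: cvg_EFin.
    by apply: nearW.
  apply: (cvg_comp _ expR); last exact: continuous_expR.
  apply: cvgB.
    apply: cvg_sumr => i; apply: cvgMl; exact: cvg_floor_approx.
  apply: cvgMl; apply: cvgMr; apply: cvg_sumr => i.
  by under eq_fun do rewrite expr2; rewrite expr2; apply: cvgM; exact: cvg_floor_approx.
apply: le_trans (fatou P measurableT _ _) _.
- by move=> k; apply/measurable_EFinP; exact: mE.
- by move=> k w _; rewrite lee_fin expR_ge0.
rewrite limn_einf_lim; apply: lime_le; first exact: is_cvg_einfs.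
apply: nearW => k; apply: le_trans (step k).
by apply: ereal_inf_lbound; exists k => /=.
Qed.

End ConditionalMGF.

(** * Square integrable vectors and their second moments *)

Section SquareIntegrable.
Context {R : realType} d (T : measurableType d) (P : probability T R).

Definition L2 (f : T -> R) : Prop :=
  measurable_fun setT f /\ P.-integrable setT (EFin \o (fun w => f w ^+ 2)).

Definition ip (f g : T -> R) : R := fine (\int[P]_w (f w * g w)%:E)%E.

Lemma L2_mul f g : L2 f -> L2 g -> P.-integrable setT (EFin \o (fun w => f w * g w)).
Proof.
move=> [mf if2] [mg ig2].
apply: (@le_integrable _ _ _ P setT measurableT _
  (fun w => (f w ^+ 2)%:E + (g w ^+ 2)%:E)%E).
- by apply/measurable_EFinP; exact: measurable_funM.
- move=> w _ /=; rewrite lee_fin [leRHS]ger0_norm ?addr_ge0 ?sqr_ge0 //.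
  have h1 := sqr_ge0 (f w - g w); have h2 := sqr_ge0 (f w + g w).
  by rewrite ler_norml; apply/andP; split; nra.
- exact: integrableD.
Qed.

Lemma ipE f g : L2 f -> L2 g -> (\int[P]_w (f w * g w)%:E)%E = (ip f g)%:E.
Proof. by move=> hf hg; rewrite fineK //; apply: integrable_fin_num => //; exact: L2_mul. Qed.

Lemma L2_cst a : L2 (fun=> a).
Proof. by split; [exact: measurable_cst | exact: finite_measure_integrable_cst]. Qed.

Lemma L2_integrable f : L2 f -> P.-integrable setT (EFin \o f).
Proof.
move=> hf; have := L2_mul hf (L2_cst 1).
by under [X in _.-integrable _ (EFin \o X)]eq_fun do rewrite mulr1.
Qed.

Lemma L2Z a f : L2 f -> L2 (fun w => a * f w).
Proof.
move=> [mf if2]; split; first exact: measurable_funM.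
rewrite (_ : _ \o _ = (fun w => (a ^+ 2)%:E * (f w ^+ 2)%:E)%E).
  exact: integrableZl.
by apply/funext => w; rewrite /= exprMn.
Qed.

Lemma L2D f g : L2 f -> L2 g -> L2 (fun w => f w + g w).
Proof.
move=> hf hg; split; first by apply: measurable_funD; [case: hf|case: hg].
rewrite (_ : _ \o _ = (fun w => ((f w ^+ 2)%:E + (g w ^+ 2)%:E) +
   2%:E * (f w * g w)%:E)%E).
  apply: integrableD => //; first by apply: integrableD; [| case: hf|case: hg].
  by apply: integrableZl => //; exact: L2_mul.
by apply/funext => w; rewrite /= -!EFinD; congr EFin; ring.
Qed.

Lemma L2_sum I (r : seq I) (f : I -> T -> R) :
  (forall i, L2 (f i)) -> L2 (fun w => \sum_(i <- r) f i w).
Proof.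
move=> hf; elim: r => [|i r IH].
  by under eq_fun do rewrite big_nil; exact: L2_cst.
by under eq_fun do rewrite big_cons; exact: L2D.
Qed.

Lemma ipC f g : ip f g = ip g f.
Proof. by rewrite /ip; under eq_integral do rewrite mulrC. Qed.

Lemma ipDl f f' g : L2 f -> L2 f' -> L2 g ->
  ip (fun w => f w + f' w) g = ip f g + ip f' g.
Proof.
move=> hf hf' hg; apply: EFin_inj; rewrite EFinD -!ipE //; last exact: L2D.
under eq_integral do rewrite mulrDl EFinD.
by rewrite integralD //; exact: L2_mul.
Qed.

Lemma ipZl a f g : L2 f -> L2 g -> ip (fun w => a * f w) g = a * ip f g.
Proof.
move=> hf hg; apply: EFin_inj; rewrite EFinM -!ipE //; last exact: L2Z.
under eq_integral do rewrite -mulrA EFinM.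
by rewrite integralZl //; exact: L2_mul.
Qed.

Lemma ip_suml I (r : seq I) (f : I -> T -> R) g : (forall i, L2 (f i)) -> L2 g ->
  ip (fun w => \sum_(i <- r) f i w) g = \sum_(i <- r) ip (f i) g.
Proof.
move=> hf hg; elim: r => [|i r IH].
  rewrite big_nil /ip; under eq_integral do rewrite big_nil mul0r.
  by rewrite integral0.
rewrite big_cons -IH -ipDl //; last exact: L2_sum.
by congr ip; apply/funext => w; rewrite big_cons.
Qed.

Definition L2v m (U : T -> 'cV[R]_m) : Prop := forall i, L2 (coordinate U i).

(** Uncentred cross moments, on which linear maps act by plain matrix products; they are covariances
    once the means vanish. *)
Definition ipmx m p (U : T -> 'cV[R]_m) (V : T -> 'cV[R]_p) : 'M[R]_(m, p) :=
  \matrix_(i, j) ip (coordinate U i) (coordinate V j).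

Lemma coordinate_mul m p (B : 'M[R]_(m, p)) (U : T -> 'cV[R]_p) i :
  coordinate (fun w => B *m U w) i = fun w => \sum_j B i j * coordinate U j w.
Proof. by apply/funext => w; rewrite /coordinate mxE. Qed.

Lemma L2v_mul m p (B : 'M[R]_(m, p)) (U : T -> 'cV[R]_p) :
  L2v U -> L2v (fun w => B *m U w).
Proof.
by move=> hU i; rewrite coordinate_mul; apply: L2_sum => j; exact: L2Z.
Qed.

Lemma L2vD m (U V : T -> 'cV[R]_m) : L2v U -> L2v V -> L2v (fun w => U w + V w).
Proof.
move=> hU hV i; rewrite (_ : coordinate _ i = fun w => coordinate U i w + coordinate V i w).
  exact: L2D.
by apply/funext => w; rewrite /coordinate mxE.
Qed.

Lemma ipmx_tr m p (U : T -> 'cV[R]_m) (V : T -> 'cV[R]_p) :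
  (ipmx U V)^T = ipmx V U.
Proof. by apply/matrixP => i j; rewrite !mxE ipC. Qed.

Lemma ipmx_mull m p q (B : 'M[R]_(m, p)) (U : T -> 'cV[R]_p) (V : T -> 'cV[R]_q) :
  L2v U -> L2v V -> ipmx (fun w => B *m U w) V = B *m ipmx U V.
Proof.
move=> hU hV; apply/matrixP => i j; rewrite !mxE coordinate_mul ip_suml //.
  by apply: eq_bigr => k _; rewrite ipZl // mxE.
by move=> k; exact: L2Z.
Qed.

Lemma ipmx_mulr m p q (B : 'M[R]_(m, p)) (U : T -> 'cV[R]_p) (V : T -> 'cV[R]_q) :
  L2v U -> L2v V -> ipmx V (fun w => B *m U w) = ipmx V U *m B^T.
Proof. by move=> hU hV; rewrite -ipmx_tr ipmx_mull // trmx_mul ipmx_tr. Qed.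

Lemma ipmxDl m q (U U' : T -> 'cV[R]_m) (V : T -> 'cV[R]_q) :
  L2v U -> L2v U' -> L2v V -> ipmx (fun w => U w + U' w) V = ipmx U V + ipmx U' V.
Proof.
move=> hU hU' hV; apply/matrixP => i j; rewrite !mxE -ipDl //; congr ip.
by apply/funext => w; rewrite /coordinate mxE.
Qed.

Lemma ipmxDr m q (U U' : T -> 'cV[R]_m) (V : T -> 'cV[R]_q) :
  L2v U -> L2v U' -> L2v V -> ipmx V (fun w => U w + U' w) = ipmx V U + ipmx V U'.
Proof. by move=> hU hU' hV; rewrite -ipmx_tr ipmxDl // linearD /= !ipmx_tr. Qed.

Lemma ipmx_psd m (U : T -> 'cV[R]_m) : L2v U -> psd (ipmx U U).
Proof.
move=> hU; split=> [|x]; first exact: ipmx_tr.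
have : 0 <= ipmx (fun w => x^T *m U w) (fun w => x^T *m U w) ord0 ord0.
  rewrite mxE; apply: fine_ge0; apply: integral_ge0 => w _.
  by rewrite lee_fin -expr2 sqr_ge0.
rewrite ipmx_mull ?ipmx_mulr //; last exact: L2v_mul.
by rewrite trmxK mulmxA /qform /dotv mulmxA.
Qed.

Lemma integral_norm2_sqr m (U : T -> 'cV[R]_m) : L2v U ->
  (\int[P]_w (norm2 (U w) ^+ 2)%:E)%E = (\tr (ipmx U U))%:E.
Proof.
move=> hU; under eq_integral do rewrite norm2_sqr dotvv_sqr.
rewrite /mxtrace; under eq_bigr do rewrite mxE.
rewrite -sumEFin -[RHS](eq_bigr _ (fun i _ => ipE (hU i) (hU i))).
under eq_integral do rewrite -sumEFin.
rewrite ge0_integral_sum //; first last.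
- by move=> i w _; rewrite lee_fin sqr_ge0.
- move=> i; apply/measurable_EFinP; apply: measurable_funX.
  by case: (hU i).
Qed.

Lemma mean_zero_ip m (U : T -> 'cV[R]_m) : L2v U ->
  mean_zero P U <-> forall i, ip (coordinate U i) (fun=> 1) = 0.
Proof.
move=> hU; have E i : 'E_P[coordinate U i]%E = (ip (coordinate U i) (fun=> 1))%:E.
  rewrite -ipE //; last exact: L2_cst.
  by rewrite unlock; apply: eq_integral => w _; rewrite mulr1.
by split => h i; [apply: EFin_inj; rewrite -E h|rewrite E h].
Qed.

Lemma covmx_ipmx m (U : T -> 'cV[R]_m) : mean_zero P U -> covmx P U = ipmx U U.
Proof.
move=> mU; apply/matrixP => i j; rewrite !mxE covariance.unlock !mU /=.
by rewrite unlock; congr fine; apply: eq_integral => w _; rewrite fctE /= !subr0.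
Qed.

Lemma mean_zero_mul m p (B : 'M[R]_(m, p)) (U : T -> 'cV[R]_p) :
  L2v U -> mean_zero P U -> mean_zero P (fun w => B *m U w).
Proof.
move=> hU /(mean_zero_ip hU) h; apply: (mean_zero_ip (@L2v_mul _ _ B _ hU)).2 => i.
rewrite coordinate_mul ip_suml; last 2 first.
- by move=> j; exact: L2Z.
- exact: L2_cst.
by rewrite big1 // => j _; rewrite ipZl ?h ?mulr0 //; exact: L2_cst.
Qed.

Lemma mean_zeroD m (U V : T -> 'cV[R]_m) : L2v U -> L2v V ->
  mean_zero P U -> mean_zero P V -> mean_zero P (fun w => U w + V w).
Proof.
move=> hU hV /(mean_zero_ip hU) h1 /(mean_zero_ip hV) h2.
apply: (mean_zero_ip (L2vD hU hV)).2 => i.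
rewrite (_ : coordinate _ i = fun w => coordinate U i w + coordinate V i w).
  by rewrite ipDl ?h1 ?h2 ?addr0 //; exact: L2_cst.
by apply/funext => w; rewrite /coordinate mxE.
Qed.

End SquareIntegrable.

(** * Orthogonality to functions of an observation *)

Section Orthogonality.
Context {R : realType} d (T : measurableType d) (P : probability T R).

Let pp (f : T -> R) w := Num.max (f w) 0.

Lemma max0_sub (x : R) : Num.max x 0 - Num.max (- x) 0 = x.
Proof. by rewrite /Num.max oppr_lt0; case: (ltgtP x 0) => [h|h|->]; rewrite ?sub0r ?subr0 ?opprK. Qed.

Lemma max0_ge0 (x : R) : 0 <= Num.max x 0.
Proof. by rewrite le_max lexx orbT. Qed.

Lemma L2_max0 f : L2 P f -> L2 P (pp f).
Proof.
move=> [mf if2].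
have mp : measurable_fun setT (pp f) by exact: measurable_maxr.
split=> //; apply: (@le_integrable _ _ _ P setT measurableT _ _ _ _ if2).
  by apply/measurable_EFinP; exact: measurable_funX.
move=> w _ /=; rewrite lee_fin !ger0_norm ?sqr_ge0 // /pp.
by rewrite maxEle; case: ifP => // _; rewrite expr0n sqr_ge0.
Qed.

Lemma L2N f : L2 P f -> L2 P (fun w => - f w).
Proof. by move/(@L2Z _ _ _ _ (-1)); under eq_fun do rewrite mulN1r. Qed.

Lemma integral_max0 (D : set T) (g : T -> R) : measurable D -> L2 P g ->
  (\int[P]_(w in D) (g w)%:E = \int[P]_(w in D) (pp g w)%:E -
     \int[P]_(w in D) (pp (fun w => - g w) w)%:E)%E.
Proof.
move=> mD hg.
have ip0 : P.-integrable D (EFin \o pp g).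
  by apply: integrableS (L2_integrable (L2_max0 hg)).
have in0 : P.-integrable D (EFin \o pp (fun w => - g w)).
  by apply: integrableS (L2_integrable (L2_max0 (L2N hg))).
rewrite -integralB //; apply: eq_integral => w _.
by rewrite -EFinB max0_sub.
Qed.

(** The last hypothesis says that [g] has zero conditional mean given [S]. Positive and negative
    parts of both [f] and [g] are treated separately, since the weighted comparison is for
    nonnegative functions. *)
Lemma ip_orthogonal d' (T' : measurableType d') (S : T -> T') (f : T' -> R)
    (g : T -> R) :
  measurable_fun setT S -> measurable_fun setT f ->
  L2 P (f \o S) -> L2 P g ->
  (forall B, measurable B -> \int[P]_(w in S @^-1` B) (g w)%:E = 0)%E ->
  ip P (f \o S) g = 0.
Proof.
move=> mS mf hf hg g0; have hNg := L2N hg.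
have h1 := L2_max0 hg; have h2 := L2_max0 hNg.
have e B : measurable B -> (\int[P]_(w in S @^-1` B) (pp g w)%:E =
    \int[P]_(w in S @^-1` B) (pp (fun w => - g w) w)%:E)%E.
  move=> mB; have mSB : measurable (S @^-1` B).
    by rewrite -[X in measurable X]setTI; exact: mS.
  have := integral_max0 mSB hg; rewrite g0 // => /esym/eqP.
  rewrite sube_eq; last 2 first.
  - apply: integrable_fin_num => //.
    by apply: (integrableS measurableT mSB) => //; exact: L2_integrable.
  - by rewrite fin_num_adde_defr.
  by rewrite add0e => /eqP.
have F0 (F : T' -> R) : measurable_fun setT F -> (forall y, 0 <= F y) ->
    L2 P (F \o S) -> ip P (F \o S) g = 0.
  move=> mF F0 hF.
  have e1 : ip P (F \o S) (pp g) = ip P (F \o S) (pp (fun w => - g w)).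
    rewrite /ip; congr fine; under eq_integral do rewrite EFinM.
    under [RHS]eq_integral do rewrite EFinM.
    apply: (@eq_integral_weighted _ _ _ _ _ P S (pp g) _ (EFin \o F)) => //.
    - by case: h1.
    - by case: h2.
    - by move=> w; exact: max0_ge0.
    - by move=> w; exact: max0_ge0.
    - exact/measurable_EFinP.
  have -> : g = fun w => pp g w + -1 * pp (fun w => - g w) w.
    by apply/funext => w; rewrite mulN1r max0_sub.
  rewrite ipC ipDl //; last exact: L2Z.
  by rewrite ipZl // ipC e1 ipC mulN1r subrr.
have mmax (F : T' -> R) : measurable_fun setT F ->
  measurable_fun setT (fun y => Num.max (F y) 0).
  by move=> mF; exact: measurable_maxr.
have -> : f \o S = fun w => Num.max (f (S w)) 0 + -1 * Num.max (- f (S w)) 0.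
  by apply/funext => w; rewrite mulN1r max0_sub.
have hp : L2 P (fun w => Num.max (f (S w)) 0) by exact: L2_max0 hf.
have hn : L2 P (fun w => Num.max (- f (S w)) 0) by exact: L2_max0 (L2N hf).
rewrite ipDl //; last exact: L2Z.
rewrite ipZl // (F0 (fun y => Num.max (f y) 0)) //; last 2 first.
- exact: mmax.
- by move=> y; exact: max0_ge0.
rewrite (F0 (fun y => Num.max (- f y) 0)) ?mulr0 ?addr0 //.
- by apply: mmax; exact: measurableT_comp.
- by move=> y; exact: max0_ge0.
Qed.

(** Independence makes the integral of [g \o V] over each event of [U] a multiple of its mean, which
    reduces the claim to [ip_orthogonal]. *)
Lemma independent_ip d1 d2 (T1 : measurableType d1) (T2 : measurableType d2)
    (U : T -> T1) (V : T -> T2) (f : T1 -> R) (g : T2 -> R) :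
  independent_RV P U V -> measurable_fun setT U -> measurable_fun setT V ->
  measurable_fun setT f -> measurable_fun setT g ->
  L2 P (f \o U) -> L2 P (g \o V) -> (\int[P]_w (g (V w))%:E = 0)%E ->
  ip P (f \o U) (g \o V) = 0.
Proof.
move=> indUV mU mV mf mg hf hg g0; apply: ip_orthogonal => // B mB.
have mUB : measurable (U @^-1` B).
  by rewrite -[X in measurable X]setTI; exact: mU.
have mind : measurable_fun setT (\1_B : T1 -> R) by exact: measurable_indic.
have mmax (F : T2 -> R) : measurable_fun setT F ->
  measurable_fun setT (fun y => Num.max (F y) 0).
  by move=> mF; exact: measurable_maxr.
have fin (F : T -> R) : L2 P F -> (\int[P]_w (F w)%:E < +oo)%E.
  move=> hF; have /integrable_fin_num : P.-integrable setT (EFin \o F) by exact: L2_integrable.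
  by move=> /(_ measurableT); rewrite fin_numE => /andP[_]; rewrite -ltey.
have eqn : (\int[P]_w (Num.max (g (V w)) 0)%:E = \int[P]_w (Num.max (- g (V w)) 0)%:E)%E.
  have := integral_max0 measurableT hg; rewrite /= g0 => /esym/eqP.
  have hp := L2_max0 hg; have hn := L2_max0 (L2N hg).
  rewrite sube_eq; last 2 first.
  - by apply: integrable_fin_num => //; exact: L2_integrable.
  - by rewrite fin_num_adde_defr.
  by rewrite add0e => /eqP.
rewrite (integral_max0 mUB hg) /pp /= !integral_preimage_indic.
rewrite (independent_integral2 (f := \1_B) (g := fun y => Num.max (g y) 0) indUV) //;
  last 3 first.
- exact: mmax.
- by move=> y; exact: max0_ge0.
- by apply: fin; exact: L2_max0 hg.
rewrite (independent_integral2 (f := \1_B) (g := fun y => Num.max (- g y) 0) indUV) //;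
  last 3 first.
- by apply: mmax; exact: measurableT_comp.
- by move=> y; exact: max0_ge0.
- by apply: fin; exact: L2_max0 (L2N hg).
rewrite eqn subee // fin_numM //.
  rewrite integral_comp_indic //; exact: fin_num_measure.
apply: integrable_fin_num => //; apply: L2_integrable; exact: L2_max0 (L2N hg).
Qed.

End Orthogonality.

(** * Second moments in the linear model *)

Section LinearModel.
Context {R : realType} d (T : measurableType d) (P : probability T R).

Lemma L2v_square_integrable n (V : {RV P >-> 'cV[R]_n}) :
  square_integrable P V -> L2v P V.
Proof.
move=> hV i; split.
  have /measurable_mxP h : measurable_fun setT (V : T -> 'cV[R]_n).
    exact: measurable_funPT.
  exact: h.
exact: Lfun2_integrable_sqr (hV i).
Qed.

Lemma psd_congr n m (B : 'M[R]_n) (A : 'M[R]_(n, m)) : psd B ->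
  psd (A^T *m B *m A).
Proof.
move=> [Bs Bp]; split=> [|x]; first by rewrite !trmx_mul trmxK Bs mulmxA.
have := Bp (A *m x); rewrite /qform dotv_mull.
by rewrite !mulmxA.
Qed.

Lemma posdefDr n (B C : 'M[R]_n) : psd B -> posdef C -> posdef (B + C).
Proof.
move=> [Bs Bp] /posdef_qform[Cs Cp]; apply/posdef_qform; split.
  by rewrite linearD /= Bs Cs.
by move=> x x0; rewrite /qform mulmxDl dotvDr ltr_wpDl ?Cp ?Bp.
Qed.

Lemma posdef_inv n (B : 'M[R]_n) : posdef B -> posdef (invmx B).
Proof.
move=> Bp; have Bu := posdef_unit Bp; have [Bs Bge] := posdef_psd Bp.
apply: psd_unit_posdef; last by rewrite unitmx_inv.
split=> [|x]; first by rewrite trmx_inv Bs.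
by have := Bge (invmx B *m x); rewrite /qform mulKVmx // dotvC.
Qed.

Context (N M : nat) (A : 'M[R]_(M, N)).
Context (X : {RV P >-> 'cV[R]_N}) (Z : {RV P >-> 'cV[R]_M}).
Hypothesis model : linear_model X Z.

Let hX : L2v P X. Proof. by have [_ [h _ _ _] _] := model; exact: L2v_square_integrable. Qed.
Let hZ : L2v P Z. Proof. by have [_ _ [h _ _ _]] := model; exact: L2v_square_integrable. Qed.
Let mX0 : mean_zero P X. Proof. by have [_ [] ] := model. Qed.
Let mZ0 : mean_zero P Z. Proof. by have [_ _ []] := model. Qed.
Let CX := covmx P X.
Let CZ := covmx P Z.
Let Y := observation A X Z.
Let E := estimation_error A X Z.

Let CXp : posdef CX.
Proof.
apply: psd_unit_posdef; last by have [_ []] := model.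
by rewrite /CX covmx_ipmx //; exact: ipmx_psd.
Qed.

Let CZp : posdef CZ.
Proof.
apply: psd_unit_posdef; last by have [_ _ []] := model.
by rewrite /CZ covmx_ipmx //; exact: ipmx_psd.
Qed.

Let XZ0 : ipmx P X Z = 0.
Proof.
have [ind _ _] := model; apply/matrixP => i j; rewrite !mxE.
apply: (@independent_ip _ _ _ P _ _ _ _ X Z (fun v => v i ord0) (fun v => v j ord0)).
- exact: ind.
- exact: measurable_funPT.
- exact: measurable_funPT.
- exact: measurable_entry.
- exact: measurable_entry.
- exact: hX.
- exact: hZ.
- by have := mZ0 j; rewrite unlock.
Qed.

Lemma L2v_observation : L2v P Y.
Proof. by apply: L2vD => //; exact: L2v_mul. Qed.

Lemma measurable_observation : measurable_fun setT Y.
Proof. by apply/measurable_mxP => i j; rewrite ord1; case: (L2v_observation i). Qed.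

Lemma L2v_estimation_error : L2v P E.
Proof.
rewrite (_ : E = fun w => X w + (- (Theta_star A X Z)^T) *m Y w).
  by apply: L2vD => //; apply: L2v_mul; exact: L2v_observation.
by apply/funext => w; rewrite mulNmx.
Qed.

Lemma mean_zero_observation : mean_zero P Y.
Proof. by apply: mean_zeroD => //; [exact: L2v_mul|exact: mean_zero_mul]. Qed.

Lemma ipmx_observation : ipmx P Y Y = A *m CX *m A^T + CZ.
Proof.
have hAX : L2v P (fun w => A *m X w) by exact: L2v_mul.
have hY : L2v P (fun w => A *m X w + Z w) by exact: L2v_observation.
rewrite [LHS](ipmxDl (U := fun w => A *m X w) (U' := Z)) //.
rewrite !ipmxDr // !ipmx_mull // !ipmx_mulr // XZ0 mulmx0 addr0.
rewrite -(ipmx_tr P X Z) XZ0 trmx0 mul0mx add0r.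
by rewrite /CX /CZ !covmx_ipmx // mulmxA.
Qed.

(** The noise covariance provides strict positivity, whatever the rank of [A]. *)
Lemma posdef_covmx_observation : posdef (covmx P Y).
Proof.
rewrite covmx_ipmx; last exact: mean_zero_observation.
rewrite ipmx_observation; apply: posdefDr => //.
rewrite -[X in X *m _ *m _](trmxK A).
by apply: psd_congr; exact: posdef_psd.
Qed.

(** The orthogonality principle for the best linear estimator. Multiplied by [B], it reads [B *m CX
    *m A^T = A^T *m invmx CZ *m (A *m CX *m A^T + CZ)], an identity visible from the definition of
    [B]. *)
Lemma ipmx_error_observation : ipmx P E Y = 0.
Proof.
have hY := L2v_observation.
rewrite [LHS](_ : _ = ipmx P X Y - (Theta_star A X Z)^T *m ipmx P Y Y); last first.
  rewrite -mulNmx -ipmx_mull // -ipmxDl //; last exact: L2v_mul.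
  by congr ipmx; apply/funext => w; rewrite mulNmx.
have -> : ipmx P X Y = CX *m A^T.
  rewrite ipmxDr //; last exact: L2v_mul.
  by rewrite ipmx_mulr // XZ0 addr0 /CX covmx_ipmx.
rewrite ipmx_observation /Theta_star trmxK -/CX -/CZ.
have CXu := posdef_unit CXp; have CZu := posdef_unit CZp.
set B := A^T *m invmx CZ *m A + invmx CX.
have Bu : B \in unitmx.
  apply: posdef_unit; apply: posdefDr; last exact: posdef_inv.
  by apply: psd_congr; apply: posdef_psd; exact: posdef_inv.
apply/eqP; rewrite subr_eq0; apply/eqP.
apply: (can_inj (mulKmx Bu)).
rewrite !mulmxA mulmxV // mul1mx mulmxDr mulmxKV //.
rewrite {1}/B mulmxDl mulmxDl mulVmx // mul1mx !mulmxA.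
by [].
Qed.

End LinearModel.

(** * Conditional expectations as functions of the observation *)

Section ConditionalExpectation.
Context {R : realType} d (T : measurableType d) (P : probability T R).
Context d' (T' : measurableType d') (Y : T -> T').
Hypothesis mY : measurable_fun setT Y.

(** A sign such as [0 <= mu] may be known only almost everywhere; since a probability space is not
    null, it then holds. *)
Lemma ae_probability_inhabited (p : Prop) : {ae P, forall w : T, p} -> p.
Proof.
move=> aep; apply: contrapT => np; have [N [mN N0 hN]] := aep.
have NT : N = setT by apply/seteqP; split => // w _; apply: hN.
have := probability_setT P; rewrite -NT N0 => -[] /esym/eqP.
by rewrite oner_eq0.
Qed.

Lemma measurable_preimage B : measurable B -> measurable (Y @^-1` B).
Proof. by move=> mB; rewrite -[X in measurable X]setTI; exact: mY. Qed.

Lemma g_sigma_preimage B : measurable B -> g_sigma_algebra_preimage Y (Y @^-1` B).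
Proof. by move=> mB; exists B => //; rewrite setTI. Qed.

(** The version is a function [h] on the space of observations, so that it can be evaluated at
    samples living on another probability space. *)
Lemma cond_expectation_bounded (V G : T -> R) (mu : R) :
  cond_expectation P Y V G -> {ae P, forall w, `|G w| <= mu} ->
  exists h : T' -> R, [/\ measurable_fun setT h, forall y, `|h y| <= mu,
    {ae P, forall w, G w = h (Y w)} &
    forall B, measurable B ->
      (\int[P]_(w in Y @^-1` B) (V w - h (Y w))%:E = 0)%E].
Proof.
move=> [iV iG GY GV] Gmu.
have mu0 : 0 <= mu.
  apply: ae_probability_inhabited; apply: filterS Gmu => w.
  exact: le_trans.
have [h0 mh0 Gh0] := doob_dynkin GY.
(* Cutting to [0] where the bound fails, a null event for [Y], makes the bound valid everywhere. *)
pose h y := if `|h0 y| <= mu then h0 y else 0.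
have mh : measurable_fun setT h.
  apply: measurable_fun_ifT => //; apply: measurable_fun_ler => //.
  exact: measurableT_comp.
have Gh : {ae P, forall w, G w = h (Y w)}.
  by apply: filterS Gmu => w; rewrite Gh0 /h => ->.
have mhY : measurable_fun setT (fun w => h (Y w)) by exact: measurableT_comp.
exists h; split => //.
  by move=> y; rewrite /h; case: ifP => //; rewrite normr0.
move=> B mB; have mYB := measurable_preimage mB.
have iGB : P.-integrable (Y @^-1` B) (EFin \o G).
  exact: (integrableS measurableT mYB).
have iVB : P.-integrable (Y @^-1` B) (EFin \o V).
  exact: (integrableS measurableT mYB).
transitivity (\int[P]_(w in Y @^-1` B) (V w - G w)%:E)%E.
  apply: ae_eq_integral => //.
  - apply: measurable_funTS; apply/measurable_EFinP; apply: measurable_funB => //.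
    by apply/measurable_EFinP; case/integrableP: iV.
  - apply: measurable_funTS; apply/measurable_EFinP; apply: measurable_funB => //.
      by apply/measurable_EFinP; case/integrableP: iV.
    by apply/measurable_EFinP; case/integrableP: iG.
  - by apply: filterS Gh => w -> _.
under eq_integral do rewrite EFinB.
rewrite integralB // GV ?subee //; last exact: g_sigma_preimage.
exact: integrable_fin_num.
Qed.

Lemma cond_expectation_nonneg (V G : T -> R) (K : R) :
  cond_expectation P Y V G -> (forall w, 0 <= V w) ->
  {ae P, forall w, G w <= K} ->
  exists m : T' -> R, [/\ measurable_fun setT m, forall y, 0 <= m y <= K &
    forall B, measurable B ->
      (\int[P]_w (\1_B (Y w) * V w)%:E = \int[P]_w (\1_B (Y w) * m (Y w))%:E)%E].
Proof.
move=> [iV iG GY GV] V0 GK.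
have mG : measurable_fun setT G by apply/measurable_EFinP; case/integrableP: iG.
(* The event [G < 0] belongs to the sigma-algebra of [Y], so [G] and the nonnegative [V] have the
   same integral over it; hence it is null. *)
have G0 : {ae P, forall w, 0 <= G w}.
  pose D := [set w | G w < 0].
  have DE : D = G @^-1` [set` `]-oo, 0[].
    by apply/seteqP; split => w; rewrite /D /= in_itv.
  have DY : g_sigma_algebra_preimage Y D by rewrite DE; apply: GY.
  have mD : measurable D by rewrite DE -[X in measurable X]setTI; apply: mG.
  have D0 : (\int[P]_(w in D) `|(G w)%:E| = 0)%E.
    have GN w : D w -> `|(G w)%:E|%E = (- (G w)%:E)%E.
      by move=> Dw; rewrite /= ltr0_norm.
    rewrite (eq_integral (fun w => - (G w)%:E)%E); last first.
      by move=> w /set_mem; exact: GN.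
    apply/eqP; rewrite eq_le; apply/andP; split; last first.
      by apply: integral_ge0 => w Dw; rewrite -GN.
    rewrite integralN ?oppe_le0; last first.
      by apply: integrable_add_def => //; apply: (integrableS measurableT mD).
    by rewrite GV //; apply: integral_ge0 => w _; rewrite lee_fin.
  have mGD : measurable_fun D (EFin \o G).
    by apply: measurable_funTS; exact/measurable_EFinP.
  have [/(_ D0) GD _] := ae_eq_integral_abs P mD mGD.
  apply: filterS GD => w /= h; rewrite leNgt; apply/negP => Gw.
  by have [Gw0] := h Gw; rewrite Gw0 ltxx in Gw.
have K0 : 0 <= K.
  apply: ae_probability_inhabited; apply: filterS2 G0 GK => w.
  exact: le_trans.
have [m0 mm0 Gm0] := doob_dynkin GY.
pose m y := Num.max 0 (Num.min (m0 y) K).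
have mm : measurable_fun setT m.
  by apply: measurable_maxr => //; exact: measurable_minr.
have Gm : {ae P, forall w, G w = m (Y w)}.
  by apply: filterS2 G0 GK => w; rewrite Gm0 /m => h0 hK;
    rewrite (min_idPl hK) (max_idPr h0).
exists m; split => //.
  by move=> y; rewrite /m le_max lexx /= ge_max K0 ge_min lexx orbT.
move=> B mB; rewrite -!integral_preimage_indic.
rewrite -GV; last exact: g_sigma_preimage.
apply: ae_eq_integral.
- exact: measurable_preimage.
- by apply: measurable_funTS; exact/measurable_EFinP.
- by apply: measurable_funTS; apply/measurable_EFinP; exact: measurableT_comp.
by apply: filterS Gm => w -> _.
Qed.

End ConditionalExpectation.

(** * Bounds on the left pseudo-inverse *)

Section PseudoInverse.
Context {R : realType}.

Lemma dotv_cauchy_schwarz n (x y : 'cV[R]_n) : dotv x y ^+ 2 <= dotv x x * dotv y y.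
Proof.
have p1 : psd (1%:M : 'M[R]_n).
  by split=> [|z]; [exact: trmx1 | rewrite /qform mul1mx dotvv_ge0].
by have := psd_cauchy_schwarz x y p1; rewrite /qform !mul1mx.
Qed.

Definition lpinv m n (W : 'M[R]_(m, n)) : 'M[R]_(n, m) := invmx (W^T *m W) *m W^T.

Context (m n : nat) (W : 'M[R]_(m, n.+1)) (s : R).
Hypothesis s0 : 0 < s.
Hypothesis sW : s <= sigma_min W.

Let gram_ge x : s ^+ 2 * dotv x x <= dotv (W *m x) (W *m x).
Proof. by apply: (le_sigma_min W (ltW s0)).1. Qed.

Lemma gram_unit : W^T *m W \in unitmx.
Proof.
apply: posdef_unit; apply/posdef_qform; split; first exact: gram_sym.
move=> x x0; rewrite gram_qform; apply: lt_le_trans (gram_ge x).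
by rewrite mulr_gt0 ?exprn_gt0 // dotvv_gt0.
Qed.

(** With [x := invmx (W^T *m W) *m a], the left-hand side is [dotv (W *m x) (W *m x)] and also
    [dotv x a]; coercivity and Cauchy-Schwarz close the estimate. *)
Lemma lpinv_tr_bound (a : 'cV[R]_n.+1) :
  dotv ((lpinv W)^T *m a) ((lpinv W)^T *m a) <= s ^- 2 * dotv a a.
Proof.
pose x := invmx (W^T *m W) *m a.
have -> : (lpinv W)^T *m a = W *m x.
  by rewrite trmx_mul trmxK trmx_inv gram_sym -mulmxA.
have Wx : dotv (W *m x) (W *m x) = dotv x a.
  by rewrite -gram_qform /qform mulKVmx // gram_unit.
have h1 := gram_ge x; rewrite Wx in h1.
have h2 := dotv_cauchy_schwarz x a.
have p2 : 0 < s ^+ 2 by rewrite exprn_gt0.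
rewrite Wx ler_pdivlMl //.
have [xa0|xa0] := leP (dotv x a) 0.
  apply: le_trans (dotvv_ge0 a); rewrite mulr_ge0_le0 // ltW //.
rewrite -(ler_pM2r xa0) -mulrA -expr2.
apply: le_trans (ler_wpM2l (ltW p2) h2) _.
by rewrite mulrA [leRHS]mulrC; apply: ler_wpM2r => //; exact: dotvv_ge0.
Qed.

(** The cost is [s ^- 4] instead of the [s ^- 2] available in terms of [b] itself, but the
    right-hand side sees only [W^T *m b], where centred terms cancel. This is the origin of the
    fourth power in the bias term. *)
Lemma lpinv_bound (b : 'cV[R]_m) :
  dotv (lpinv W *m b) (lpinv W *m b) <= s ^- 4 * dotv (W^T *m b) (W^T *m b).
Proof.
pose x := lpinv W *m b; pose u := W^T *m b.
have xE : x = invmx (W^T *m W) *m u by rewrite /x /u mulmxA.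
have Wx : dotv (W *m x) (W *m x) = dotv x u.
  by rewrite -gram_qform /qform {2}xE mulKVmx // gram_unit.
have h1 := gram_ge x; rewrite Wx in h1.
have h2 := dotv_cauchy_schwarz x u.
have p4 : 0 < s ^+ 4 by rewrite exprn_gt0.
rewrite -/x -/u ler_pdivlMl //.
have [->|x0] := eqVneq x 0; first by rewrite {1}/dotv mulmx0 mxE mulr0 dotvv_ge0.
have xp : 0 < dotv x x by rewrite dotvv_gt0.
rewrite -(ler_pM2r xp) [leRHS]mulrC; apply: le_trans h2.
have -> : s ^+ 4 * dotv x x * dotv x x = (s ^+ 2 * dotv x x) ^+ 2.
  by rewrite exprMn -exprM expr2 mulrA.
have q0 : 0 <= s ^+ 2 * dotv x x by rewrite mulr_ge0 ?sqr_ge0 ?dotvv_ge0.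
by apply: lerXn2r => //; rewrite nnegrE //; exact: le_trans q0 h1.
Qed.

Lemma lpinv_solve p (z : 'M[R]_(n.+1, p)) (e : 'M[R]_(m, p)) :
  W^T *m W *m z = W^T *m e -> z = lpinv W *m e.
Proof. by move=> h; rewrite /lpinv -mulmxA -h mulKmx // gram_unit. Qed.

End PseudoInverse.

(** * Normal equations of least squares *)

Section LeastSquares.
Context {R : realType}.

Lemma frobenius_sqE m n (B : 'M[R]_(m, n)) :
  frobenius_sq B = \sum_j dotv (col j B) (col j B).
Proof.
rewrite /frobenius_sq exchange_big /=; apply: eq_bigr => j _.
by rewrite dotvv_sqr; apply: eq_bigr => i _; rewrite mxE.
Qed.

Lemma frobenius_sq_tr m n (B : 'M[R]_(m, n)) : frobenius_sq B = \tr (B^T *m B).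
Proof.
rewrite frobenius_sqE /mxtrace; apply: eq_bigr => j _.
rewrite dotvE mxE; apply: eq_bigr => i _; by rewrite !mxE.
Qed.

Lemma frobenius_sq_ge0 m n (B : 'M[R]_(m, n)) : 0 <= frobenius_sq B.
Proof. by do 2! apply: sumr_ge0 => ? _; rewrite sqr_ge0. Qed.


Lemma frobenius_sq_eq0 m n (B : 'M[R]_(m, n)) : frobenius_sq B <= 0 -> B = 0.
Proof.
move=> h; have : frobenius_sq B == 0 by rewrite eq_le h frobenius_sq_ge0.
rewrite frobenius_sqE psumr_eq0 => [/allP B0|j _]; last exact: dotvv_ge0.
apply/matrixP => i j; have := B0 j (mem_index_enum j).
rewrite dotvv_eq0 => /eqP/colP/(_ i).
by rewrite !mxE.
Qed.

Lemma frobenius_sqD m n (B H : 'M[R]_(m, n)) t :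
  frobenius_sq (B + t *: H) =
  frobenius_sq B + t * (2 * \tr (H^T *m B)) + t ^+ 2 * frobenius_sq H.
Proof.
rewrite !frobenius_sq_tr.
have -> : (B + t *: H)^T = B^T + t *: H^T by rewrite linearD linearZ.
rewrite mulmxDl !mulmxDr.
rewrite -!scalemxAl -!scalemxAr !linearD /= !linearZ /=.
have -> : \tr (B^T *m H) = \tr (H^T *m B).
  by rewrite -mxtrace_tr trmx_mul trmxK.
ring.
Qed.

Lemma least_squares_normal_eq N M n (Xs : 'M[R]_(n, N)) (Ys : 'M[R]_(n, M))
    (Theta : 'M[R]_(M, N)) : (0 < n)%N ->
  least_squares Xs Ys Theta -> Ys^T *m Ys *m Theta = Ys^T *m Xs.
Proof.
move=> n0 hmin; pose r := Ys *m Theta - Xs; pose H := Ys^T *m r.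
suff H0 : H = 0.
  apply/eqP; rewrite -subr_eq0 -[X in X - _]mulmxA -mulmxBr; exact/eqP.
apply: frobenius_sq_eq0; rewrite leNgt; apply/negP => Hp.
pose p := frobenius_sq (Ys *m H).
have p0 : 0 <= p by exact: frobenius_sq_ge0.
have np : 0 < n%:R^-1 :> R by rewrite invr_gt0 ltr0n.
pose q := frobenius_sq H.
have key t : 0 <= t * (2 * q) + t ^+ 2 * p.
  have := hmin (Theta + t *: H).
  rewrite (ler_pM2l np) mulmxDr -scalemxAr addrAC -/r frobenius_sqD.
  rewrite trmx_mul -mulmxA -/H -frobenius_sq_tr -addrA lerDl; exact.
(* A step along [- H], the descent direction, short enough to contradict minimality; the [1] avoids
   division by zero when [p = 0]. *)
have := key (- (q / (p + 1))).
have -> : - (q / (p + 1)) * (2 * q) + (- (q / (p + 1))) ^+ 2 * p =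
   - (q ^+ 2 / (p + 1)) * (1 + (p + 1)^-1).
  by field; rewrite gt_eqF // ltr_wpDl.
apply/negP; rewrite -ltNge mulNr oppr_lt0 mulr_gt0 //.
  by rewrite divr_gt0 ?exprn_gt0 // ltr_wpDl.
by rewrite ltr_pwDl // invr_ge0 addr_ge0.
Qed.

End LeastSquares.

(** * Concentration of the noise contribution *)

Section NoiseBound.
Context {R : realType} d (T : measurableType d) (Q : probability T R).
Context d' (T' : measurableType d') (n m : nat).
Local Notation M := m.+1.
Context (S : 'I_n -> T -> T') (y : T' -> 'cV[R]_M) (r : T' -> R) (v : R).
Hypothesis indS : mutually_independent_RV Q S.
Hypothesis mS : forall i, measurable_fun setT (S i).
Hypothesis my : measurable_fun setT y.
Hypothesis mr : measurable_fun setT r.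
Hypothesis v0 : 0 <= v.
Hypothesis cond_mgf : forall l : R, exists f : 'cV[R]_M -> R,
  [/\ measurable_fun setT f,
      forall z, 0 <= f z <= expR (v * l ^+ 2 / 2) &
      forall i B, measurable B ->
        (\int[Q]_w (\1_B (y (S i w)) * expR (l * r (S i w)))%:E =
         \int[Q]_w (\1_B (y (S i w)) * f (y (S i w)))%:E)%E].
Context (D : 'M[R]_M) (s : R).
Hypothesis s0 : 0 < s.

Local Notation Yb := (rows_of S y).
Let good (B : 'M[R]_(n, M)) := s <= sigma_min (B *m D).

(* Set to 0 off the event sigma_min >= s, so that its exponential moments are
   bounded without conditioning on that event. *)
Definition noise (w : T) : 'cV[R]_M :=
  if s <= sigma_min (Yb w *m D) then lpinv (Yb w *m D) *m \col_i r (S i w) else 0.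

Let measurable_id_mx : measurable_mx (fun B : 'M[R]_(n, M) => B).
Proof. by move=> i j; exact: measurable_entry. Qed.

Lemma measurable_mulmx_cst : measurable_mx (fun B : 'M[R]_(n, M) => B *m D).
Proof. by apply: measurable_mulmx => //; exact: measurable_cst_mx. Qed.

Lemma measurable_lpinv_mul : measurable_mx (fun B : 'M[R]_(n, M) => lpinv (B *m D)).
Proof.
have h := measurable_mulmx_cst; have ht := measurable_trmx h.
by apply: measurable_mulmx => //; apply: measurable_invmx; exact: measurable_mulmx.
Qed.

Lemma measurable_good : measurable_fun setT good.
Proof.
apply: (measurable_fun_bool true); rewrite setTI.
rewrite [X in measurable X](_ : _ = [set B | s <= sigma_min (B *m D)]).
  by apply: measurable_le_sigma_min; exact: measurable_mulmx_cst.
by apply/seteqP; split.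
Qed.

Lemma measurable_noise : measurable_mx noise.
Proof.
have mY := measurable_rows_of mS my.
move=> i j; rewrite (_ : (fun w => _) = (fun w => if good (Yb w) then
    (lpinv (Yb w *m D) *m \col_i r (S i w)) i j else 0)); last first.
  by apply/funext => w; rewrite /noise /good; case: ifP => //; rewrite mxE.
apply: measurable_fun_ifT => //.
  exact: measurableT_comp measurable_good mY.
apply: measurable_mulmx => [k l|k l].
  exact: measurableT_comp (measurable_lpinv_mul k l) mY.
under eq_fun do rewrite mxE.
exact: measurableT_comp.
Qed.

(** The direction [beta] may depend on the observed rows. Transposing moves [lpinv] onto it, giving
    coefficients [alpha] with sum of squares at most [K / s ^+ 2]; the compensator in
    [cond_mgf_rows] is then bounded by a constant and can be restored. *)
Lemma noise_mgf (beta : 'M[R]_(n, M) -> 'cV[R]_M) (K : R) :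
  measurable_mx beta -> (forall B, dotv (beta B) (beta B) <= K) ->
  (\int[Q]_w (expR (dotv (beta (Yb w)) (noise w)))%:E <=
   (expR (v / s ^+ 2 * K / 2))%:E)%E.
Proof.
move=> mbeta bK.
pose alpha i (B : 'M[R]_(n, M)) :=
  if good B then ((lpinv (B *m D))^T *m beta B) i ord0 else 0.
have malpha i : measurable_fun setT (alpha i).
  apply: measurable_fun_ifT => //; first exact: measurable_good.
  apply: measurable_mulmx => //; apply: measurable_trmx.
  exact: measurable_lpinv_mul.
have K0 : 0 <= K by apply: le_trans (bK 0); exact: dotvv_ge0.
have p2 : 0 < s ^+ 2 by rewrite exprn_gt0.
have sa B : \sum_i alpha i B ^+ 2 <= K / s ^+ 2.
  rewrite /alpha /good; have [gB|_] := leP s _; last first.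
    by rewrite big1 ?divr_ge0 // ?(ltW p2) // => i _; rewrite expr0n.
  rewrite -dotvv_sqr; apply: le_trans (lpinv_tr_bound s0 gB (beta B)) _.
  by rewrite [leRHS]mulrC ler_wpM2l // invr_ge0 (ltW p2).
have da w : dotv (beta (Yb w)) (noise w) = \sum_i alpha i (Yb w) * r (S i w).
  rewrite /noise /alpha /good; case: ifP => gB; last first.
    by rewrite /dotv mulmx0 mxE big1 // => i _; rewrite mul0r.
  rewrite dotvC dotv_mull dotvC dotvE.
  by apply: eq_bigr => i _; congr (_ * _); rewrite !mxE.
have h := cond_mgf_rows indS mS my mr cond_mgf malpha.
have mh : measurable_fun setT (fun w => expR (\sum_i alpha i (Yb w) * r (S i w) -
    v * (\sum_i alpha i (Yb w) ^+ 2) / 2)).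
  have mY := measurable_rows_of mS my.
  have ma i : measurable_fun setT (fun w => alpha i (Yb w)).
    exact: measurableT_comp (malpha i) mY.
  apply: measurableT_comp => //; apply: measurable_funB.
    apply: measurable_sum => i; apply: measurable_funM => //.
    exact: measurableT_comp.
  apply: measurable_funM => //; apply: measurable_funM => //.
  by apply: measurable_sum => i; exact: measurable_funX.
apply: (@le_trans _ _ (\int[Q]_w ((expR (v / s ^+ 2 * K / 2))%:E *
  (expR (\sum_i alpha i (Yb w) * r (S i w) -
    v * (\sum_i alpha i (Yb w) ^+ 2) / 2))%:E))%E).
  apply: ge0_le_integral => //=.
  - apply/measurable_EFinP; apply: measurableT_comp => //.
    under eq_fun do rewrite da.
    apply: measurable_sum => i; apply: measurable_funM.
      exact: measurableT_comp (malpha i) (measurable_rows_of mS my).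
    exact: measurableT_comp.
  - by apply: measurable_funeM; exact/measurable_EFinP.
  move=> w _; rewrite -EFinM lee_fin -expRD ler_expR da addrC -addrA lerDl.
  rewrite addrC subr_ge0 -!mulrA; apply: ler_wpM2l => //.
  rewrite mulrA ler_pM2r // mulrC; exact: sa.
rewrite ge0_integralZl //=; last exact/measurable_EFinP.
by rewrite -[leRHS]mule1; apply: lee_wpmul2l => //; rewrite lee_fin.
Qed.

Context (tau eps : R).
Hypothesis eps0 : 0 < eps.
(** [tau], later chosen independently of [M], bounds the variance proxy in each direction by
    [tau / M], the scale on which [chi2_tail] operates. *)
Hypothesis vtau : v * M%:R <= tau * s ^+ 2.

Let p2 : 0 < s ^+ 2. Proof. by rewrite exprn_gt0. Qed.
Let Mp : 0 < M%:R :> R. Proof. by rewrite ltr0n. Qed.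

Let tau0 : 0 <= tau.
Proof. by rewrite -(pmulr_lge0 _ p2); apply: le_trans vtau; rewrite mulr_ge0. Qed.

Let vs : v / s ^+ 2 <= tau / M%:R.
Proof. by rewrite ler_pdivrMr // mulrAC ler_pdivlMr. Qed.

Lemma noise_tail :
  (Q [set w | (tau + eps <= dotv (noise w) (noise w))%R] <=
   (chi2_rate tau eps ^+ M)%:E)%E.
Proof.
under eq_set do rewrite dotvv_sqr.
apply: (@chi2_tail _ _ _ Q M (fun j w => noise w j ord0)) => //.
  by move=> j; exact: measurable_noise.
move=> a; have := @noise_mgf (fun=> \col_j a j) _ (measurable_cst_mx _)
  (fun=> lexx _).
have -> : dotv (\col_j a j : 'cV[R]_M) (\col_j a j) = \sum_j a j ^+ 2.
  by rewrite dotvv_sqr; apply: eq_bigr => j _; rewrite mxE.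
under eq_integral do rewrite dotvE.
under eq_integral do under eq_bigr do rewrite mxE.
move=> /le_trans; apply; rewrite lee_fin ler_expR ler_pM2r // ler_wpM2r //.
by apply: sumr_ge0 => j _; exact: sqr_ge0.
Qed.

(** Chernoff exponent per dimension for the variance proxy [K * tau / M]; the optimum would be
    [eps ^+ 2 / (2 * K * tau)], and the [1] covers [K * tau = 0]. *)
Definition cross_rate (K : R) : R := expR (- (eps ^+ 2 / (2 * (K * tau + 1)))).

Lemma cross_tail (beta : 'M[R]_(n, M) -> 'cV[R]_M) (K : R) :
  measurable_mx beta -> (forall B, dotv (beta B) (beta B) <= K) ->
  (Q [set w | (eps <= dotv (beta (Yb w)) (noise w))%R] <=
   (cross_rate K ^+ M)%:E)%E.
Proof.
move=> mbeta bK.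
have K0 : 0 <= K by apply: le_trans (bK 0); exact: dotvv_ge0.
pose delta := eps / (K * tau + 1).
have Dp : 0 < K * tau + 1 by rewrite ltr_wpDl // mulr_ge0.
have d0 : 0 < delta by rewrite divr_gt0.
pose th := delta * M%:R.
have th0 : 0 <= th by rewrite mulr_ge0 // ltW.
have mdot : measurable_fun setT (fun w => dotv (beta (Yb w)) (noise w)).
  under eq_fun do rewrite dotvE.
  apply: measurable_sum => i; apply: measurable_funM.
    exact: measurableT_comp (mbeta i ord0) (measurable_rows_of mS my).
  exact: measurable_noise.
have mA : measurable [set w | (eps <= dotv (beta (Yb w)) (noise w))%R].
  by apply: measurable_fun_le_set => //; exact: measurable_cst.
apply: le_trans (@measure_le_integral _ _ _ Q _ (fun w =>
  expR (- (th * eps)) * expR (dotv (th *: beta (Yb w)) (noise w))) mA _ _ _) _.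
- apply: measurable_funM => //; apply: measurableT_comp => //.
  by under eq_fun do rewrite dotvZl; exact: measurable_funM.
- by move=> w; rewrite mulr_ge0 ?expR_ge0.
- move=> w /= hw; rewrite -expRD -expR0 ler_expR addrC dotvZl -mulrBr.
  by rewrite mulr_ge0 // subr_ge0.
under eq_integral do rewrite EFinM.
rewrite ge0_integralZl //=; last first.
- apply/measurable_EFinP; apply: measurableT_comp => //.
  by under eq_fun do rewrite dotvZl; exact: measurable_funM.
have h := @noise_mgf (fun B => th *: beta B) (th ^+ 2 * K) _ _.
apply: le_trans (lee_wpmul2l _ (h _ _)) _.
- by rewrite lee_fin expR_ge0.
- by move=> i j; under eq_fun do rewrite mxE; exact: measurable_funM.
- move=> B; rewrite dotvZl dotvZr mulrA -expr2.
  by apply: ler_wpM2l => //; exact: sqr_ge0.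
rewrite -EFinM lee_fin -expRD /cross_rate -expRM_natl ler_expR.
have e1 : v / s ^+ 2 * (th ^+ 2 * K) / 2 <= tau / M%:R * (th ^+ 2 * K) / 2.
  by rewrite ler_pM2r // ler_wpM2r // mulr_ge0 // sqr_ge0.
apply: le_trans (lerD (lexx _) e1) _.
have -> : - (th * eps) + tau / M%:R * (th ^+ 2 * K) / 2 =
   M%:R * (delta * (delta * (K * tau) / 2 - eps)).
  by rewrite /th; field; rewrite gt_eqF.
have -> : - (eps ^+ 2 / (2 * (K * tau + 1))) = delta * (eps / 2 - eps).
  by rewrite /delta; field; rewrite gt_eqF.
rewrite ler_pM2l // ler_pM2l // lerD2r ler_pM2r //.
rewrite /delta mulrAC ler_pdivrMr // mulrDr mulr1 lerDl.
exact: ltW.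
Qed.

End NoiseBound.

(** * Concentration of the bias contribution *)

Section BiasBound.
Context {R : realType} d (T : measurableType d) (Q : probability T R).
Context d' (T' : measurableType d') (n M : nat).
Context (S : 'I_n -> T -> T') (u : T' -> 'cV[R]_M) (h : T' -> R) (kappa : R).
Hypothesis indS : mutually_independent_RV Q S.
Hypothesis mS : forall i, measurable_fun setT (S i).
Hypothesis mu : measurable_mx u.
Hypothesis mh : measurable_fun setT h.
Hypothesis mgf : forall i (a : 'cV[R]_M),
  (\int[Q]_w (expR (dotv a (u (S i w)) * h (S i w)))%:E <=
   (expR (kappa * dotv a a / 2))%:E)%E.
Hypothesis n0 : (0 < n)%N.

(** This corresponds to W^T b / n rather than to the error component W^+ b: it is an average of
    independent terms, a structure that the pseudo-inverse would destroy. *)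
Definition bias (w : T) : 'cV[R]_M := n%:R^-1 *: \sum_i h (S i w) *: u (S i w).

Lemma dotv_sumr I (r : seq I) (a : 'cV[R]_M) (x : I -> 'cV[R]_M) :
  dotv a (\sum_(i <- r) x i) = \sum_(i <- r) dotv a (x i).
Proof. by rewrite /dotv mulmx_sumr summxE. Qed.

Lemma dotv_bias a w :
  dotv a (bias w) = \sum_i dotv (n%:R^-1 *: a) (u (S i w)) * h (S i w).
Proof.
rewrite /bias dotvZr dotv_sumr mulr_sumr; apply: eq_bigr => i _.
by rewrite dotvZr dotvZl -mulrA [X in _ * X]mulrC.
Qed.

Lemma measurable_bias : measurable_mx bias.
Proof.
move=> j k; rewrite ord1.
under eq_fun do rewrite mxE summxE.
apply: measurable_funM => //; apply: measurable_sum => i.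
under eq_fun do rewrite mxE; apply: measurable_funM.
  exact: measurableT_comp.
exact: measurableT_comp (mu j ord0) (mS i).
Qed.

(** Each of the [n] independent terms has variance proxy [kappa / n ^ 2], and the proxies add up. *)
Lemma bias_mgf (a : 'cV[R]_M) :
  (\int[Q]_w (expR (dotv a (bias w)))%:E <=
   (expR (kappa / n%:R * dotv a a / 2))%:E)%E.
Proof.
pose b := n%:R^-1 *: a.
pose f (i : 'I_n) s := expR (dotv b (u s) * h s).
have mf i : measurable_fun setT (f i).
  apply: measurableT_comp => //; apply: measurable_funM => //.
  under eq_fun do rewrite dotvE.
  by apply: measurable_sum => j; apply: measurable_funM => //; exact: mu.
have np : 0 < n%:R :> R by rewrite ltr0n.
under eq_integral do rewrite dotv_bias expR_sum.
rewrite (independent_integral_prod (f := f) indS mS mf) /f //; last first.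
- by move=> i; apply: le_lt_trans (mgf i b) _; rewrite ltry.
apply: (@le_trans _ _ (\prod_(i < n) (expR (kappa * dotv b b / 2))%:E)%E).
  rewrite prodEFin.
  have fin i : (\int[Q]_w (expR (dotv b (u (S i w)) * h (S i w)))%:E)%E \is a fin_num.
    rewrite ge0_fin_numE; first by apply: le_lt_trans (mgf i b) _; rewrite ltry.
    by apply: integral_ge0 => w _; rewrite lee_fin expR_ge0.
  rewrite (eq_bigr (fun i => (fine (\int[Q]_w
      (expR (dotv b (u (S i w)) * h (S i w)))%:E))%:E)); last first.
    by move=> i _; rewrite fineK.
  rewrite prodEFin lee_fin; apply: ler_prod => i _.
  rewrite fine_ge0 /=; last first.
    by apply: integral_ge0 => w _; rewrite lee_fin expR_ge0.
  by rewrite -lee_fin fineK // mgf.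
rewrite prodEFin lee_fin prodr_const card_ord -expRM_natl ler_expR.
rewrite /b dotvZl dotvZr le_eqVlt; apply/orP; left; apply/eqP.
by field; rewrite gt_eqF.
Qed.

Lemma bias_tail (tau eps : R) : (0 < M)%N -> 0 <= tau -> 0 < eps ->
  kappa * M%:R <= tau * n%:R ->
  (Q [set w | (tau + eps <= dotv (bias w) (bias w))%R] <=
   (chi2_rate tau eps ^+ M)%:E)%E.
Proof.
move=> M0 t0 e0 kt.
have np : 0 < n%:R :> R by rewrite ltr0n.
have Mp : 0 < M%:R :> R by rewrite ltr0n.
under eq_set do rewrite dotvv_sqr.
apply: (@chi2_tail _ _ _ Q M (fun j w => bias w j ord0)) => //.
  by move=> j; exact: measurable_bias.
move=> a; have := bias_mgf (\col_j a j).
have -> : dotv (\col_j a j : 'cV[R]_M) (\col_j a j) = \sum_j a j ^+ 2.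
  by rewrite dotvv_sqr; apply: eq_bigr => j _; rewrite mxE.
under eq_integral do rewrite dotvE.
under eq_integral do under eq_bigr do rewrite mxE.
move=> /le_trans; apply; rewrite lee_fin ler_expR ler_pM2r // ler_wpM2r //.
  by apply: sumr_ge0 => j _; exact: sqr_ge0.
by rewrite ler_pdivrMr // mulrAC ler_pdivlMr.
Qed.

End BiasBound.

(** * Transfer of integrals between variables of the same law *)

Section SameLaw.
Context {R : realType} d1 d2 d3 (T1 : measurableType d1) (T2 : measurableType d2)
  (T' : measurableType d3).
Context (Q : probability T1 R) (P : probability T2 R).
Context (U : T1 -> T') (V : T2 -> T').
Hypothesis mU : measurable_fun setT U.
Hypothesis mV : measurable_fun setT V.
Hypothesis sameUV : same_law Q P U V.
Local Open Scope ereal_scope.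

Lemma same_law_ge0_integral (f : T' -> \bar R) : measurable_fun setT f ->
  (forall x, 0 <= f x) -> \int[Q]_w f (U w) = \int[P]_w f (V w).
Proof.
move=> mf f0.
have E1 := @ge0_integral_pushforward _ _ _ _ _ _ mU Q setT f measurableT mf (fun x _ => f0 x).
have E2 := @ge0_integral_pushforward _ _ _ _ _ _ mV P setT f measurableT mf (fun x _ => f0 x).
rewrite preimage_setT in E1; rewrite preimage_setT in E2.
rewrite -[LHS]E1 -[RHS]E2; apply: eq_measure_integral => A mA _.
exact: sameUV.
Qed.

Lemma same_law_integral (f : T' -> \bar R) : measurable_fun setT f ->
  \int[Q]_w f (U w) = \int[P]_w f (V w).
Proof.
move=> mf; rewrite integralE [RHS]integralE.
rewrite (funepos_comp f U) (funeneg_comp f U) (funepos_comp f V) (funeneg_comp f V).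
congr (_ - _).
- apply: (same_law_ge0_integral (f := f^\+)); first exact: measurable_funepos.
  by move=> x; exact: funepos_ge0.
- apply: (same_law_ge0_integral (f := f^\-)); first exact: measurable_funeneg.
  by move=> x; exact: funeneg_ge0.
Qed.

Lemma same_law_integrable (f : T' -> \bar R) : measurable_fun setT f ->
  P.-integrable setT (f \o V) -> Q.-integrable setT (f \o U).
Proof.
move=> mf /integrableP[_ fV]; apply/integrableP; split.
  exact: measurableT_comp mf mU.
rewrite (same_law_ge0_integral (f := fun x => `|f x|)) //.
exact: measurableT_comp.
Qed.

End SameLaw.

(** * Exponential moments of the whitened bias terms *)

Section WhitenedBias.
Context {R : realType} d (T : measurableType d) (P : probability T R) (M : nat).
Context (V : T -> 'cV[R]_M) (b : T -> R) (rho mu : R).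
Hypothesis L2V : L2v P V.
Hypothesis V0 : mean_zero P V.
Hypothesis subV : subgaussian_vec P rho V.
Hypothesis mb : measurable_fun setT b.
Hypothesis bmu : forall w, `|b w| <= mu.
Hypothesis Vb0 : forall j, ip P (coordinate V j) b = 0.
Local Open Scope ereal_scope.

Lemma bounded_L2 : L2 P b.
Proof.
split=> //; apply: (@le_integrable _ _ _ P setT measurableT _ (EFin \o cst (mu ^+ 2)%R)).
- by apply/measurable_EFinP; exact: measurable_funX.
- move=> w _ /=; rewrite lee_fin !ger0_norm ?sqr_ge0 //.
  rewrite -(real_normK (num_real (b w))); apply: lerXn2r; rewrite ?nnegrE //.
  exact: le_trans (bmu w).
exact: finite_measure_integrable_cst.
Qed.

Lemma dotv_mean_zero (a : 'cV[R]_M) : \int[P]_w (dotv a (V w))%:E = 0.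
Proof.
transitivity (ip P (fun w => \sum_j a j ord0 * coordinate V j w)%R (fun=> 1%R))%:E.
  rewrite -ipE; last exact: L2_cst.
    by apply: eq_integral => w _; rewrite mulr1 dotvE.
  by apply: L2_sum => j; exact: L2Z.
rewrite ip_suml; last 2 first.
- by move=> j; exact: L2Z.
- exact: L2_cst.
rewrite big1 // => j _; rewrite ipZl //; last exact: L2_cst.
by rewrite ((mean_zero_ip L2V).1 V0) mulr0.
Qed.

Lemma dotv_coordinate (a : 'cV[R]_M) :
  (fun w => dotv a (V w)) = (fun w => \sum_j a j ord0 * coordinate V j w)%R.
Proof. by apply/funext => w; rewrite dotvE. Qed.

Lemma L2_dotv (a : 'cV[R]_M) : L2 P (fun w => dotv a (V w)).
Proof.
by rewrite dotv_coordinate; apply: L2_sum => j; exact: L2Z.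
Qed.

(** Sub-Gaussianity is given for unit vectors, so [a] is normalized to [e] and its norm becomes the
    parameter of the moment bound; the null vector is treated apart. *)
Lemma whitened_bias_mgf (a : 'cV[R]_M) :
  \int[P]_w (expR (dotv a (V w) * b w))%:E <=
  (expR (3 / 2 * rho ^+ 2 * mu ^+ 2 * dotv a a / 2))%:E.
Proof.
have [->|a0] := eqVneq a 0%R.
  under eq_integral do rewrite /dotv trmx0 mul0mx mxE mul0r expR0.
  by rewrite integral_probability_cst /dotv mulmx0 mxE mulr0 mul0r expR0.
have aap : (0 < dotv a a)%R by rewrite dotvv_gt0.
have l0 : (0 < norm2 a)%R.
  by rewrite lt_neqAle sqrtr_ge0 andbT eq_sym -sqrf_eq0 norm2_sqr gt_eqF.
pose e := ((norm2 a)^-1 *: a)%R.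
have e1 : norm2 e = 1%R.
  apply/eqP; rewrite -(eqrXn2 (n := 2)) // ?sqrtr_ge0 // expr1n norm2_sqr.
  rewrite dotvZl dotvZr mulrA -expr2 exprVn norm2_sqr mulVf // gt_eqF //.
have ae : a = (norm2 a *: e)%R by rewrite scalerA mulfV ?scale1r // gt_eqF.
have [rho0 _ sube] := subV e1.
have E0 : fine 'E_P[(fun w => (e^T *m V w) ord0 ord0)] = 0%R.
  by rewrite unlock -/(dotv _ _) [X in fine X](dotv_mean_zero e).
have mV : measurable_fun setT (fun w => dotv e (V w)) by case: (L2_dotv e).
have h := @subgaussian_mul_bounded_mgf _ _ _ P (fun w => dotv e (V w)) b rho mu
  (norm2 a) mV mb bmu _ _ _.
rewrite -norm2_sqr; apply: le_trans _ (h _ _ _).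
- rewrite le_eqVlt; apply/orP; left; apply/eqP; apply: eq_integral => w _.
  by rewrite {1}ae dotvZl mulrA.
- move=> l; have := sube l; rewrite E0 unlock.
  by under eq_integral do rewrite subr0.
- exact: L2_mul (L2_dotv e) bounded_L2.
rewrite ipE; [|exact: L2_dotv|exact: bounded_L2].
rewrite dotv_coordinate ip_suml //; last 2 first.
- by move=> j; exact: L2Z.
- exact: bounded_L2.
by rewrite big1 // => j _; rewrite ipZl ?Vb0 ?mulr0 //; exact: bounded_L2.
Qed.

End WhitenedBias.

Lemma cross_rate_lt1 {R : realType} (tau eps K : R) :
  0 <= tau -> 0 < eps -> 0 <= K -> cross_rate tau eps K < 1.
Proof.
move=> t0 e0 K0; rewrite expR_lt1 oppr_lt0 divr_gt0 ?exprn_gt0 // mulr_gt0 //.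
by rewrite ltr_wpDl // mulr_ge0.
Qed.

(** * One column of the error *)

Section ColumnBound.
Context {R : realType} d (T : measurableType d) (Q : probability T R).
Context d' (T' : measurableType d') (n m : nat).
Local Notation M := m.+1.
Context (S : 'I_n -> T -> T') (y : T' -> 'cV[R]_M) (r : T' -> R)
  (h : 'cV[R]_M -> R) (v kappa : R).
Hypothesis indS : mutually_independent_RV Q S.
Hypothesis mS : forall i, measurable_fun setT (S i).
Hypothesis my : measurable_fun setT y.
Hypothesis mr : measurable_fun setT r.
Hypothesis mh : measurable_fun setT h.
Hypothesis v0 : 0 <= v.
Hypothesis cond_mgf : forall l : R, exists f : 'cV[R]_M -> R,
  [/\ measurable_fun setT f,
      forall z, 0 <= f z <= expR (v * l ^+ 2 / 2) &
      forall i B, measurable B ->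
        (\int[Q]_w (\1_B (y (S i w)) * expR (l * r (S i w)))%:E =
         \int[Q]_w (\1_B (y (S i w)) * f (y (S i w)))%:E)%E].
Context (D : 'M[R]_M).
Hypothesis mgf : forall i (a : 'cV[R]_M),
  (\int[Q]_w (expR (dotv a (D^T *m y (S i w)) * h (y (S i w))))%:E <=
   (expR (kappa * dotv a a / 2))%:E)%E.
Context (s eps tau1 tau3 K : R).
Hypothesis n0 : (0 < n)%N.
Hypothesis s0 : 0 < s.
Hypothesis eps0 : 0 < eps.
Hypothesis tau3_ge0 : 0 <= tau3.
Hypothesis vtau1 : v * M%:R <= tau1 * s ^+ 2.
Hypothesis ktau3 : kappa * M%:R <= tau3 * n%:R.
Hypothesis Ktau3 : n%:R ^+ 2 * (tau3 + eps) <= K * s ^+ 4.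

Local Notation Yb := (rows_of S y).

(** A single ratio for the three tail bounds, so that they add up to [3 * q ^+ M]. *)
Definition column_rate (q : R) : Prop :=
  [/\ chi2_rate tau1 eps <= q, chi2_rate tau3 eps <= q & cross_rate tau1 eps K <= q].

(** The squared norm is expanded into noise, bias and twice the cross term, each controlled off one
    of the three parts of [B]. The event of small [sigma_min] is kept out of [B] because all columns
    share it. *)
Lemma column_bound q : column_rate q ->
  exists2 B, measurable B & (Q B <= (3 * q ^+ M)%:E)%E /\
    forall w, ~ B w -> s <= sigma_min (Yb w *m D) ->
      let e := lpinv (Yb w *m D) *m \col_i (r (S i w) + h (y (S i w))) in
      dotv e e <= tau1 + K + 3 * eps.
Proof.
move=> [q1 q3 q4].
pose b (B : 'M[R]_(n, M)) : 'cV[R]_n := \col_i h (row i B)^T.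
pose Gb B := lpinv (B *m D) *m b B.
have mid : measurable_mx (fun B : 'M[R]_(n, M) => B).
  by move=> i j; exact: measurable_entry.
have mb : measurable_mx b.
  move=> i j; under eq_fun do rewrite mxE.
  exact: measurableT_comp mh (measurable_row_tr i).
have mGb : measurable_mx Gb.
  by apply: measurable_mulmx => //; exact: measurable_lpinv_mul.
have mdGb : measurable_fun setT (fun B => dotv (Gb B) (Gb B)).
  under eq_fun do rewrite dotvE.
  by apply: measurable_sum => i; apply: measurable_funM; exact: mGb.
(* [cross_tail] needs a direction that is bounded for every sample, hence the
   truncation. *)
pose beta B : 'cV[R]_M := if dotv (Gb B) (Gb B) <= K then Gb B else 0.
have mbeta : measurable_mx beta.
  move=> i j; rewrite (_ : (fun w => _) = (fun B =>
    if dotv (Gb B) (Gb B) <= K then Gb B i j else 0)); last first.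
    by apply/funext => B; rewrite /beta; case: ifP => //; rewrite mxE.
  by apply: measurable_fun_ifT => //; exact: measurable_fun_ler.
have K0 : 0 <= K.
  have p4 : 0 < s ^+ 4 by rewrite exprn_gt0.
  rewrite -(pmulr_lge0 _ p4); apply: le_trans Ktau3.
  by rewrite mulr_ge0 ?sqr_ge0 // addr_ge0 // ltW.
have bK B : dotv (beta B) (beta B) <= K.
  by rewrite /beta; case: ifP => // _; rewrite /dotv mulmx0 mxE.
pose u p := D^T *m y p.
have mu : measurable_mx u.
  apply: measurable_mulmx; first exact: measurable_cst_mx.
  exact/measurable_mxP.
have mhy : measurable_fun setT (fun p => h (y p)) by exact: measurableT_comp.
pose nz := noise S y r D s; pose bs := bias S u (fun p => h (y p)).
have mnz := measurable_noise mS my mr D s.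
have mbs := measurable_bias mS mu mhy.
have mdot (x : T -> 'cV[R]_M) (z : T -> 'cV[R]_M) : measurable_mx x -> measurable_mx z ->
    measurable_fun setT (fun w => dotv (x w) (z w)).
  move=> mx mz; under eq_fun do rewrite dotvE.
  by apply: measurable_sum => i; exact: measurable_funM.
have mbY : measurable_mx (fun w => beta (Yb w)).
  by move=> i j; exact: measurableT_comp (mbeta i j) (measurable_rows_of mS my).
pose B1 := [set w | tau1 + eps <= dotv (nz w) (nz w)].
pose B3 := [set w | tau3 + eps <= dotv (bs w) (bs w)].
pose B4 := [set w | eps <= dotv (beta (Yb w)) (nz w)].
have mB1 : measurable B1.
  by apply: measurable_fun_le_set; [exact: measurable_cst | exact: mdot].
have mB3 : measurable B3.
  by apply: measurable_fun_le_set; [exact: measurable_cst | exact: mdot].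
have mB4 : measurable B4.
  by apply: measurable_fun_le_set; [exact: measurable_cst | exact: mdot].
have qM x : 0 <= x -> x <= q -> (((x : R) ^+ M)%:E <= (q ^+ M)%:E)%E.
  by move=> x0 xq; rewrite lee_fin; apply: lerXn2r => //; rewrite nnegrE (le_trans x0).
exists (B1 `|` B3 `|` B4); first by apply: measurableU => //; exact: measurableU.
split.
  have e3 : 3 * q ^+ M = q ^+ M + q ^+ M + q ^+ M by ring.
  rewrite e3 !EFinD.
  apply: (le_trans (measureU2 Q (measurableU _ _ mB1 mB3) mB4)).
  apply: leeD; last first.
    have h4 := @cross_tail _ _ _ Q _ _ _ _ S y r v indS mS my mr v0 cond_mgf D s
      s0 tau1 eps eps0 vtau1 beta K mbeta bK.
    by apply: le_trans h4 _; apply: qM => //; exact: expR_ge0.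
  apply: (le_trans (measureU2 Q mB1 mB3)); apply: leeD.
    have h1 := @noise_tail _ _ _ Q _ _ _ _ S y r v indS mS my mr v0 cond_mgf D s
      s0 tau1 eps eps0 vtau1.
    by apply: le_trans h1 _; apply: qM => //; exact: expR_ge0.
  have h3 := @bias_tail _ _ _ Q _ _ _ _ S u _ kappa indS mS mu mhy mgf n0 tau3 eps
    isT tau3_ge0 eps0 ktau3.
  by apply: le_trans h3 _; apply: qM => //; exact: expR_ge0.
move=> w Bw sw; rewrite /=.
have n1 : dotv (nz w) (nz w) < tau1 + eps.
  by rewrite ltNge; apply/negP => H; apply: Bw; left; left.
have n3 : dotv (bs w) (bs w) < tau3 + eps.
  by rewrite ltNge; apply/negP => H; apply: Bw; left; right.
have n4 : dotv (beta (Yb w)) (nz w) < eps.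
  by rewrite ltNge; apply/negP => H; apply: Bw; right.
have nzE : nz w = lpinv (Yb w *m D) *m \col_i r (S i w) by rewrite /nz /noise sw.
have bE : b (Yb w) = \col_i h (y (S i w)).
  by apply/colP => i; rewrite !mxE row_rows_of.
(* Undoing the average in [bias] costs a factor [n], whose square appears in [Ktau3]. *)
have bsE : (Yb w *m D)^T *m b (Yb w) = n%:R *: bs w.
  rewrite /bs /bias scalerA mulfV ?scale1r ?pnatr_eq0 -?lt0n //.
  have -> : (Yb w *m D)^T *m b (Yb w) = D^T *m \sum_i h (y (S i w)) *: y (S i w).
    rewrite trmx_mul -mulmxA; congr (_ *m _); apply/colP => j.
    rewrite mxE summxE; apply: eq_bigr => i _.
    by rewrite bE !mxE mulrC.
  by rewrite mulmx_sumr; apply: eq_bigr => i _; rewrite -scalemxAr.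
(* Off [B3], with [sigma_min] at least [s], the truncation in [beta] is inactive. *)
have GbK : dotv (Gb (Yb w)) (Gb (Yb w)) <= K.
  apply: le_trans (lpinv_bound s0 sw _) _; rewrite bsE dotvZl dotvZr mulrA -expr2.
  have p4 : 0 < s ^+ 4 by rewrite exprn_gt0.
  rewrite ler_pdivrMl // [leRHS]mulrC; apply: le_trans Ktau3.
  by apply: ler_wpM2l; [exact: sqr_ge0 | exact: ltW].
have betaE : beta (Yb w) = Gb (Yb w) by rewrite /beta GbK.
have -> : (\col_i (r (S i w) + h (y (S i w))) : 'cV[R]_n) =
    \col_i r (S i w) + b (Yb w).
  by apply/colP => i; rewrite bE !mxE.
rewrite mulmxDr -nzE -/(Gb _) dotvDl !dotvDr (dotvC (nz w)) -betaE.
have : dotv (beta (Yb w)) (beta (Yb w)) <= K by exact: bK.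
move: n1 n4; set a := dotv (nz w) _; set c := dotv _ (nz w).
set e := dotv (beta _) (beta _) => h1 h4 hK.
apply: (@le_trans _ _ ((tau1 + eps) + eps + (eps + K))); last first.
  by rewrite le_eqVlt; apply/orP; left; apply/eqP; ring.
by apply: lerD; [apply: lerD|apply: lerD]; rewrite // ltW.
Qed.

End ColumnBound.

(** * Bounds for a fixed dimension *)

Section FixedDimension.
Context {R : realType} (c : R) (c_const : singular_value_constant c).
Context (N m n : nat) (rho : R) (C : 'M[R]_N) (C_posdef : posdef C) (mu : 'cV[R]_N).
Local Notation M := m.+1.
Context d (T : measurableType d) (P : probability T R) (A : 'M[R]_(M, N)).
Context (X : {RV P >-> 'cV[R]_N}) (Z : {RV P >-> 'cV[R]_M}).
Hypothesis model : linear_model X Z.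
Local Notation Y := (observation A X Z).
Local Notation E := (estimation_error A X Z).
Context (condE : T -> 'cV[R]_N) (condexp : 'cV[R]_N -> T -> R).
Hypothesis condE_version : forall i : 'I_N,
  cond_expectation P Y (coordinate E i) (coordinate condE i).
Hypothesis condexp_version : forall alpha : 'cV[R]_N,
  cond_expectation P Y
    (fun w => expR ((alpha^T *m invmx (sqrtmx C) *m (E w - condE w)) ord0 ord0))
    (condexp alpha).
Hypothesis hyp_i : {ae P, forall w, forall alpha : 'cV[R]_N,
  condexp alpha w <= expR (norm2 alpha ^+ 2 / 2)}.
Hypothesis hyp_ii : forall i : 'I_N,
  {ae P, forall w, `|condE w i ord0| <= mu i ord0}.
Hypothesis hyp_iii : subgaussian_vec P rho
  (fun w => invmx (sqrtmx (covmx P Y)) *m Y w).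
Context d' (Omega : measurableType d') (Q : probability Omega R).
Context (S : 'I_n -> {RV Q >-> ('cV[R]_N * 'cV[R]_M)%type}).
Hypothesis S_iid : iid_samples P X Y S.

Local Notation pair := ('cV[R]_N * 'cV[R]_M)%type.
Let XY w : pair := (X w, Y w).
Let CY := covmx P Y.
Let Sq := sqrtmx CY.
Let D := invmx Sq.
Let Theta := Theta_star A X Z.
Let y : pair -> 'cV[R]_M := snd.

Let mX : measurable_fun setT (X : T -> 'cV[R]_N).
Proof. exact: measurable_funPT. Qed.

Let mY : measurable_fun setT Y.
Proof. exact: measurable_observation model. Qed.

Let mXY : measurable_fun setT XY.
Proof. exact: measurable_fun_pair. Qed.

Let mS i : measurable_fun setT (S i : Omega -> pair).
Proof. exact: measurable_funPT. Qed.

Let my : measurable_fun setT y.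
Proof. exact: measurable_snd. Qed.

Let indS : mutually_independent_RV Q (fun i => S i : Omega -> pair).
Proof. by case: S_iid. Qed.

Let sameS i : same_law Q P (S i) XY.
Proof. by case: S_iid. Qed.

Let CYp : posdef CY.
Proof. exact: posdef_covmx_observation model. Qed.

Let Sqp : posdef Sq. Proof. by have [] := sqrtmxP CYp. Qed.
Let SqSq : Sq *m Sq = CY. Proof. by have [] := sqrtmxP CYp. Qed.
Let Squ : Sq \in unitmx. Proof. exact: posdef_unit. Qed.
Let Sqs : Sq^T = Sq. Proof. by have [] := Sqp. Qed.
Let Ds : D^T = D. Proof. by rewrite trmx_inv Sqs. Qed.
Let L2Y : L2v P Y. Proof. exact: L2v_observation model. Qed.
Let mY0 : mean_zero P Y. Proof. exact: mean_zero_observation model. Qed.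

(** The second moment of [Delta^T *m Y] is the trace of [Delta^T *m CY *m Delta]; splitting [CY] as
    [Sq *m Sq] exhibits a Frobenius norm, hence a sum over columns. *)
Lemma expected_error (Delta : 'M[R]_(M, N)) :
  'E_P[fun w => (norm2 (Delta^T *m Y w) ^+ 2)%R]%E = (frobenius_sq (Sq *m Delta))%:E.
Proof.
rewrite unlock integral_norm2_sqr; last exact: L2v_mul.
rewrite ipmx_mull ?ipmx_mulr //; last exact: L2v_mul.
rewrite trmxK frobenius_sq_tr trmx_mul Sqs -covmx_ipmx // -/CY -SqSq.
by rewrite !mulmxA.
Qed.

Let DY0 : mean_zero P (fun w => D *m Y w). Proof. exact: mean_zero_mul. Qed.
Let L2DY : L2v P (fun w => D *m Y w). Proof. exact: L2v_mul. Qed.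

Let covDY : covmx P (fun w => D *m Y w) = 1%:M.
Proof.
rewrite covmx_ipmx // ipmx_mull // ipmx_mulr // -covmx_ipmx // -/CY -SqSq Ds.
by rewrite !mulmxA mulVmx // mul1mx mulmxV.
Qed.

(** The rows [D *m y (S i w)] are whitened copies of [Y]; centring, isotropy and sub-Gaussianity are
    transported from [P] to [Q] by equality of laws. *)
Lemma sigma_min_tail (s t : R) : (0 < n)%N -> 0 <= t ->
  s <= Num.sqrt n%:R - c * rho ^+ 2 * (Num.sqrt M%:R + Num.sqrt t) ->
  (Q [set w | (sigma_min (rows_of S y w *m D) < s)%R] <= (2 * expR (- t))%:E)%E.
Proof.
move=> n0 t0 st.
pose W i w := D *m y (S i w).
have mW i : measurable_fun setT (W i).
  apply/measurable_mxP; apply: measurable_mulmx; first exact: measurable_cst_mx.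
  by apply/measurable_mxP; exact: measurableT_comp.
pose W' i : {RV Q >-> 'cV[R]_M} := mfun_Sub (mem_set (mW i)).
have mDy : measurable_mx (fun p : pair => D *m y p).
  by apply: measurable_mulmx; [exact: measurable_cst_mx | exact/measurable_mxP].
have indW : mutually_independent_RV Q (fun i => W' i : Omega -> 'cV[R]_M).
  move=> J B mB.
  have mBi i : measurable ((fun p : pair => D *m y p) @^-1` B i).
    rewrite -[X in measurable X]setTI.
    by have /measurable_mxP h := mDy; exact: h.
  exact: (indS J mBi).
have Q_P i (f : 'cV[R]_M -> \bar R) : measurable_fun setT f ->
    (\int[Q]_w f (W i w) = \int[P]_w f (D *m Y w))%E.
  move=> mf; apply: (same_law_integral (mS i) mXY (sameS i) (f := fun p => f (D *m y p))).
  by apply: measurableT_comp => //; exact/measurable_mxP.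
have mcoord j : measurable_fun setT (fun v : 'cV[R]_M => (v j ord0)%:E).
  by apply/measurable_EFinP; exact: measurable_entry.
have mean0 i : mean_zero Q (W' i).
  move=> j; have := DY0 j; rewrite unlock => <-.
  exact: (Q_P i (fun v => (v j ord0)%:E)).
have isoW i : [/\ subgaussian_vec Q rho (W' i), mean_zero Q (W' i) &
    covmx Q (W' i) = 1%:M].
  split=> //.
  - move=> a a1; have [rho0 iV sub] := hyp_iii a1.
    have mdot : measurable_fun setT (fun v : 'cV[R]_M => (a^T *m v) ord0 ord0).
      rewrite (_ : (fun v => _) = (fun v => dotv a v)) //.
      under eq_fun do rewrite dotvE.
      by apply: measurable_sum => j; apply: measurable_funM => //; exact: measurable_entry.
    split=> //.
    - apply: (same_law_integrable (mS i) mXY (sameS i)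
        (f := fun p => ((a^T *m (D *m y p)) ord0 ord0)%:E)); last exact: iV.
      apply/measurable_EFinP.
      by apply: (measurableT_comp mdot); exact/measurable_mxP.
    move=> l; have := sub l; rewrite unlock.
    rewrite -(Q_P i (fun v => ((a^T *m v) ord0 ord0)%:E)); last exact/measurable_EFinP.
    set z := fine _; rewrite -(Q_P i (fun v =>
      (expR (l * ((a^T *m v) ord0 ord0 - z)))%:E)) //.
    apply/measurable_EFinP; apply: measurableT_comp => //.
    by apply: measurable_funM => //; exact: measurable_funB.
  rewrite covmx_ipmx // -[RHS]covDY covmx_ipmx //; apply/matrixP => j k.
  rewrite !mxE /ip; congr fine.
  apply: (Q_P i (fun v => (v j ord0 * v k ord0)%:E)).
  by apply/measurable_EFinP; apply: measurable_funM; exact: measurable_entry.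
pose Wmx w : 'M[R]_(n, M) := \matrix_(i, j) W' i w j ord0.
have WE w : Wmx w = rows_of S y w *m D.
  apply/matrixP => i j; rewrite /Wmx [LHS]mxE [LHS]/= [LHS]mxE [RHS]mxE.
  apply: eq_bigr => k _.
  have DC : D j k = D k j by rewrite -[in LHS]Ds mxE.
  by rewrite DC mulrC /rows_of mxE.
have mWmx : measurable_mx Wmx.
  move=> i j; under eq_fun do rewrite mxE.
  by have /measurable_mxP h := mW i; exact: h.
have := c_const n0 (isT : (0 < M)%N) indW isoW t0.
rewrite /=; set ev := [set w | _] => Pev.
have mlow x : measurable [set w | x <= sigma_min (Wmx w)].
  exact: measurable_le_sigma_min.
(* Monotonicity of [Q] asks for a measurable event; the middle inequality in [ev] always holds and
   drops out. *)
have mev : measurable ev.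
  rewrite (_ : ev = [set w | Num.sqrt n%:R -
      c * rho ^+ 2 * (Num.sqrt M%:R + Num.sqrt t) <= sigma_min (Wmx w)] `&`
    [set w | sigma_max (Wmx w) <= Num.sqrt n%:R +
      c * rho ^+ 2 * (Num.sqrt M%:R + Num.sqrt t)]).
    by apply: measurableI => //; exact: measurable_ge_sigma_max.
  by apply/seteqP; split=> w /= [] // *; split => //; exact: sigma_min_le_max.
have bE : [set w | sigma_min (rows_of S y w *m D) < s] =
    ~` [set w | s <= sigma_min (Wmx w)].
  by apply/seteqP; split=> w /=; rewrite WE ltNge => /negP.
rewrite bE probability_setC //.
have le_ev : (Q ev <= Q [set w | (s <= sigma_min (Wmx w))%R])%E.
  apply: le_measure; rewrite ?inE // => w [h _ _] /=.
  exact: le_trans st h.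
have := le_trans Pev le_ev.
have : Q [set w | s <= sigma_min (Wmx w)] \is a fin_num by exact: fin_num_measure.
case: (Q _) => // r _; rewrite !lee_fin lerBlDr => h.
by rewrite lerBlDr addrC.
Qed.

Lemma column_tail (k : 'I_N) (s eps tau1 tau3 K q : R) :
  (0 < n)%N -> 0 < s -> 0 < eps -> 0 <= tau3 ->
  C k k * M%:R <= tau1 * s ^+ 2 ->
  3 / 2 * rho ^+ 2 * mu k ord0 ^+ 2 * M%:R <= tau3 * n%:R ->
  n%:R ^+ 2 * (tau3 + eps) <= K * s ^+ 4 ->
  column_rate eps tau1 tau3 K q ->
  exists2 B, measurable B & (Q B <= (3 * q ^+ M)%:E)%E /\
    forall w, ~ B w -> s <= sigma_min (rows_of S y w *m D) ->
      let e := lpinv (rows_of S y w *m D) *m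
               col k (sample_X S w - sample_Y S w *m Theta) in
      dotv e e <= tau1 + K + 3 * eps.
Proof.
move=> n0 s0 eps0 t0 h1 h3 hK hq.
have [h [mh hmu condEh Eh0]] := cond_expectation_bounded mY (condE_version k) (hyp_ii k).
(* [h] is the version of the conditional mean of the error and [r] the remaining noise, both as
   functions of a sample. *)
pose r (p : pair) := (p.1 - Theta^T *m p.2) k ord0 - h p.2.
have mr : measurable_fun setT r.
  apply: measurable_funB; last exact: measurableT_comp.
  rewrite /r; under eq_fun do rewrite !mxE; apply: measurable_funB.
    exact: measurableT_comp (measurable_entry k ord0) measurable_fst.
  apply: measurable_sum => j; apply: measurable_funM => //.
  exact: measurableT_comp (measurable_entry j ord0) measurable_snd.
have rXY w : r (XY w) = coordinate E k w - h (Y w) by [].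
have [SCp SC2] := sqrtmxP C_posdef.
have Ckk : 0 <= C k k.
  have [_ /(_ (delta_mx k ord0))] := posdef_psd C_posdef.
  rewrite /qform -colE dotvE (bigD1 k) //= big1 ?addr0; last first.
    by move=> i ik; rewrite !mxE (negPf ik) mul0r.
  by rewrite !mxE !eqxx mul1r.
have cond l : exists f : 'cV[R]_M -> R,
  [/\ measurable_fun setT f,
      forall z, 0 <= f z <= expR (C k k * l ^+ 2 / 2) &
      forall i B, measurable B ->
        (\int[Q]_w (\1_B (y (S i w)) * expR (l * r (S i w)))%:E =
         \int[Q]_w (\1_B (y (S i w)) * f (y (S i w)))%:E)%E].
  (* This direction cancels the inverse square root of [C], leaving [l] times the coordinate [k],
     and its squared norm is [C k k * l ^+ 2]; the trace of [C] will arise by summing over [k]. *)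
  pose alpha : 'cV[R]_N := l *: (sqrtmx C *m delta_mx k ord0).
  have SCs : (sqrtmx C)^T = sqrtmx C by case: SCp.
  have aE (v : 'cV[R]_N) : (alpha^T *m invmx (sqrtmx C) *m v) ord0 ord0 = l * v k ord0.
    rewrite /alpha linearZ /= trmx_mul SCs -!scalemxAl.
    rewrite mulmxK; last exact: posdef_unit.
    by rewrite trmx_delta -rowE !mxE.
  have na : norm2 alpha ^+ 2 = C k k * l ^+ 2.
    rewrite norm2_sqr /alpha dotvZl dotvZr dotv_mull.
    rewrite SCs mulmxA SC2 -colE dotvE (bigD1 k) //= big1 ?addr0.
      by rewrite !mxE !eqxx mul1r mulrA -expr2 mulrC.
    by move=> i ik; rewrite !mxE (negPf ik) mul0r.
  have hK' : {ae P, forall w, condexp alpha w <= expR (C k k * l ^+ 2 / 2)}.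
    by rewrite -na; apply: filterS hyp_i => w /(_ alpha).
  have [f [mf f0K fE]] := cond_expectation_nonneg mY (condexp_version alpha)
    (fun w => expR_ge0 _) hK'.
  exists f; split => // i B mB.
  have mind : measurable_fun setT (\1_B : 'cV[R]_M -> R) by exact: measurable_indic.
  have mexp : measurable_fun setT (fun p : pair => \1_B (y p) * expR (l * r p)).
    apply: measurable_funM; first exact: measurableT_comp.
    by apply: measurableT_comp => //; exact: measurable_funM.
  rewrite (same_law_integral (mS i) mXY (sameS i)
    (f := fun p => (\1_B (y p) * expR (l * r p))%:E)); last exact/measurable_EFinP.
  rewrite (same_law_integral (mS i) mXY (sameS i)
    (f := fun p => (\1_B (y p) * f (y p))%:E)); last first.
    by apply/measurable_EFinP; apply: measurable_funM; exact: measurableT_comp.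
  rewrite -[RHS](fE B mB); apply: ae_eq_integral => //.
  - by apply/measurable_EFinP; exact: measurableT_comp mexp mXY.
  - apply/measurable_EFinP; apply: measurable_funM.
      exact: measurableT_comp.
    have [iV _ _ _] := condexp_version alpha.
    by apply/measurable_EFinP; case/integrableP: iV.
  apply: filterS condEh => w hw _; congr (_ * expR _)%:E.
  by rewrite aE rXY -hw /coordinate !mxE.
(* The error is orthogonal to [Y], and so is the error minus [h (Y w)], whose conditional mean
   vanishes; hence so is [h (Y w)]. *)
have Yh0 j : ip P (coordinate Y j) (fun w => h (Y w)) = 0.
  have L2h : L2 P (fun w => h (Y w)).
    by apply: (@bounded_L2 _ _ _ _ _ (mu k ord0)) => //; exact: measurableT_comp.
  have L2E : L2 P (coordinate E k) by exact: (L2v_estimation_error A model k).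
  have L2Eh : L2 P (fun w => coordinate E k w + -1 * h (Y w)).
    by apply: L2D => //; exact: L2Z.
  have e0 : ip P (coordinate Y j) (fun w => coordinate E k w + -1 * h (Y w)) = 0.
    apply: (@ip_orthogonal _ _ _ P _ _ Y (fun v => v j ord0)) => //.
    - exact: measurable_entry.
    - exact: L2Y.
    move=> B mB; rewrite -[RHS](Eh0 B mB); apply: eq_integral => w _.
    by rewrite mulN1r.
  have := ipmx_error_observation A model => /matrixP/(_ k j).
  rewrite !mxE ipC => EY0; move: e0.
  rewrite ipC ipDl //; last exact: L2Z.
  by rewrite ipZl // (ipC P _ (coordinate Y j)) EY0 add0r mulN1r ipC => /eqP;
    rewrite oppr_eq0 => /eqP.
have DYh0 j : ip P (coordinate (fun w => D *m Y w) j) (fun w => h (Y w)) = 0.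
  have L2h : L2 P (fun w => h (Y w)).
    by apply: (@bounded_L2 _ _ _ _ _ (mu k ord0)) => //; exact: measurableT_comp.
  rewrite coordinate_mul ip_suml //; last by move=> l; exact: L2Z.
  by rewrite big1 // => l _; rewrite ipZl // Yh0 mulr0.
have mhY : measurable_fun setT (fun w => h (Y w)) by exact: measurableT_comp.
have mgf i (a : 'cV[R]_M) :
  (\int[Q]_w (expR (dotv a (D^T *m y (S i w)) * h (y (S i w))))%:E <=
   (expR (3 / 2 * rho ^+ 2 * mu k ord0 ^+ 2 * dotv a a / 2))%:E)%E.
  rewrite (same_law_integral (mS i) mXY (sameS i)
    (f := fun p => (expR (dotv a (D^T *m y p) * h (y p)))%:E)).
    rewrite Ds; exact: (whitened_bias_mgf L2DY DY0 hyp_iii mhY (fun w => hmu (Y w)) DYh0).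
  apply/measurable_EFinP; apply: measurableT_comp => //; apply: measurable_funM.
    under eq_fun do rewrite dotvE.
    apply: measurable_sum => j; apply: measurable_funM => //.
    by apply: measurable_mulmx; [exact: measurable_cst_mx | exact/measurable_mxP].
  exact: measurableT_comp.
have [B mB [QB hB]] := column_bound indS mS my mr mh Ckk cond mgf n0 s0 eps0 t0 h1 h3 hK hq.
exists B => //; split => // w Bw sw; rewrite /=.
have -> : col k (sample_X S w - sample_Y S w *m Theta) =
    \col_i (r (S i w) + h (y (S i w))).
  apply/colP => i; rewrite !mxE /r subrK !mxE; congr (_ - _).
  by apply: eq_bigr => j _; rewrite !mxE mulrC.
exact: hB.
Qed.

(** [B] is fixed before [Theta_hat], so it is measurable although the estimator is an arbitrary
    minimizer. Its mass collects one singular value event and three events for each of the [N]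
    columns. *)
Lemma sample_bound (s t eps q : R) (tau1 tau3 K : 'I_N -> R) :
  (0 < n)%N -> 0 < s -> 0 <= t -> 0 < eps ->
  s <= Num.sqrt n%:R - c * rho ^+ 2 * (Num.sqrt M%:R + Num.sqrt t) ->
  (forall k, 0 <= tau3 k) ->
  (forall k, C k k * M%:R <= tau1 k * s ^+ 2) ->
  (forall k, 3 / 2 * rho ^+ 2 * mu k ord0 ^+ 2 * M%:R <= tau3 k * n%:R) ->
  (forall k, n%:R ^+ 2 * (tau3 k + eps) <= K k * s ^+ 4) ->
  (forall k, column_rate eps (tau1 k) (tau3 k) (K k) q) ->
  exists2 B, measurable B & (Q B <= (2 * expR (- t) + N%:R * (3 * q ^+ M))%:E)%E /\
    forall w, ~ B w -> forall Theta_hat,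
      least_squares (sample_X S w) (sample_Y S w) Theta_hat ->
      ('E_P[fun v => (norm2 (Theta_hat^T *m Y v - (Theta_star A X Z)^T *m Y v) ^+ 2)%R]
       <= (\sum_k (tau1 k + K k + 3 * eps))%:E)%E.
Proof.
move=> n0 s0 t0 eps0 st tau30 h1 h3 hK hq.
have /choice[B hB] := fun k => (exists2P _ _).1 (@column_tail k s eps (tau1 k)
  (tau3 k) (K k) q n0 s0 eps0 (tau30 k) (h1 k) (h3 k) (hK k) (hq k)).
pose B0 := [set w | sigma_min (rows_of S y w *m D) < s].
have mB0 : measurable B0.
  rewrite (_ : B0 = ~` [set w | s <= sigma_min (rows_of S y w *m D)]).
    apply: measurableC; apply: measurable_le_sigma_min.
    apply: measurable_mulmx; last exact: measurable_cst_mx.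
    by apply/measurable_mxP; exact: measurable_rows_of.
  by apply/seteqP; split=> w; rewrite /B0 /= ltNge => /negP.
have mB k : measurable (B k) by case: (hB k).
exists (B0 `|` \big[setU/set0]_(k <- enum 'I_N) B k).
  by apply: measurableU => //; exact: bigsetU_measurable.
split.
  apply: le_trans (measureU2 _ mB0 _) _; first exact: bigsetU_measurable.
  rewrite EFinD; apply: leeD; first exact: sigma_min_tail.
  rewrite -[X in (X%:R * _)%R](size_enum_ord N).
  elim: (enum 'I_N) => [|k r IH].
    by rewrite big_nil measure0 mul0r.
  rewrite big_cons /= -natr1 addrC mulrDl mul1r EFinD.
  apply: le_trans (measureU2 _ (mB k) _) _; first exact: bigsetU_measurable.
  by apply: leeD => //; have [_ [QB _]] := hB k; exact: QB.
move=> w Bw Th lsq.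
have sw : s <= sigma_min (rows_of S y w *m D).
  by rewrite leNgt; apply/negP => H; apply: Bw; left.
have Bk k : ~ B k w.
  by move=> H; apply: Bw; right; rewrite -bigcup_seq; exists k => //=; rewrite mem_enum.
have -> : (fun v => norm2 (Th^T *m Y v - (Theta_star A X Z)^T *m Y v) ^+ 2) =
   (fun v => norm2 ((Th - Theta)^T *m Y v) ^+ 2).
  by apply/funext => v; rewrite linearB /= mulmxBl.
rewrite expected_error lee_fin.
pose W := rows_of S y w *m D.
have YsE : rows_of S y w = sample_Y S w by [].
(* Since the sample matrix is [W *m Sq], the normal equations for [Th] become those of [W] for
   [Sq *m (Th - Theta)]. *)
have -> : Sq *m (Th - Theta) = lpinv W *m (sample_X S w - sample_Y S w *m Theta).
  apply: (lpinv_solve s0 sw); rewrite -/W.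
  have ne := least_squares_normal_eq n0 lsq.
  rewrite /W trmx_mul Ds YsE -!mulmxA; congr (_ *m _).
  by rewrite mulKmx // !mulmxBr !mulmxA ne.
rewrite frobenius_sqE; apply: ler_sum => k _.
rewrite colE -mulmxA -colE.
by have [_ [_ H]] := hB k; exact: H.
Qed.

End FixedDimension.

(** * Almost sure upper limits by Borel-Cantelli *)

Section BorelCantelli.
Context {R : realType} d (T : measurableType d) (Q : probability T R).

Lemma geometric_nneseries_lty (a q : R) : 0 <= q -> q < 1 ->
  (\sum_(0 <= i <oo) (a * q ^+ i)%:E < +oo)%E.
Proof.
move=> q0 q1; have q1' : `|q| < 1 by rewrite ger0_norm.
have cg := @cvg_geometric_series _ a q q1'.
rewrite (_ : (\sum_(0 <= i <oo) _)%E = limn (EFin \o series (geometric a q))).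
  rewrite EFin_lim; last by apply/cvg_ex; eexists; exact: cg.
  by rewrite ltry.
by congr (limn _); apply/funext => k /=; rewrite /series /= sumEFin.
Qed.

(** The exceptional sets [B] carry the measurability, so that [u] can be any sequence of functions,
    such as the errors of arbitrarily selected minimizers. *)
Lemma ae_limn_esup_le (u : nat -> T -> \bar R) (l a q : R) (M0 : nat) :
  0 <= a -> 0 <= q -> q < 1 ->
  (forall M, (M0 <= M)%N -> exists2 B, measurable B &
     (Q B <= (a * q ^+ M)%:E)%E /\ forall w, ~ B w -> (u M w <= l%:E)%E) ->
  {ae Q, forall w, (limn_esup (fun M => u M w) <= l%:E)%E}.
Proof.
move=> a0 q0 q1 hB.
have /choice[B hB'] : forall M, exists B, [/\ measurable B,
    (Q B <= (a * q ^+ M)%:E)%E &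
    (M0 <= M)%N -> forall w, ~ B w -> (u M w <= l%:E)%E].
  move=> M; have [/hB[B mB [QB uB]]|M0M] := leqP M0 M; first by exists B.
  (* Below [M0] nothing is asserted, and the empty set keeps the series summable. *)
  exists set0; split => //; first by rewrite measure0 lee_fin mulr_ge0 // exprn_ge0.
have mB M : measurable (B M) by case: (hB' M).
have Q0 : Q (lim_sup_set B) = 0%E.
  apply: lim_sup_set_cvg0 => //.
  apply: le_lt_trans (geometric_nneseries_lty a q0 q1).
  by apply: lee_nneseries => [M _ _|M _] //; case: (hB' M).
exists (lim_sup_set B); split => //.
  by apply: bigcapT_measurable => k; apply: bigcup_measurable.
move=> w /= nle; apply: contrapT => nB; apply: nle.
have [k Bk] : exists k, forall M, (k <= M)%N -> ~ B M w.
  apply: contrapT => H; apply: nB => k _; apply: contrapT => nBk; apply: H.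
  by exists k => M kM BM; apply: nBk; exists M.
rewrite limn_esup_lim; apply: lime_le; first exact: is_cvg_esups.
exists (maxn k M0) => // M /= kM; apply: ge_ereal_sup => _ [p /= Mp <-].
have [_ _ h] := hB' p; apply: h.
  by apply: leq_trans Mp; apply: leq_trans kM; rewrite leq_maxr.
by apply: Bk; apply: leq_trans Mp; apply: leq_trans kM; rewrite leq_maxl.
Qed.

End BorelCantelli.

(** * Choice of parameters and limits *)

Section Asymptotics.
Context {R : realType}.

Lemma cvg_exprn (u : nat -> R) (l : R) k :
  u j @[j --> \oo] --> l -> u j ^+ k @[j --> \oo] --> l ^+ k.
Proof.
move=> ul; apply: (cvg_comp u (fun x => x ^+ k) (G := nbhs l)); first exact: ul.
exact: exprn_continuous.
Qed.

Lemma cvg_limit_bound N (u v : 'I_N -> R) (g gamma : R) (sig : nat -> R) :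
  0 < g -> sig j @[j --> \oo] --> g ->
  \sum_(k < N) (u k * gamma / sig j ^+ 2 + harmonic j +
     (v k * gamma + 2 * harmonic j) / sig j ^+ 4 + 3 * harmonic j) @[j --> \oo]
  --> \sum_(k < N) (u k * gamma / g ^+ 2 + v k * gamma / g ^+ 4).
Proof.
move=> g0 cs; apply: cvg_sumr => k.
have ch := @cvg_harmonic R.
have cV p : (sig j ^+ p)^-1 @[j --> \oo] --> (g ^+ p)^-1.
  apply: (@cvgV _ _ _ _ (fun j => sig j ^+ p)); last exact: cvg_exprn.
  by rewrite gt_eqF // exprn_gt0.
have -> : u k * gamma / g ^+ 2 + v k * gamma / g ^+ 4 =
   u k * gamma / g ^+ 2 + 0 + (v k * gamma + 2 * 0) / g ^+ 4 + 3 * 0.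
  by rewrite !mulr0 !addr0.
apply: cvgD; last exact: cvgMr.
apply: cvgD; first by apply: cvgD => //; exact: cvgMr.
apply: cvgM => //; apply: cvgD; first exact: cvg_cst.
exact: cvgMr.
Qed.

(* delta is small enough that the deviation sqrt (delta M) in the singular value
   bound costs less than half of the gap between sig and its limit. *)
Lemma eventually_parameters N (b gamma sig eps : R) (u v : 'I_N -> R)
    (n : nat -> nat) :
  0 <= b -> 0 < gamma -> 0 < sig -> sig < 1 - b * Num.sqrt gamma -> 0 < eps ->
  (fun M => M%:R / (n M)%:R : R) @ \oo --> gamma ->
  exists2 delta, 0 < delta & \forall M \near \oo,
    [/\ (0 < n M)%N,
        sig * Num.sqrt (n M)%:R <= Num.sqrt (n M)%:R -
          b * (Num.sqrt M%:R + Num.sqrt (delta * M%:R)),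
        forall k, u k * M%:R <=
          (u k * gamma / sig ^+ 2 + eps) * (sig * Num.sqrt (n M)%:R) ^+ 2,
        forall k, v k * M%:R <= (v k * gamma + eps) * (n M)%:R &
        forall k, (n M)%:R ^+ 2 * (v k * gamma + eps + eps) <=
          (v k * gamma + 2 * eps) / sig ^+ 4 * (sig * Num.sqrt (n M)%:R) ^+ 4].
Proof.
move=> b0 g0 s0 sg e0 nlim.
pose a := b * Num.sqrt gamma; pose g := 1 - a.
have a0 : 0 <= a by rewrite mulr_ge0.
pose rd := (g - sig) / (2 * (a + 1)).
have a1 : 0 < a + 1 by rewrite ltr_wpDl.
have gs : 0 < g - sig by rewrite subr_gt0.
have rd0 : 0 < rd by rewrite divr_gt0 // mulr_gt0.
have s2 : 0 < sig ^+ 2 by rewrite exprn_gt0.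
have s4 : 0 < sig ^+ 4 by rewrite exprn_gt0.
(* The square makes the deviation sqrt (delta M) equal to [rd] times sqrt M. *)
exists (rd ^+ 2); first by rewrite exprn_gt0.
have clim (x : R) : x * (M%:R / (n M)%:R) @[M --> \oo] --> x * gamma.
  by apply: cvgMr.
have near_u : \forall M \near \oo, forall k,
    u k * (M%:R / (n M)%:R) < u k * gamma + eps * sig ^+ 2.
  apply: filter_forall => k; apply: (cvgr_lt _ (clim _)).
  by rewrite ltrDl mulr_gt0.
have near_v : \forall M \near \oo, forall k,
    v k * (M%:R / (n M)%:R) < v k * gamma + eps.
  by apply: filter_forall => k; apply: (cvgr_lt _ (clim _)); rewrite ltrDl.
(* Divided by sqrt n, the requirement on the singular values depends only on the ratio M / n. *)
have near_s : \forall M \near \oo,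
    b * Num.sqrt (M%:R / (n M)%:R) * (1 + rd) < 1 - sig.
  have c : b * Num.sqrt (M%:R / (n M)%:R) * (1 + rd) @[M --> \oo] --> a * (1 + rd).
    apply: cvgMl; apply: cvgMr.
    apply: (cvg_comp _ Num.sqrt (G := nbhs gamma)); first exact: nlim.
    exact: sqrt_continuous.
  apply: (cvgr_lt _ c).
  have e1 : rd * (2 * (a + 1)) = g - sig by rewrite mulfVK // gt_eqF // mulr_gt0.
  have h1 : 0 <= rd * a by rewrite mulr_ge0 // ltW.
  by rewrite /g in e1 gs; nra.
have near_0 : \forall M \near \oo, 0 < M%:R / (n M)%:R :> R.
  exact: (cvgr_gt _ nlim).
near=> M.
have r0 : 0 < M%:R / (n M)%:R :> R by near: M.
(* As division by zero gives [0], a positive ratio forces [n M] to be positive. *)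
have nM : (0 < n M)%N.
  by rewrite lt0n; apply: contraTneq r0 => ->; rewrite invr0 mulr0 ltxx.
have np : 0 < (n M)%:R :> R by rewrite ltr0n.
pose sn : R := Num.sqrt (n M)%:R.
have sn0 : 0 < sn by rewrite sqrtr_gt0.
have sn2 : sn ^+ 2 = (n M)%:R by rewrite sqr_sqrtr // ltW.
have sn4 : sn ^+ 4 = (n M)%:R ^+ 2 by rewrite -sn2 -exprM.
have ME : M%:R = M%:R / (n M)%:R * (n M)%:R :> R by rewrite mulfVK // gt_eqF.
split=> // [|k|k|k].
- have hs : b * Num.sqrt (M%:R / (n M)%:R) * (1 + rd) < 1 - sig by near: M.
  have sM : Num.sqrt M%:R = Num.sqrt (M%:R / (n M)%:R) * sn.
    by rewrite {1}ME sqrtrM // ltW.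
  have sdM : Num.sqrt (rd ^+ 2 * M%:R) = rd * Num.sqrt M%:R.
    by rewrite sqrtrM ?sqr_ge0 // sqrtr_sqr gtr0_norm.
  rewrite sdM sM -/sn.
  have := ler_wpM2r (ltW sn0) (ltW hs); nra.
- have hu : u k * (M%:R / (n M)%:R) < u k * gamma + eps * sig ^+ 2.
    by move: k; near: M.
  rewrite ME mulrA -/sn exprMn sn2 [leRHS]mulrA ler_pM2r //.
  by rewrite mulrDl mulfVK ?gt_eqF // (ltW hu).
- have hv : v k * (M%:R / (n M)%:R) < v k * gamma + eps by move: k; near: M.
  by rewrite ME mulrA ler_pM2r // (ltW hv).
rewrite -/sn exprMn mulrA mulfVK ?gt_eqF // sn4 mulrC.
by rewrite ler_pM2r ?exprn_gt0 // -addrA mulr2n mulrDl mul1r.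
Unshelve. all: by end_near. Qed.

End Asymptotics.

(** * Limit in the dimension, then in the tolerance *)

Theorem proposition5p17 (R : realType)
  (c : R) (c_gt0 : 0 < c) (c_const : singular_value_constant c)
  (N : nat) (rho : R) (C : 'M[R]_N) (C_posdef : posdef C) (mu : 'cV[R]_N)
  (d : nat -> measure_display) (T : forall M, measurableType (d M))
  (P : forall M, probability (T M) R)
  (A : forall M, 'M[R]_(M, N))
  (X : forall M, {RV (P M) >-> 'cV[R]_N})
  (Z : forall M, {RV (P M) >-> 'cV[R]_M})
  (model : forall M, (0 < M)%N -> linear_model (X M) (Z M))
  (Y := fun M => observation (A M) (X M) (Z M))
  (E := fun M => estimation_error (A M) (X M) (Z M))
  (* condE M = E[E | Y] and condexp M alpha is the conditional expectation of
     hypothesis (i) *)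
  (condE : forall M, T M -> 'cV[R]_N)
  (condE_version : forall M, (0 < M)%N -> forall i : 'I_N,
    cond_expectation (P M) (Y M) (coordinate (E M) i) (coordinate (condE M) i))
  (condexp : forall M, 'cV[R]_N -> T M -> R)
  (condexp_version : forall M, (0 < M)%N -> forall alpha : 'cV[R]_N,
    cond_expectation (P M) (Y M)
      (fun w => expR ((alpha^T *m invmx (sqrtmx C) *m (E M w - condE M w))
                        ord0 ord0))
      (condexp M alpha))
  (hyp_i : forall M, (0 < M)%N ->
    {ae P M, forall w, forall alpha : 'cV[R]_N,
      condexp M alpha w <= expR (norm2 alpha ^+ 2 / 2)})
  (hyp_ii : forall M, (0 < M)%N -> forall i : 'I_N,
    {ae P M, forall w, `|condE M w i ord0| <= mu i ord0})
  (hyp_iii : forall M, (0 < M)%N ->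
    subgaussian_vec (P M) rho
      (fun w => invmx (sqrtmx (covmx (P M) (Y M))) *m Y M w))
  (n : nat -> nat) (gamma : R)
  (n_lim : (fun M => M%:R / (n M)%:R : R) @ \oo --> gamma)
  (gamma_gt0 : 0 < gamma) (gamma_lt : gamma < 1 / (c ^+ 2 * rho ^+ 4))
  (d' : measure_display) (Omega : measurableType d') (Q : probability Omega R)
  (S : forall M, 'I_(n M) -> {RV Q >-> ('cV[R]_N * 'cV[R]_M)%type})
  (S_iid : forall M, (0 < M)%N -> iid_samples (P M) (X M) (Y M) (S M))
  (Theta_hat : forall M, Omega -> 'M[R]_(M, N))
  (Theta_hat_min : forall M, (0 < M)%N -> forall omega,
    least_squares (sample_X (S M) omega) (sample_Y (S M) omega)
      (Theta_hat M omega)) :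
  {ae Q, forall omega : Omega,
    (limn_esup (fun M =>
       'E_(P M)[fun w =>
         (norm2 ((Theta_hat M omega)^T *m Y M w
                - (Theta_star (A M) (X M) (Z M))^T *m Y M w) ^+ 2)%R])
     <= (eps_err c rho gamma C + eps_bias c rho gamma mu)%:E)%E}.
Proof.
have gr : gamma * (c ^+ 2 * rho ^+ 4) < 1.
  have [r0|r0] := eqVneq (c ^+ 2 * rho ^+ 4) 0; first by rewrite r0 mulr0.
  rewrite -ltr_pdivlMr // lt_neqAle eq_sym r0 mulr_ge0 ?sqr_ge0 //.
  by rewrite (exprM rho 2 2) sqr_ge0.
pose b := c * rho ^+ 2.
have b0 : 0 <= b by rewrite mulr_ge0 ?sqr_ge0 // ltW.
pose g := 1 - b * Num.sqrt gamma.
(* Up to squaring, this is the hypothesis on [gamma] in the form [gr]. *)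
have g0 : 0 < g.
  rewrite subr_gt0 ltNge; apply/negP => /(exprn_ege1 2); apply/negP.
  rewrite -ltNge exprMn sqr_sqrtr ?(ltW gamma_gt0) // mulrC.
  by rewrite /b exprMn -exprM.
pose kap (k : 'I_N) := 3 / 2 * rho ^+ 2 * mu k ord0 ^+ 2.
(* [sig j] approaches [g] strictly from below; the factor [1 / 2] keeps it positive even for
   [j = 0], where [harmonic j = 1]. *)
pose sig j := g * (1 - harmonic j / 2).
have h0 j : 0 < harmonic j :> R by exact: harmonic_gt0.
have h1 j : harmonic j <= 1 :> R by rewrite /harmonic invf_le1 // ler1n.
have sig0 j : 0 < sig j by rewrite mulr_gt0 // subr_gt0 ltr_pdivrMr //; have := h1 j; lra.
have sigg j : sig j < g by rewrite gtr_pMr // gtrDl oppr_lt0 divr_gt0.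
have csig : sig j @[j --> \oo] --> g * (1 - 0 * 2^-1).
  apply: cvgMr; apply: cvgB; first exact: cvg_cst.
  by apply: cvgMl; exact: cvg_harmonic.
rewrite mul0r subr0 mulr1 in csig.
have Ckk k : 0 <= C k k.
  have [_ /(_ (delta_mx k ord0))] := posdef_psd C_posdef.
  rewrite /qform -colE dotvE (bigD1 k) //= big1 ?addr0; last first.
    by move=> i ik; rewrite !mxE (negPf ik) mul0r.
  by rewrite !mxE !eqxx mul1r.
have kap0 k : 0 <= kap k.
  apply: mulr_ge0; last exact: sqr_ge0.
  by apply: mulr_ge0; [exact: divr_ge0 | exact: sqr_ge0].
pose tau1 j k := C k k * gamma / sig j ^+ 2 + harmonic j.
pose tau3 j k := kap k * gamma + harmonic j.
pose K j k := (kap k * gamma + 2 * harmonic j) / sig j ^+ 4.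
pose tot j := \sum_k (tau1 j k + K j k + 3 * harmonic j).
pose u M omega := 'E_(P M)[fun w => (norm2 ((Theta_hat M omega)^T *m Y M w
  - (Theta_star (A M) (X M) (Z M))^T *m Y M w) ^+ 2)%R]%E.
(* The tolerance [harmonic j] and the margin below [g] stay constant while [M] grows, so the tail
   rates do not depend on [M]. *)
have level j : {ae Q, forall omega, (limn_esup (fun M => u M omega) <= (tot j)%:E)%E}.
  have [delta d0 [M0 _ hM0]] := eventually_parameters (fun k => C k k) kap
    b0 gamma_gt0 (sig0 j) (sigg j) (h0 j) n_lim.
  pose rate k := Num.max (Num.max (chi2_rate (tau1 j k) (harmonic j))
    (chi2_rate (tau3 j k) (harmonic j))) (cross_rate (tau1 j k) (harmonic j) (K j k)).
  (* Starting the maximum at [expR (- delta)] covers the singular value event, and also the case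
     [N = 0] of no column. *)
  pose q := \big[Num.max/expR (- delta)]_k rate k.
  have t10 k : 0 <= tau1 j k.
    apply: addr_ge0; last exact: ltW.
    by apply: divr_ge0; [apply: mulr_ge0 => //|apply: exprn_ge0]; exact: ltW.
  have t30 k : 0 <= tau3 j k.
    by apply: addr_ge0; [apply: mulr_ge0 => //|]; exact: ltW.
  have K0 k : 0 <= K j k.
    apply: divr_ge0; last by apply: exprn_ge0; exact: ltW.
    by apply: addr_ge0; apply: mulr_ge0 => //; exact: ltW.
  have q1 : q < 1.
    apply/bigmax_ltP; split; first by rewrite expR_lt1 oppr_lt0.
    move=> k _; rewrite /rate gt_max gt_max; apply/andP; split.
      by apply/andP; split; exact: chi2_rate_lt1.
    exact: cross_rate_lt1.
  have qd : expR (- delta) <= q by exact: bigmax_ge_id.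
  have q0 : 0 <= q by apply: le_trans qd; exact: expR_ge0.
  have hq k : column_rate (harmonic j) (tau1 j k) (tau3 j k) (K j k) q.
    have := le_bigmax (expR (- delta)) rate k.
    by rewrite !ge_max => /andP[/andP[]].
  (* [maxn 1 M0] excludes the dimension [0], where no model is assumed. *)
  apply: (@ae_limn_esup_le _ _ _ Q u (tot j) (2 + N%:R * 3) q (maxn 1 M0)) => //.
  move=> [|m]; first by rewrite geq_max.
  rewrite geq_max => /andP[_ /hM0[n0 st c1 c3 c4]].
  have dm : 0 <= delta * m.+1%:R by rewrite mulr_ge0 // ltW.
  have s0 : 0 < sig j * Num.sqrt (n m.+1)%:R by rewrite mulr_gt0 // sqrtr_gt0 ltr0n.
  have M_gt0 := ltn0Sn m.
  have [B mB [QB hB]] := sample_bound c_const C_posdef (model _ M_gt0)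
    (condE_version _ M_gt0) (condexp_version _ M_gt0) (hyp_i _ M_gt0)
    (hyp_ii _ M_gt0) (hyp_iii _ M_gt0) (S_iid _ M_gt0) n0 s0 dm (h0 j) st t30 c1 c3
    c4 hq.
  exists B => //; split.
    have e : expR (- (delta * m.+1%:R)) <= q ^+ m.+1.
      by rewrite -mulNr mulrC expRM_natl; apply: lerXn2r => //; rewrite nnegrE expR_ge0.
    apply: le_trans QB _; rewrite lee_fin.
    have -> : (2 + N%:R * 3) * q ^+ m.+1 = 2 * q ^+ m.+1 + N%:R * (3 * q ^+ m.+1) by ring.
    by apply: lerD => //; rewrite ler_pM2l.
  by move=> w Bw; apply: (hB w Bw); exact: Theta_hat_min.
have ctot : tot j @[j --> \oo] --> eps_err c rho gamma C + eps_bias c rho gamma mu.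
  rewrite (_ : _ + _ = \sum_k (C k k * gamma / g ^+ 2 + kap k * gamma / g ^+ 4)).
    exact: cvg_limit_bound.
  rewrite /eps_err /eps_bias big_split /= -!mulr_suml; congr (_ + _).
  rewrite norm2_sqr dotvv_sqr -/b -/g; congr (_ * _ / _).
  by rewrite /kap -mulr_sumr.
(* The levels are countable, so one null set serves all of them, and the bound follows by letting
   [j] grow. *)
have := ae_foralln level; apply: filterS => omega hom.
have ctotE : (tot j)%:E @[j --> \oo] -->
    (eps_err c rho gamma C + eps_bias c rho gamma mu)%:E.
  by apply: cvg_EFin => //; exact: nearW.
rewrite -(cvg_lim _ ctotE) //; apply: lime_ge.
  by apply/cvg_ex; eexists; exact: ctotE.
by apply: nearW => j; exact: hom.
Qed.
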